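(* Let $N\geq 1$, let $p=(p_0,\dots,p_N)$ satisfy $p_j>0$ for all $j$ and $\sum_{0\le j\le N} p_j=1$, and let $\varphi_k(x)=r_kx+b_k$, $0\leq k\leq N$, be real affine maps with $r_k>0$ and $b_k\in\mathbb{R}$, having no common fixed point, and such that $\sum_{0\leq j\leq N}p_j\log r_j<0$. Let $\nu$ be the invariant measure of $((\varphi_k)_{0\le k\le N},p)$. Then $\nu$ is not Rajchman if and only if there exists an affine map $f(x)=ax+b$, with $a,b\in\mathbb{R}$ and $a\neq0$, such that the conjugate system $(f\circ \varphi_j\circ f^{-1})_{0\leq j\leq N}$ is in Pisot form, for some Pisot number $1/\lambda>1$, with invariant measure $w$ (for the same probability vector $p$) verifying that $\hat{w}(\lambda^{-k})$ does not converge to $0$ as $k\to+\infty$.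
   Context: Fourier transform and Rajchman property: for a Borel probability measure $\mu$ on $\mathbb{R}$, $\hat{\mu}(t)=\int_{\mathbb{R}}e^{2i\pi tx}\,d\mu(x)$ for $t\in\mathbb{R}$; $\mu$ is called Rajchman if $\hat{\mu}(t)\to0$ as $t\to+\infty$. Invariant measure: given affine maps $\varphi_k(x)=r_kx+b_k$ with $r_k>0$, $0\le k\le N$, and a probability vector $p$ with $\sum_j p_j\log r_j<0$, the invariant measure $\nu$ is the unique Borel probability measure on $\mathbb{R}$ such that $\nu=\sum_{0\leq j\leq N}p_j\,\nu\circ \varphi_j^{-1}$. Equivalently, if $(\varepsilon_n)_{n\ge0}$ are i.i.d. with $\mathbb{P}(\varepsilon_0=k)=p_k$, $\nu$ is the law of the almost surely convergent series $\sum_{l\geq0}b_{\varepsilon_l}r_{\varepsilon_0}\cdots r_{\varepsilon_{l-1}}$. Pisot number: a real algebraic integer $\theta>1$ whose conjugates (the other roots of its minimal monic polynomial) all have modulus strictly less than $1$ (integers $\geq2$ are included). For a Pisot number $\theta$ and $\alpha\in\mathbb{Q}[\theta]$, let $Tr_\theta(\alpha)\in\mathbb{Q}$ be the trace of the $\mathbb{Q}$-linear operator $x\mapsto\alpha x$ on $\mathbb{Q}[\theta]$. Define $\mathcal{T}(\theta)=\{\alpha\in\mathbb{Q}[\theta] : Tr_{\theta}(\theta^n\alpha)\in\mathbb{Z}\text{ for all large enough } n\geq0\}$. Pisot form: for $N\ge1$, a family of real affine maps $(\psi_k)_{0\leq k\leq N}$ is in Pisot form if there exist a Pisot number $1/\lambda>1$,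 relatively prime integers $(n_k)_{0\leq k\leq N}$ (i.e. $\gcd(n_0,\dots,n_N)=1$; the $n_k$ may be of any sign or zero) and $\mu_k\in\mathcal{T}(1/\lambda)$, $0\leq k\leq N$, such that $\psi_j(x)=\lambda^{n_j}x+\mu_j$ for all $0\leq j\leq N$. (The data $\lambda,(n_j),(\mu_j)$ are then uniquely determined.) *)

(* Defs.v *)
From mathcomp Require Import all_boot all_order all_algebra.
From mathcomp Require Import all_classical all_reals all_analysis.
From mathcomp Require Import complex.

Set Implicit Arguments.
Unset Strict Implicit.
Unset Printing Implicit Defensive.

Import Order.TTheory GRing.Theory Num.Theory numFieldNormedType.Exports.

Local Open Scope classical_set_scope.
Local Open Scope ring_scope.
Local Open Scope complex_scope.

(* [measurableTypeR R] is R with its Borel sigma-algebra; the integrand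
   e^(2 i pi t x) is integrated componentwise. [R[i]^o] carries the topology
   of the complex modulus. *)
Definition fourier (R : realType) (mu : probability (measurableTypeR R) R)
    (t : R) : R[i]^o :=
  (\int[mu]_x cos (2 * pi * t * x)) +i* (\int[mu]_x sin (2 * pi * t * x)).

Definition rajchman (R : realType) (mu : probability (measurableTypeR R) R) :=
  fourier mu t @[t --> +oo] --> 0.

Definition affine (R : realType) (a b : R) : R -> R := fun x => a * x + b.

Definition affine_inv (R : realType) (a b : R) : R -> R := fun y => (y - b) / a.

Lemma affineK (R : realType) (a b : R) :
  a != 0 -> cancel (affine a b) (affine_inv a b).
Proof. by move=> a0 x; rewrite /affine /affine_inv addrK mulrC mulKf. Qed.

Lemma affine_invK (R : realType) (a b : R) :
  a != 0 -> cancel (affine_inv a b) (affine a b).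
Proof. by move=> a0 y; rewrite /affine /affine_inv mulrC divfK// subrK. Qed.

Definition conj_family (R : realType) (I : Type) (a b : R) (phi : I -> R -> R) :
    I -> R -> R :=
  fun j => affine a b \o phi j \o affine_inv a b.

(* nu = \sum_j p_j nu o psi_j^-1 *)
Definition invariant_measure (R : realType) (I : finType) (p : I -> R)
    (psi : I -> R -> R) (nu : probability (measurableTypeR R) R) :=
  forall A : set (measurableTypeR R), measurable A ->
    nu A = (\sum_j (p j)%:E * nu (psi j @^-1` A))%E.

Definition is_minpolyQ (R : realType) (theta : R) (P : {poly rat}) :=
  [/\ P \is monic, root (map_poly ratr P) theta &
      forall Q : {poly rat}, root (map_poly ratr Q) theta -> P %| Q].

Definition pisot (R : realType) (theta : R) :=
  [/\ 1 < theta, integralOver (intr : int -> R) theta &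
      exists2 P, is_minpolyQ theta P &
        forall z : R[i],
          root (map_poly ratr P) z -> z != theta%:C -> `|z| < 1].

Definition Qadjoin (R : realType) (theta : R) : set R :=
  range (fun P : {poly rat} => (map_poly ratr P).[theta]).

Definition is_Qbasis (R : realType) (V : set R) d (e : 'I_d -> R) :=
  [/\ forall i, V (e i),
      forall c : 'I_d -> rat,
        \sum_i ratr (c i) * e i = 0 -> forall i, c i = 0 &
      forall x, V x -> exists c : 'I_d -> rat, x = \sum_i ratr (c i) * e i].

(* t is the trace of the matrix of x |-> alpha * x in some Q-basis of
   Q[theta]. *)
Definition is_trace (R : realType) (theta alpha : R) (t : rat) :=
  exists d (e : 'I_d -> R) (M : 'M[rat]_d),
    [/\ is_Qbasis (Qadjoin theta) e,
        forall i, alpha * e i = \sum_j ratr (M i j) * e j &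
        t = \tr M].

(* The default value 0 is only reached when theta is not algebraic or alpha
   is not in Q[theta]. *)
Definition Tr (R : realType) (theta alpha : R) : rat :=
  xget 0 [set t | is_trace theta alpha t].

Lemma is_trace_uniq (R : realType) (theta alpha : R) (t t' : rat) :
  is_trace theta alpha t -> is_trace theta alpha t' -> t = t'.
Proof.
have coord d m (e : 'I_d -> R) (x : 'I_m -> R) : is_Qbasis (Qadjoin theta) e ->
    (forall i, Qadjoin theta (x i)) ->
    exists P : 'M[rat]_(m, d), forall i, x i = \sum_j ratr (P i j) * e j.
  move=> [_ _ span] xV; have /choice[c cP] : forall i, exists c : 'I_d -> rat,
      x i = \sum_j ratr (c j) * e j by move=> i; exact: span.
  exists (\matrix_(i, j) c i j) => i; rewrite cP.
  by apply: eq_bigr => j _; rewrite mxE.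
have comp d m n (e : 'I_d -> R) (x : 'I_m -> R) (P : 'M[rat]_(m, d))
    (A : 'M[rat]_(n, m)) : (forall i, x i = \sum_j ratr (P i j) * e j) ->
    forall i, \sum_j ratr (A i j) * x j = \sum_k ratr ((A *m P) i k) * e k.
  move=> xP i; under eq_bigr => j _ do rewrite xP mulr_sumr.
  rewrite exchange_big; apply: eq_bigr => k _ /=.
  rewrite mxE rmorph_sum mulr_suml; apply: eq_bigr => j _.
  by rewrite rmorphM mulrA.
have uniq d m (e : 'I_d -> R) (A B : 'M[rat]_(m, d)) :
    is_Qbasis (Qadjoin theta) e ->
    (forall i, \sum_j ratr (A i j) * e j = \sum_j ratr (B i j) * e j) -> A = B.
  move=> [_ free _] AB; apply/matrixP => i j; apply/eqP; rewrite -subr_eq0.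
  apply/eqP; apply: (free (fun j => A i j - B i j)).
  under eq_bigr => k _ do rewrite rmorphB mulrBl.
  by rewrite sumrB AB subrr.
move=> [d [e [M [eB eM ->]]]] [d' [e' [M' [eB' eM' ->]]]].
have [|P eP] := coord _ _ e e' eB; first by case: eB'.
have [|P' eP'] := coord _ _ e' e eB'; first by case: eB.
have one n (f : 'I_n -> R) i : f i = \sum_j ratr ((1%:M : 'M[rat]_n) i j) * f j.
  rewrite (bigD1 i)//= mxE eqxx rmorph1 mul1r big1 ?addr0// => j ji.
  by rewrite mxE eq_sym (negPf ji) rmorph0 mul0r.
have PP' : P' *m P = 1%:M.
  by apply: (uniq _ _ e) => // i; rewrite -(comp _ _ _ _ e')// -eP' -one.
have MP : M' *m P = P *m M.
  apply: (uniq _ _ e) => // i; rewrite -(comp _ _ _ _ e')// -eM' eP.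
  rewrite mulr_sumr -(comp _ _ _ e (fun i => alpha * e i) M)//.
  by apply: eq_bigr => j _; rewrite mulrCA.
have P'P : P *m P' = 1%:M.
  by apply: (uniq _ _ e') => // i; rewrite -(comp _ _ _ _ e)// -eP -one.
by rewrite -[M]mul1mx -PP' -mulmxA -MP mulmxA mxtrace_mulC mulmxA P'P mul1mx.
Qed.

Lemma TrE (R : realType) (theta alpha : R) (t : rat) :
  is_trace theta alpha t -> Tr theta alpha = t.
Proof.
by move=> tr_t; apply: xget_unique => // s /is_trace_uniq; exact.
Qed.

Definition Tset (R : realType) (theta : R) : set R :=
  [set alpha | Qadjoin theta alpha /\
    \forall n \near \oo, Tr theta (theta ^+ n * alpha) \is a Num.int].

Definition pisot_form (R : realType) (N : nat) (lambda : R)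
    (psi : 'I_N.+1 -> R -> R) :=
  pisot lambda^-1 /\
  exists (n : 'I_N.+1 -> int) (mu : 'I_N.+1 -> R),
    [/\ \big[gcdn/0%N]_k `|n k|%N = 1%N,
        forall k, Tset lambda^-1 (mu k) &
        forall j x, psi j x = lambda ^ n j * x + mu j].

(* Main.v *)
Require Import Defs.
From HB Require Import structures.
From mathcomp Require Import all_boot all_order all_algebra.
From mathcomp Require Import all_classical all_reals all_analysis.
From mathcomp Require Import complex separable measurable_realfun.
From mathcomp Require Import lra ring zify.
Import Order.TTheory GRing.Theory Num.Theory numFieldNormedType.Exports.

Set Implicit Arguments.
Unset Strict Implicit.
Unset Printing Implicit Defensive.

Local Open Scope classical_set_scope.
Local Open Scope ring_scope.
Local Open Scope complex_scope.

(** Let F be the Fourier transform of nu.  The invariance of nu reads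
    F(t) = sum_j p_j e(t b_j) F(r_j t) with e(x) = exp(2 i pi x), and F is
    bounded by 1 and uniformly continuous.  Everything follows from these facts,
    read on the logarithmic scale t = exp(u), where multiplication by
    r_j = exp(- a_j) is the translation by - a_j.  By convexity,
    g(u) = |F(exp u)|^2 is subharmonic for the random walk with steps - a_j: it
    is at most the average of the g(u - a_j).  The walk drifts to -oo, so g obeys
    a maximum principle ([maximum_principle]): bounds on a layer as wide as the
    steps propagate to all larger u.  A first consequence is that the functional
    equation has, on t > 0, at most one bounded solution that tends to a given
    value at 0 ([log_equation_unique]); hence the transform of any invariant measure w of
    the system conjugated by y |-> a y + c is e(c t) F(a t).  This settles the
    implication from the conjugate system to nu.

    For the other one, suppose that F does not tend to 0 at +oo.  The variance of
    the terms of the functional equation is the average of the g(u - a_j) minus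
    g(u), so its total mass over the logarithmic scale telescopes and is finite.
    Thus each map of the system, and by composition each map
    y |-> exp(- x) y + b of the group they generate, is an approximate symmetry:
    |e(exp(u) b) F(exp(u - x)) - F(exp u)|^2 has a finite total mass.  For a
    translation by d this bounds the mass of |e(t d) - 1|^2 |F(t)|^2: the
    transform F is small except where t d is nearly an integer.

    - If the a_j generate a dense subgroup, take a nonzero translation in the
      group, a commutator.  As t d is far from the integers most of the time, the
      averages of g over unit intervals tend to 0 ([mean_decay]).  If g had a
      positive upper limit, it would be nearly attained simultaneously along
      arithmetic progressions of arbitrarily small step, while the average of g
      over such a progression is small on a layer, hence everywhere by the
      maximum principle ([dense_subharmonic_decay]).  So F tends to 0, which is
      excluded.

    - Otherwise a_j = n_j tau with coprime integers n_j; put theta = exp(tau).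
      The maximum principle and a compactness argument produce alpha > 0 such
      that |F(alpha theta^k)| is bounded below for large k.  The group contains a
      map of ratio 1 / theta, say with fixed point y0.  Moving y0 to 0 and
      rescaling by alpha turns the maps into x |-> theta^(- n_j) x + mu_j, and
      the translations by mu_j become approximate symmetries.  Therefore
      mu_j theta^k is at square summable distance from the integers
      ([lattice_scales_resonance]), and some mu_j is nonzero because the maps
      have no common fixed point.

    Pisot's theorem ([pisot_of_sum_sqr]) then says that theta is a Pisot number
    and that the mu_j lie in Q[theta].  It is proved through Hankel determinants:
    those of the sequence u of nearest integers tend to 0 by Hadamard's inequality,
    hence vanish eventually, and u satisfies a linear recurrence; the
    conjugates of theta are read off this recurrence.  Finally the trace of
    theta^n mu_j differs from mu_j theta^n by a combination of n-th powers
    of the other conjugates, which tends to 0, so that it equals the nearest integer for large n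
    ([Tset_of_null]). *)

(** * Hadamard's inequality *)

Definition psd (R : realFieldType) n (M : 'M[R]_n) :=
  M^T = M /\ forall v : 'rV[R]_n, 0 <= (v *m M *m v^T) 0 0.

Lemma psd_diag_ge0 (R : realFieldType) n (M : 'M[R]_n) i : psd M -> 0 <= M i i.
Proof.
move=> [_ /(_ (delta_mx 0 i))]; rewrite -rowE trmx_delta -colE.
by rewrite !mxE.
Qed.

(** Induction on the size through the Schur complement. If the corner entry [a]
    is positive, subtracting [v^T v / a] from the remaining block leaves a
    positive semidefinite matrix with a smaller diagonal, and divides the
    determinant by [a]. If [a] = 0, positivity forces the whole first row to
    vanish. *)
Lemma psd_det_le (R : realFieldType) n (M : 'M[R]_n) :
  psd M -> 0 <= \det M <= \prod_i M i i.
Proof.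
elim: n M => [|n IHn] M; first by rewrite det_mx00 big_ord0 ler01 lexx.
rewrite -[n.+1]/(1 + n)%N in M *.
move: (ulsubmx M) (ursubmx M) (dlsubmx M) (drsubmx M) (submxK M) => U v w N <- {M}.
rewrite [U]mx11_scalar; set a := U 0 0.
move=> psdM; have [symM posM] := psdM.
move: symM; rewrite tr_block_mx => /eq_block_mx[_ _ vw symN]; subst w.
have quad (s : R) (y : 'rV_n) :
    ((row_mx s%:M y) *m block_mx a%:M v v^T N *m (row_mx s%:M y)^T) 0 0 =
    s ^+ 2 * a + 2 * s * (y *m v^T) 0 0 + (y *m N *m y^T) 0 0.
  have vy : (v *m y^T) 0 0 = (y *m v^T) 0 0.
    by rewrite -[v *m _]trmxK trmx_mul trmxK mxE.
  rewrite mul_row_block tr_row_mx mul_row_col !mulmxDl tr_scalar_mx.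
  rewrite !mul_mx_scalar !mul_scalar_mx -!scalemxAl.
  move: vy; move: (v *m y^T) (y *m v^T) (y *m N *m y^T) => A B C vy.
  by rewrite !mxE vy eqxx mulr1n; ring.
have a_ge0 : 0 <= a.
  by have := posM (row_mx 1%:M 0); rewrite quad !mul0mx !mxE expr1n mul1r mulr0 !addr0.
have N_ge0 i : 0 <= N i i.
  have := posM (row_mx 0%:M (delta_mx 0 i)).
  by rewrite quad expr0n mulr0 !mul0r !add0r -rowE trmx_delta -colE !mxE.
rewrite big_split_ord /= big_ord1 block_mxEul mxE eqxx mulr1n.
under eq_bigr do rewrite block_mxEdr.
have [a0|a_neq0] := eqVneq a 0.
  have v0 : v = 0.
    apply/rowP => i; rewrite [RHS]mxE; apply/eqP/negP => /negP.
    set c := v 0 i; set d := N i i => c0.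
    have dv : (delta_mx 0 i *m v^T : 'M[R]_1) 0 0 = c by rewrite -rowE !mxE.
    have dd : (delta_mx 0 i *m N *m (delta_mx 0 i : 'rV_n)^T : 'M[R]_1) 0 0 = d.
      by rewrite -rowE trmx_delta -colE !mxE.
    (* The form would take the value - d - 2 < 0 on this vector. *)
    have := posM (row_mx (- (d + 1) / c)%:M (delta_mx 0 i)).
    rewrite quad dv dd a0 mulr0 add0r -mulrA divfK//.
    by have := N_ge0 i; rewrite -/d; lra.
  by rewrite v0 a0 trmx0 det_lblock det_scalar1 !mul0r lexx.
have a_gt0 : 0 < a by rewrite lt_def a_neq0.
pose S := N - a^-1 *: (v^T *m v).
have -> : block_mx a%:M v v^T N =
    block_mx 1%:M 0 (a^-1 *: v^T) 1%:M *m block_mx a%:M v 0 S.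
  rewrite mulmx_block !mul1mx !mul0mx !addr0 mul_mx_scalar.
  by rewrite scalerA divff// scale1r -scalemxAl /S addrC subrK.
rewrite det_mulmx det_lblock det_ublock !det1 !mul1r det_scalar1.
have psdS : psd S.
  split; first by rewrite /S linearB linearZ /= trmx_mul trmxK symN.
  move=> y; have := posM (row_mx (- a^-1 * (y *m v^T) 0 0)%:M y).
  rewrite quad /S mulmxBr mulmxBl -scalemxAr -scalemxAl.
  have -> : y *m (v^T *m v) *m y^T = (y *m v^T) *m (y *m v^T)^T.
    by rewrite trmx_mul trmxK !mulmxA.
  rewrite [y *m v^T]mx11_scalar tr_scalar_mx -scalar_mxM.
  set c := (y *m v^T) 0 0.
  move: (y *m N *m y^T) => C.
  rewrite !mxE !eqxx !mulr1n => h; apply: le_trans h _.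
  by rewrite le_eqVlt; apply/orP; left; apply/eqP; field.
have /andP[detS detSle] := IHn _ psdS.
rewrite mulr_ge0//= ler_pM2l//; apply: (le_trans detSle).
apply: ler_prod => i _; rewrite psd_diag_ge0//= /S !mxE big_ord1 !mxE.
by rewrite gerBl mulr_ge0 ?invr_ge0// -expr2 sqr_ge0.
Qed.

Lemma hadamard (R : realFieldType) n (A : 'M[R]_n) :
  \det A ^+ 2 <= \prod_j \sum_i A i j ^+ 2.
Proof.
have psdA : psd (A^T *m A).
  split; first by rewrite trmx_mul trmxK.
  move=> v; rewrite mulmxA -mulmxA -[v *m A^T]trmxK trmx_mul trmxK.
  rewrite !mxE sumr_ge0// => i _; rewrite mxE -expr2 sqr_ge0//.
have /andP[_] := psd_det_le psdA.
rewrite det_mulmx det_tr -expr2 => /le_trans; apply.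
by under eq_bigr do (rewrite mxE; under eq_bigr do rewrite mxE -expr2).
Qed.

(** * Polynomials acting on sequences through the shift *)

(** [act p u] is p(S) u, where S is the shift of sequences. In this way the
    sequences annihilated by a polynomial are the solutions of a linear
    recurrence, and products of polynomials act by composition. *)
Definition act (K : fieldType) (p : {poly K}) (u : nat -> K) (k : nat) : K :=
  \sum_(i < size p) p`_i * u (k + i)%N.

Lemma actE (K : fieldType) n (p : {poly K}) u k :
  (size p <= n)%N -> act p u k = \sum_(i < n) p`_i * u (k + i)%N.
Proof.
move=> pn; rewrite /act (big_ord_widen n (fun i => p`_i * u (k + i)%N))//.
rewrite big_mkcond; apply: eq_bigr => i _; case: ltnP => // hi.
by rewrite nth_default// mul0r.
Qed.

Lemma eq_act (K : fieldType) (p : {poly K}) u v k :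
  (forall i, (k <= i)%N -> u i = v i) -> act p u k = act p v k.
Proof. by move=> uv; apply: eq_bigr => i _; rewrite uv// leq_addr. Qed.

Lemma act0 (K : fieldType) (u : nat -> K) k : act 0 u k = 0.
Proof. by rewrite /act size_poly0 big_ord0. Qed.

Lemma actD (K : fieldType) (p q : {poly K}) u k :
  act (p + q) u k = act p u k + act q u k.
Proof.
pose n := maxn (size p) (size q).
rewrite !(@actE _ n) ?leq_maxl ?leq_maxr ?size_polyD//.
by rewrite -big_split; apply: eq_bigr => i _; rewrite coefD mulrDl.
Qed.

Lemma actZ (K : fieldType) a (p : {poly K}) u k :
  act (a *: p) u k = a * act p u k.
Proof.
rewrite !(@actE _ (size p)) ?size_scale_leq// mulr_sumr.
by apply: eq_bigr => i _; rewrite coefZ mulrA.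
Qed.

Lemma act_sum (K : fieldType) (I : Type) (r : seq I) (p : I -> {poly K}) u k :
  act (\sum_(i <- r) p i) u k = \sum_(i <- r) act (p i) u k.
Proof.
by elim: r => [|i r IH]; rewrite ?big_nil ?act0// !big_cons actD IH.
Qed.

Lemma actMXn (K : fieldType) n (q : {poly K}) u k :
  act ('X^n * q) u k = act q u (k + n)%N.
Proof.
rewrite (@actE _ (n + size q)); last first.
  by apply: (leq_trans (size_polyMleq _ _)); rewrite size_polyXn.
rewrite big_split_ord /= big1 ?add0r => [|i _]; last first.
  by rewrite coefXnM ltn_ord mul0r.
apply: eq_bigr => i _; rewrite coefXnM ltnNge leq_addr /= addKn.
by rewrite addnA.
Qed.

Lemma actXn (K : fieldType) n (u : nat -> K) k : act 'X^n u k = u (k + n)%N.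
Proof. by rewrite -['X^n]mulr1 actMXn /act size_poly1 big_ord1 coef1 mul1r addn0. Qed.

Lemma act_mul (K : fieldType) (p q : {poly K}) u k :
  act (p * q) u k = act p (act q u) k.
Proof.
rewrite -[p in LHS]coefK poly_def mulr_suml act_sum.
by apply: eq_bigr => i _; rewrite -scalerAl actZ actMXn.
Qed.

Lemma actB (K : fieldType) (p q : {poly K}) u k :
  act (p - q) u k = act p u k - act q u k.
Proof. by rewrite actD -scaleN1r actZ mulN1r. Qed.

Lemma act_ZXn (K : fieldType) a n (u : nat -> K) k :
  act (a *: 'X^n) u k = a * u (k + n)%N.
Proof. by rewrite actZ actXn. Qed.

Lemma act_subr (K : fieldType) (p : {poly K}) u v k :
  act p (fun i => u i - v i) k = act p u k - act p v k.
Proof. by rewrite -sumrB; apply: eq_bigr => i _; rewrite mulrBr. Qed.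

Lemma act_geom (K : fieldType) (p : {poly K}) c z k :
  act p (fun i => c * z ^+ i) k = p.[z] * c * z ^+ k.
Proof.
rewrite horner_coef !mulr_suml; apply: eq_bigr => i _.
by rewrite exprD; ring.
Qed.

Lemma act_map (K L : fieldType) (f : {rmorphism K -> L}) (p : {poly K}) u k :
  act (map_poly f p) (fun i => f (u i)) k = f (act p u k).
Proof.
rewrite (@actE _ (size p)) ?size_poly// rmorph_sum.
by apply: eq_bigr => i _; rewrite coef_map rmorphM.
Qed.

Lemma recurrence_eq0 (K : fieldType) (C : {poly K}) v :
  C != 0 -> (forall k, act C v k = 0) ->
  (forall k, (k < (size C).-1)%N -> v k = 0) -> forall k, v k = 0.
Proof.
move=> C0 Cv v0; set d := (size C).-1 in v0.
have sC : size C = d.+1 by rewrite prednK// lt0n size_poly_eq0.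
elim/ltn_ind => k IH; have [/v0//|dk] := ltnP k d.
have := Cv (k - d)%N; rewrite /act sC big_ord_recr big1 /= => [|i _].
  rewrite add0r subnK// => /eqP; rewrite mulf_eq0 => /orP[|/eqP//].
  by rewrite -[C`_d]/(lead_coef C) lead_coef_eq0 (negPf C0).
by rewrite IH ?mulr0//; have := ltn_ord i; lia.
Qed.

(** The two actions commute, so [act D u] solves the recurrence of [C] as well
    and is determined by its first terms. *)
Lemma annihilator_of_initial (K : fieldType) (C D : {poly K}) u :
  C != 0 -> (forall k, act C u k = 0) ->
  (forall k, (k < (size C).-1)%N -> act D u k = 0) -> forall k, act D u k = 0.
Proof.
move=> C0 Cu D0; apply: (@recurrence_eq0 _ C) => // k.
rewrite -act_mul mulrC act_mul /act big1// => i _.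
by rewrite -/(act C u _) Cu mulr0.
Qed.

Definition hankel (K : nzRingType) (u : nat -> K) n : 'M[K]_n :=
  \matrix_(i, j) u (i + j)%N.

Lemma hankel_singular (K : fieldType) (u : nat -> K) n :
  \det (hankel u n) = 0 ->
  exists2 C : {poly K}, C != 0 & (size C <= n)%N /\
    forall k, (k < n)%N -> act C u k = 0.
Proof.
move=> /eqP/det0P[v v0 vA]; exists (rVpoly v).
  by rewrite -(rVpolyK v) in v0; apply: contra_neq v0 => ->; rewrite raddf0.
have sv : (size (rVpoly v) <= n)%N by exact: size_poly.
split=> // k kn; rewrite (actE _ _ sv); move/rowP/(_ (Ordinal kn)): vA.
rewrite !mxE => vA; rewrite -[RHS]vA; apply: eq_bigr => i _.
by rewrite coef_rVpoly_ord mxE addnC.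
Qed.

(** Call C a relation up to n if its degree is at most n and C(S) u vanishes up
    to n. Take a relation C up to some n whose degree is the least possible. If
    m is the first index where C(S) u does not vanish, let D be a relation up
    to m: its degree is at least that of C. The value of C(S) D(S) u at m - deg
    D can then be computed in two ways. It is 0 since only terms of D(S) u up
    to m enter, and it is the product of the leading coefficient of D by the
    value of C(S) u at m. *)
Lemma kronecker (K : fieldType) (u : nat -> K) n0 :
  (forall n, (n0 <= n)%N -> exists2 C : {poly K}, C != 0 & (size C <= n.+1)%N /\
    forall k, (k < n.+1)%N -> act C u k = 0) ->
  exists2 C : {poly K}, C != 0 & forall k, act C u k = 0.
Proof.
move=> H.
pose P s := `[< exists n (C : {poly K}), [/\ (n0 <= n)%N, C != 0, size C = s,
  (size C <= n.+1)%N & forall k, (k < n.+1)%N -> act C u k = 0] >].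
have exP : exists s, P s.
  have [C C0 [sC Cu]] := H n0 (leqnn _).
  by exists (size C); apply/asboolP; exists n0, C.
case: (ex_minnP exP) => s /asboolP[n [C [n0n C0 sC Cn Cu]]] smin.
exists C => //; apply: contrapT => /existsNP[m0 /eqP Cm0].
have exm : exists m, act C u m != 0 by exists m0.
case: (ex_minnP exm) => m Cm mmin.
have nm : (n < m)%N by rewrite ltnNge; apply/negP => mn; rewrite Cu ?eqxx// in Cm.
have n0m : (n0 <= m)%N by apply: leq_trans n0n _; exact: ltnW.
have [D D0 [sD Du]] := H m n0m.
have sCD : (s <= size D)%N by apply: smin; apply/asboolP; exists m, D.
have sD0 : (0 < size D)%N by rewrite lt0n size_poly_eq0.
set q := (size D).-1; have sDq : size D = q.+1 by rewrite prednK.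
have qm : (q <= m)%N by lia.
have eq1 : act D (act C u) (m - q) = lead_coef D * act C u m.
  rewrite {1}/act sDq big_ord_recr big1 /= => [|i _].
    by rewrite add0r subnK// lead_coefE -/q.
  rewrite (_ : act C u _ = 0) ?mulr0//; apply/eqP/negPn/negP => /mmin.
  by have := ltn_ord i; lia.
move: eq1; rewrite -act_mul mulrC act_mul {1}/act big1 => [/esym/eqP|i _].
  by rewrite mulf_eq0 lead_coef_eq0 (negPf D0) (negPf Cm).
by rewrite Du ?mulr0//; have := ltn_ord i; lia.
Qed.

(** * Hankel determinants of nearly geometric integer sequences *)

Lemma small_tails (R : realType) (e : nat -> R) C :
  (forall i, 0 <= e i) -> (forall n, \sum_(i < n) e i <= C) ->
  forall rho, 0 < rho -> exists J, forall j n, (J <= j)%N ->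
    \sum_(i < n) e (j + i)%N <= rho.
Proof.
move=> e0 eC rho rho0; pose S := range (fun n => \sum_(i < n) e i).
have supS : has_sup S.
  by split; [exists 0, 0%N; rewrite ?big_ord0|exists C => _ [n _ <-]].
have [_ [J _ <-] hJ] := sup_adherent rho0 supS.
exists J => j n Jj.
have : \sum_(i < j + n) e i <= sup S.
  by apply: ub_le_sup; [exact: supS.2|exists (j + n)%N].
rewrite big_split_ord /=.
suff : \sum_(i < J) e i <= \sum_(i < j) e i by lra.
rewrite (big_ord_widen _ e Jj) big_mkcond; apply: ler_sum => i _.
by case: ifP.
Qed.

Lemma half_exp_small (R : realType) (K : R) :
  exists n0, forall n, (n0 <= n)%N -> K * 2^-1 ^+ n < 1.
Proof.
exists (Num.bound `|K|) => n Kn; rewrite exprVn ltr_pdivrMr ?exprn_gt0// mul1r.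
have : K < (Num.bound `|K|)%:R.
  by apply: le_lt_trans (ler_norm K) _; rewrite archi_boundP.
move/lt_le_trans; apply; apply: (@le_trans _ _ n%:R); first by rewrite ler_nat.
by rewrite -natrX ler_nat ltnW// ltn_expl.
Qed.

(** Subtracting from each column [theta] times the previous one leaves entries
    that are small when [u] is close to a geometric sequence of ratio [theta].
    *)
Lemma hankel_shifted_det (R : comNzRingType) (u : nat -> R) (theta : R) n :
  \det (hankel u n.+1) = \det (\matrix_(i < n.+1, j < n.+1)
    (if (j : nat) is k.+1 then u (i + k).+1 - theta * u (i + k)%N else u i)).
Proof.
pose T : 'M[R]_n.+1 := \matrix_(i, j) ((i == j)%:R - theta * ((i : nat).+1 == j)%:R).
have detT : \det T = 1.
  rewrite -det_tr det_trig.
    by rewrite big1// => i _; rewrite !mxE eqxx eqn_leq ltnn mulr0 subr0.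
  apply/is_trig_mxP => i j ij; rewrite !mxE -val_eqE /= gtn_eqF//.
  by rewrite gtn_eqF ?mulr0 ?subr0// ltnW.
rewrite -[LHS]mulr1 -detT -det_mulmx; congr (\det _).
apply/matrixP => i j; rewrite !mxE.
under eq_bigr do rewrite !mxE mulrBr.
rewrite sumrB (bigD1 j)//= eqxx mulr1 big1 ?addr0;
  last by move=> k /negPf ->; rewrite mulr0.
case: j => -[|j] jn /=; first by rewrite big1 ?subr0 ?addn0// => k _; rewrite !mulr0.
rewrite addnS; congr (_ - _).
have jn' : (j < n.+1)%N by exact: ltnW.
rewrite (bigD1 (Ordinal jn'))//= eqxx mulr1 big1 ?addr0 1?mulrC// => k.
by rewrite eqSS -val_eqE /= => /negPf ->; rewrite !mulr0.
Qed.

Lemma prod_eventually_small (R : realFieldType) (M rho : R) J (g : nat -> R) n :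
  0 < rho -> 1 <= M -> (forall j, 0 <= g j) ->
  (forall j, g j <= M * rho) -> (forall j, (J <= j)%N -> g j <= rho) ->
  \prod_(j < n) g j <= M ^+ J * rho ^+ n.
Proof.
move=> rho0 M1 g0 gM grho.
suff : \prod_(j < n) g j <= M ^+ minn n J * rho ^+ n.
  move/le_trans; apply; rewrite ler_pM2r ?exprn_gt0//.
  by apply: ler_weXn2l => //; exact: geq_minr.
elim: n => [|n IH]; first by rewrite big_ord0 min0n !expr0 mulr1.
rewrite big_ord_recr /= exprSr mulrA.
have [nJ|Jn] := ltnP n J.
  have -> : minn n.+1 J = (minn n J).+1 by lia.
  have -> : M ^+ (minn n J).+1 * rho ^+ n * rho =
      (M ^+ minn n J * rho ^+ n) * (M * rho) by rewrite exprS; ring.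
  by rewrite ler_pM// prodr_ge0.
have -> : minn n.+1 J = minn n J by lia.
by rewrite ler_pM ?prodr_ge0// grho.
Qed.

(** After the column operation of [hankel_shifted_det], Hadamard's inequality
    bounds the square of the determinant by the product of the squared norms of
    the columns. The first one grows at most like theta^(2 n), up to a factor
    n; the others are bounded, and all but finitely many are below any given
    constant because they are pieces of the tails of a convergent series. So
    the product tends to 0, and the determinant is an integer. *)
Lemma hankel_eventually_singular (R : realType) (theta x C : R) (u : nat -> int) :
  1 < theta ->
  (forall n, \sum_(i < n) (x * theta ^+ i - (u i)%:~R) ^+ 2 <= C) ->
  exists n0, forall n, (n0 <= n)%N -> \det (hankel u n.+1) = 0.
Proof.
move=> th1 hC; pose e i : R := x * theta ^+ i - (u i)%:~R.
have C0 : 0 <= C by have := hC 0%N; rewrite big_ord0.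
pose v i : R := (u i)%:~R.
pose eta i : R := v i.+1 - theta * v i.
have etaE i : eta i = theta * e i - e i.+1 by rewrite /eta /e /v exprS; ring.
have th2 : 1 < theta ^+ 2 by rewrite exprn_egt1.
pose C' := 2 * (theta ^+ 2 + 1) * C.
have etaC n : \sum_(i < n) eta i ^+ 2 <= C'.
  have : \sum_(i < n) eta i ^+ 2 <=
      \sum_(i < n) (2 * theta ^+ 2 * e i ^+ 2 + 2 * e i.+1 ^+ 2).
    apply: ler_sum => i _; rewrite etaE.
    by have := sqr_ge0 (theta * e i + e i.+1); rewrite !expr2; lra.
  move/le_trans; apply; rewrite big_split /= -!mulr_sumr.
  have := hC n; have := hC n.+1; rewrite big_ord_recl /=.
  have := sqr_ge0 (x * theta ^+ 0 - (u 0)%:~R).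
  under [X in _ -> _ + X <= _ -> _]eq_bigr => i _ do rewrite -/(e i.+1).
  under [X in _ -> _ -> X <= _ -> _]eq_bigr => i _ do rewrite -/(e i).
  rewrite /C'; nra.
(* Almost all columns contribute a factor rho, which compensates the growth
   (n + 1) theta^(2 n) of the first one, as n + 1 <= 2^n, and leaves 2^(- n). *)
pose rho := (4 * theta ^+ 2)^-1.
have rho0 : 0 < rho by rewrite invr_gt0 mulr_gt0// (lt_trans _ th2).
have [J hJ] := small_tails (fun i => sqr_ge0 (eta i)) etaC rho0.
pose M := 1 + C' / rho.
have C'0 : 0 <= C' by have := etaC 0%N; rewrite big_ord0.
have M1 : 1 <= M by rewrite lerDl divr_ge0// ltW.
have [n0 hn0] := half_exp_small (2 * (x ^+ 2 + C) * M ^+ J).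
exists n0 => n n0n.
apply/eqP; rewrite -(intr_eq0 R) -det_map_mx.
have -> : map_mx intr (hankel u n.+1) = hankel v n.+1.
  by apply/matrixP => i j; rewrite !mxE.
have -> : \det (hankel v n.+1) = (\det (hankel u n.+1))%:~R.
  by rewrite -det_map_mx; congr (\det _); apply/matrixP => i j; rewrite !mxE.
rewrite intr_eq0; set D := \det (hankel u n.+1).
suff : (D%:~R : R) ^+ 2 < 1.
  rewrite -rmorphXn -[1]/((1 : int)%:~R) ltr_int => D1.
  by apply/negPn/negP => D0; have := sqr_ge0 D; nia.
have -> : (D%:~R : R) = \det (hankel v n.+1).
  by rewrite -det_map_mx; congr (\det _); apply/matrixP => i j; rewrite !mxE.
rewrite (hankel_shifted_det _ theta).
apply: (le_lt_trans (hadamard _)); rewrite big_ord_recl /=.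
apply: (le_lt_trans _ (hn0 _ n0n)).
have -> : 2 * (x ^+ 2 + C) * M ^+ J * 2^-1 ^+ n =
    (2 ^+ n * (2 * (x ^+ 2 + C) * (theta ^+ 2) ^+ n)) * (M ^+ J * rho ^+ n).
  have -> : 2^-1 ^+ n = 2 ^+ n * (theta ^+ 2) ^+ n * rho ^+ n :> R.
    rewrite -!exprMn; congr (_ ^+ n); rewrite /rho; field.
    by rewrite gt_eqF// (lt_trans ltr01).
  by ring.
apply: ler_pM.
- by apply: sumr_ge0 => i _; exact: sqr_ge0.
- by apply: prodr_ge0 => i _; apply: sumr_ge0 => j _; exact: sqr_ge0.
- apply: (@le_trans _ _ (\sum_(i < n.+1) 2 * (x ^+ 2 + C) * (theta ^+ 2) ^+ n)).
    apply: ler_sum => i _; rewrite mxE /v.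
    have ei : e i ^+ 2 <= C.
      apply: le_trans (hC i.+1); rewrite big_ord_recr /= lerDr.
      by apply: sumr_ge0 => j _; exact: sqr_ge0.
    have ti : 1 <= (theta ^+ 2) ^+ i <= (theta ^+ 2) ^+ n.
      by rewrite (exprn_ege1 _ (ltW th2)) (ler_weXn2l (ltW th2))// -ltnS.
    have -> : (u i)%:~R = x * theta ^+ i - e i by rewrite /e; ring.
    have -> : (x * theta ^+ i - e i) ^+ 2 = 2 * (x ^+ 2 * (theta ^+ 2) ^+ i + e i ^+ 2)
        - (x * theta ^+ i + e i) ^+ 2 by rewrite -exprM mulnC exprM; ring.
    have := sqr_ge0 (x * theta ^+ i + e i); have := sqr_ge0 x.
    move: ti => /andP[]; move: ((theta ^+ 2) ^+ i) ((theta ^+ 2) ^+ n) => t s.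
    by nra.
  rewrite sumr_const card_ord -[leLHS]mulr_natl; apply: ler_wpM2r.
    apply: mulr_ge0; last by apply: exprn_ge0; exact: sqr_ge0.
    by apply: mulr_ge0 => //; apply: addr_ge0 => //; exact: sqr_ge0.
  by rewrite -natrX ler_nat ltn_expl.
- under eq_bigr => j _.
    under eq_bigr => i _ do rewrite mxE /= addnC.
    over.
  apply: (@prod_eventually_small _ M rho J
    (fun j => \sum_(i < n.+1) eta (j + i)%N ^+ 2)) => //.
  + by move=> j; apply: sumr_ge0 => i _; exact: sqr_ge0.
  + move=> j; rewrite /M mulrDl mul1r divfK ?gt_eqF//.
    have := etaC (j + n.+1)%N; rewrite big_split_ord /=.
    have : 0 <= \sum_(i < j) eta i ^+ 2 by apply: sumr_ge0 => i _; exact: sqr_ge0.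
    by lra.
  + by move=> j Jj; exact: hJ.
Qed.

(** * Null sequences and integral recurrences *)

(** The norm is that of an arbitrary numeric field, so that the notion applies
    to real and to complex sequences. *)
Definition null (K : numFieldType) (e : nat -> K) :=
  forall rho, 0 < rho -> exists J, forall j, (J <= j)%N -> `|e j| < rho.

Lemma eq_null (K : numFieldType) (e f : nat -> K) : e =1 f -> null e -> null f.
Proof.
by move=> ef ne rho /ne[J hJ]; exists J => j /hJ; rewrite ef.
Qed.

Lemma null_shift (K : numFieldType) (e : nat -> K) m :
  null e -> null (fun k => e (k + m)%N).
Proof.
move=> ne rho /ne[J hJ]; exists J => j Jj; apply: hJ.
exact: leq_trans Jj (leq_addr _ _).
Qed.

Lemma null_mull (K : numFieldType) (e : nat -> K) c :
  null e -> null (fun k => c * e k).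
Proof.
move=> ne rho rho0.
have c1 : 0 < `|c| + 1 by rewrite ltr_wpDl.
have [J hJ] := ne _ (divr_gt0 rho0 c1); exists J => j /hJ ej.
rewrite normrM; apply: (@le_lt_trans _ _ ((`|c| + 1) * `|e j|)).
  by rewrite ler_wpM2r// lerDl.
by rewrite mulrC -ltr_pdivlMr.
Qed.

Lemma null_add (K : numFieldType) (e f : nat -> K) :
  null e -> null f -> null (fun k => e k + f k).
Proof.
move=> ne nf rho rho0; have r2 : 0 < rho / 2 by rewrite divr_gt0.
have [[J hJ] [L hL]] := (ne _ r2, nf _ r2); exists (maxn J L) => j.
rewrite geq_max => /andP[/hJ ej /hL fj].
by apply: (le_lt_trans (ler_normD _ _)); rewrite [rho]splitr ltrD.
Qed.

Lemma null_sum (K : numFieldType) (I : Type) (r : seq I) (e : I -> nat -> K) :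
  (forall i, null (e i)) -> null (fun k => \sum_(i <- r) e i k).
Proof.
move=> ne; elim: r => [|i r IH].
  by move=> rho rho0; exists 0%N => j _; rewrite big_nil normr0.
by apply: eq_null (null_add (ne i) IH) => k; rewrite big_cons.
Qed.

Lemma null_act (K : numFieldType) (p : {poly K}) (e : nat -> K) :
  null e -> null (act p e).
Proof.
move=> ne; apply: null_sum => i; apply: null_mull; exact: null_shift.
Qed.

(** The conclusion is used to compare growths: two multiples of the same
    geometric sequence that differ by a null sequence are equal. *)
Lemma geom_null (K : numFieldType) (e : nat -> K) (c z : K) m :
  1 <= `|z| -> null e -> (forall k, (m <= k)%N -> e k = c * z ^+ k) -> c = 0.
Proof.
move=> z1 ne ec; apply/eqP/negPn/negP => c0.
have [|J hJ] := ne `|c|; first by rewrite normr_gt0.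
have := hJ _ (leq_maxl J m); rewrite ec ?leq_maxr// normrM.
rewrite gtr_pMr ?normr_gt0// normrX => /lt_geF/negP; apply.
exact: exprn_ege1.
Qed.

Lemma null_of_sum_sqr (R : realType) (e : nat -> R) C :
  (forall n, \sum_(i < n) e i ^+ 2 <= C) -> null e.
Proof.
move=> eC rho rho0.
have r2 : 0 < (rho / 2) ^+ 2 by rewrite exprn_gt0// divr_gt0.
have [J hJ] := small_tails (fun i => sqr_ge0 (e i)) eC r2.
exists J => j /(hJ _ 1%N); rewrite big_ord1 addn0 => h.
apply: (@le_lt_trans _ _ (rho / 2)); last by rewrite ltr_pdivrMr// ltr_pMr// ltr1n.
rewrite -(@ler_pXn2r _ 2)// ?nnegrE ?normr_ge0 ?divr_ge0 ?(ltW rho0)//.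
by rewrite real_normK// num_real.
Qed.

Lemma int_null_eventually0 (R : realType) (w : nat -> rat) (N : int) :
  N != 0 -> (forall k, N%:~R * w k \is a Num.int) ->
  null (fun k => ratr (w k) : R) ->
  exists J, forall k, (J <= k)%N -> w k = 0.
Proof.
move=> N0 Nw nw.
have N1 : 0 < (`|N|%:~R : R)^-1 by rewrite invr_gt0 ltr0z normr_gt0.
have [J hJ] := nw _ N1; exists J => k /hJ.
have /intrP[a wa] := Nw k.
rewrite -[ltRHS]mulr1 mulrC ltr_pdivlMr ?ltr0z ?normr_gt0// => h.
have {h} : `|(a%:~R : R)| < 1.
  by rewrite -ratr_int -wa rmorphM /= ratr_int normrM mulrC -intr_norm.
rewrite -intr_norm -[1]/(1%:~R) ltr_int => a1.
have a0 : a = 0 by lia.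
by move/eqP: wa; rewrite a0 mulf_eq0 intr_eq0 (negPf N0) => /eqP.
Qed.

Lemma act_rVpoly (K : fieldType) n (v : 'rV[K]_n) u k :
  act (rVpoly v) u k = \sum_i v 0 i * u (k + i)%N.
Proof.
rewrite (@actE _ n) ?size_poly//.
by apply: eq_bigr => i _; rewrite coef_rVpoly_ord.
Qed.

Lemma exists_equal_residues (u : nat -> int) p (d : int) : d != 0 ->
  exists l k, [/\ (p <= l)%N, (l < k)%N &
    forall i, (i < p)%N -> (d %| u (k + i)%N - u (l + i)%N)%Z].
Proof.
move=> d0; pose T := {ffun 'I_p -> 'I_(`|d|%N).+1}.
pose f (k : 'I_#|T|.+1) : T := [ffun i : 'I_p => inord `|(u (p + k + i)%N %% d)%Z|%N].
have /injectivePn[k [l kl fkl]] : ~~ injectiveb f.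
  apply/negP => /injectiveP /leq_card; rewrite card_ord ltnn//.
have dvd i : (i < p)%N -> (u (p + k + i)%N %% d)%Z = (u (p + l + i)%N %% d)%Z.
  move=> ip; move/ffunP/(_ (Ordinal ip)): fkl; rewrite !ffunE /=.
  have h m : (`|(m %% d)%Z| < (`|d|%N).+1)%N.
    by have := modz_ge0 m d0; have := ltz_mod m d0; lia.
  move=> /(congr1 val); rewrite /= !inordK// => e.
  have := modz_ge0 (u (p + k + i)%N) d0; have := modz_ge0 (u (p + l + i)%N) d0.
  by lia.
wlog lk : k l kl fkl dvd / (l < k)%N => [th|].
  have [||/val_inj kl'] := ltngtP l k; first exact: th.
    by apply: th; rewrite 1?eq_sym// => i /dvd.
  by rewrite kl' eqxx in kl.
exists (p + l)%N, (p + k)%N; split; rewrite ?leq_addr ?ltn_add2l// => i ip.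
by rewrite -eqz_mod_dvd dvd.
Qed.

(** Take C of minimal degree p. Then the Hankel matrix H of size p is
    nonsingular. Two windows of length p of the sequence that agree modulo det
    H differ, by Cramer's rule, by an integral combination of the rows of H,
    which are windows too. This is a monic integral recurrence that holds at
    the first p indices, hence everywhere by [annihilator_of_initial]. *)
Lemma monic_int_annihilator (u : nat -> int) (C : {poly rat}) :
  C != 0 -> (forall k, act C (fun k => (u k)%:~R) k = 0) ->
  exists2 E : {poly int}, E \is monic &
    forall k, act (map_poly intr E) (fun k => (u k)%:~R : rat) k = 0.
Proof.
move=> C0 Cu; set v : nat -> rat := fun k => (u k)%:~R.
pose P s := `[< exists C : {poly rat},
  [/\ C != 0, size C = s & forall k, act C v k = 0] >].
have exP : exists s, P s by exists (size C); apply/asboolP; exists C.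
case: (ex_minnP exP) => s /asboolP[{C0 Cu}C [C0 sC Cu]] smin.
have s0 : (0 < s)%N by rewrite -sC lt0n size_poly_eq0.
set p := s.-1; have sp : s = p.+1 by rewrite prednK.
have d0 : \det (hankel u p) != 0.
  apply/eqP => d0; have : \det (hankel v p) = 0.
    rewrite -[RHS](rmorph0 intr) -d0 -det_map_mx; congr (\det _).
    by apply/matrixP => i j; rewrite !mxE.
  move/hankel_singular => [D D0 [sD Dv]].
  have : P (size D).
    apply/asboolP; exists D; split => //.
    by apply: (annihilator_of_initial C0 Cu) => k; rewrite sC => /Dv.
  by move/smin => h; exfalso; move: h; rewrite sp ltnNge sD.
have [l [k [pl lk dvd]]] := exists_equal_residues u p d0.
set d := \det _ in d0 dvd.
pose y : 'rV[int]_p := \row_i ((u (k + i)%N - u (l + i)%N) %/ d)%Z.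
have [z zH] : exists z, z *m hankel u p = d *: y.
  by exists (y *m \adj (hankel u p)); rewrite -mulmxA mul_adj_mx mul_mx_scalar.
have zE i : (i < p)%N -> \sum_j z 0 j * u (i + j)%N = u (k + i)%N - u (l + i)%N.
  move=> ip; move/rowP/(_ (Ordinal ip)): zH; rewrite !mxE /= mulrC divzK ?dvd// => <-.
  by apply: eq_bigr => j _; rewrite mxE addnC.
pose F : {poly int} := - 'X^l - rVpoly z.
pose E : {poly int} := 'X^k + F.
have sF : (size F < size ('X^k : {poly int}))%N.
  rewrite /F size_polyXn ltnS; apply: (leq_trans (size_polyD _ _)).
  rewrite !size_polyN size_polyXn geq_max lk /=.
  by apply: (leq_trans (size_poly _ _)); lia.
exists E; first by rewrite monicE lead_coefDl// lead_coefXn.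
apply: (annihilator_of_initial C0 Cu) => i; rewrite sC -/p => ip.
rewrite /E /F !rmorphD !rmorphN /= !map_polyXn map_rVpoly.
rewrite actD actB -scaleN1r act_ZXn actXn act_rVpoly.
rewrite (_ : \sum_j _ = (u (k + i)%N - u (l + i)%N)%:~R); last first.
  rewrite -zE// rmorph_sum; apply: eq_bigr => j _.
  by rewrite mxE rmorphM.
by rewrite /v rmorphB /= addnC [(i + l)%N]addnC; ring.
Qed.

(** If C(S) kills [ratr u], then C(S) applied to the error is C(theta) x
    theta^k, which cannot be a null sequence unless C(theta) = 0. *)
Lemma annihilator_root (R : realType) (theta x : R) (u : nat -> rat)
    (C : {poly rat}) m :
  1 < theta -> x != 0 -> null (fun k => x * theta ^+ k - ratr (u k)) ->
  (forall k, (m <= k)%N -> act C u k = 0) -> root (map_poly ratr C) theta.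
Proof.
move=> th1 x0 nu Cu.
have := null_act (map_poly ratr C) nu.
move=> /(@geom_null _ _ ((map_poly ratr C).[theta] * x) theta m).
have -> : (1 <= `|theta|) by rewrite ger0_norm ?ltW// (lt_trans ltr01).
move=> /(_ isT) h; have {h} : (map_poly ratr C).[theta] * x = 0.
  apply: h => k mk; rewrite act_subr act_geom act_map Cu// rmorph0 subr0//.
by move/eqP; rewrite mulf_eq0 (negPf x0) orbF.
Qed.

(** * Minimal polynomials, Q[theta] and conjugates *)

Lemma exists_minpolyQ (R : realType) (theta : R) (C : {poly rat}) :
  C != 0 -> root (map_poly ratr C) theta -> exists P, is_minpolyQ theta P.
Proof.
move=> C0 Ct.
pose P s := `[< exists C : {poly rat},
  [/\ C != 0, size C = s & root (map_poly ratr C) theta] >].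
have exP : exists s, P s by exists (size C); apply/asboolP; exists C.
case: (ex_minnP exP) => s /asboolP[{C0 Ct}C [C0 sC Ct]] smin.
have lC0 : lead_coef C != 0 by rewrite lead_coef_eq0.
exists ((lead_coef C)^-1 *: C); split.
- by rewrite monicE lead_coefZ mulVf.
- by rewrite map_polyZ /= rootZ// fmorph_eq0 invr_eq0.
- move=> Q Qt; rewrite dvdpZl ?invr_eq0//; apply/negPn/negP => QC.
  have : P (size (Q %% C)).
    apply/asboolP; exists (Q %% C); split => //.
    rewrite /root; have /eqP := Qt; rewrite [in map_poly ratr Q](divp_eq Q C).
    by rewrite rmorphD rmorphM /= hornerD hornerM (eqP Ct) mulr0 add0r => ->.
  by move/smin; rewrite -sC leqNgt ltn_modp C0.
Qed.

Lemma minpolyQ_neq0 (R : realType) (theta : R) P : is_minpolyQ theta P -> P != 0.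
Proof. by case=> /monic_neq0. Qed.

Lemma minpolyQ_size (R : realType) (theta : R) P Q : is_minpolyQ theta P ->
  Q != 0 -> root (map_poly ratr Q) theta -> (size P <= size Q)%N.
Proof. by move=> [_ _ minP] Q0 /minP; exact: dvdp_leq. Qed.

Lemma minpolyQ_size_gt1 (R : realType) (theta : R) P :
  is_minpolyQ theta P -> (1 < size P)%N.
Proof.
move=> Pm; have P0 := minpolyQ_neq0 Pm; have [_ Pt _] := Pm.
rewrite ltnNge; apply/negP => /size1_polyC; move: P`_0 => c PE.
move: Pt P0; rewrite PE map_polyC rootC fmorph_eq0 => /eqP ->.
by rewrite eqxx.
Qed.

Lemma Qadjoin_horner (R : realType) (theta : R) (P : {poly rat}) :
  Qadjoin theta (map_poly ratr P).[theta].
Proof. by exists P. Qed.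

Lemma Qadjoin_rat (R : realType) (theta : R) (c : rat) : Qadjoin theta (ratr c).
Proof. by exists c%:P => //; rewrite map_polyC hornerC. Qed.

Lemma QadjoinX (R : realType) (theta : R) : Qadjoin theta theta.
Proof. by exists 'X => //; rewrite map_polyX hornerX. Qed.

Lemma QadjoinD (R : realType) (theta x y : R) :
  Qadjoin theta x -> Qadjoin theta y -> Qadjoin theta (x + y).
Proof.
move=> [P _ <-] [Q _ <-]; exists (P + Q) => //.
by rewrite rmorphD hornerD.
Qed.

Lemma QadjoinM (R : realType) (theta x y : R) :
  Qadjoin theta x -> Qadjoin theta y -> Qadjoin theta (x * y).
Proof.
move=> [P _ <-] [Q _ <-]; exists (P * Q) => //.
by rewrite rmorphM hornerM.
Qed.

Lemma Qadjoin_sum (R : realType) (theta : R) n (x : 'I_n -> R) :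
  (forall i, Qadjoin theta (x i)) -> Qadjoin theta (\sum_i x i).
Proof.
move=> Qx; elim/big_rec: _ => [|i y _ Qy]; last exact: QadjoinD.
by rewrite -(rmorph0 ratr); exact: Qadjoin_rat.
Qed.

Lemma minpolyQ_coprime (R : realType) (theta : R) P G : is_minpolyQ theta P ->
  ~~ root (map_poly ratr G) theta -> coprimep P G.
Proof.
move=> Pm Gt; have [_ Pt _] := Pm; rewrite /coprimep; set D := gcdp P G.
have PE := divpK (dvdp_gcdl P G); have P0 := minpolyQ_neq0 Pm.
have D0 : D != 0 by rewrite gcdp_eq0 (negPf P0).
have DP : D %| P by exact: dvdp_gcdl.
have E0 : P %/ D != 0.
  by rewrite divp_eq0 (negPf P0) (negPf D0)/= -leqNgt dvdp_leq.
have : (map_poly ratr (P %/ D)).[theta] * (map_poly ratr D).[theta] = 0 :> R.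
  by rewrite -hornerM -rmorphM PE (eqP Pt).
move/eqP; rewrite mulf_eq0 => /orP[/(minpolyQ_size Pm E0)|/eqP Dt].
  have sP : (0 < size P)%N by rewrite lt0n size_poly_eq0.
  have sD : (0 < size D)%N by rewrite lt0n size_poly_eq0.
  rewrite size_divp//; move: sP sD; move: (size P) (size D) => a c.
  by clear; lia.
case/negP: Gt; rewrite /root -(divpK (dvdp_gcdr P G)) -/D.
by rewrite rmorphM hornerM Dt mulr0.
Qed.

Lemma QadjoinV (R : realType) (theta x : R) P : is_minpolyQ theta P ->
  Qadjoin theta x -> Qadjoin theta x^-1.
Proof.
move=> Pm [G _ <-]; set x0 := _.[_].
have [->|x0n] := eqVneq x0 0.
  by rewrite invr0 -(rmorph0 ratr); exact: Qadjoin_rat.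
have [_ Pt _] := Pm.
have /Bezout_eq1_coprimepP[[u v] /= uv] := minpolyQ_coprime Pm x0n.
have vx : (map_poly ratr v).[theta] * x0 = 1.
  have := congr1 (fun Q => (map_poly ratr Q).[theta] : R) uv.
  rewrite /= rmorphD !rmorphM rmorph1 /= hornerD !hornerM hornerC (eqP Pt).
  by rewrite mulr0 add0r.
have -> : x0^-1 = (map_poly ratr v).[theta].
  by rewrite -[LHS]mul1r -vx mulfK.
exact: Qadjoin_horner.
Qed.

Lemma null_complex (R : realType) (e : nat -> R) :
  null e -> null (fun k => (e k)%:C : R[i]).
Proof.
move=> ne rho; rewrite ltcE /= => /andP[/eqP rI rR].
have [J hJ] := ne _ rR; exists J => j /hJ ej.
by rewrite normc_def /= expr0n addr0 sqrtr_sqr ltcE /= rI eqxx.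
Qed.

(** The sequence q(S) w is annihilated by S - z. *)
Lemma linear_factor_act (K : fieldType) (q : {poly K}) z (w : nat -> K) :
  (forall k, act (q * ('X - z%:P)) w k = 0) ->
  forall k, act q w k = act q w 0 * z ^+ k.
Proof.
move=> h; elim=> [|k IH]; first by rewrite mulr1.
have := h k; rewrite mulrC act_mul actB.
rewrite -['X]/('X^1) actXn addn1 -[z%:P]mulr1 mul_polyC actZ.
rewrite /(act 1) size_poly1 big_ord1 coef1 mul1r addn0 => /eqP.
by rewrite subr_eq0 => /eqP ->; rewrite IH exprS; ring.
Qed.

(** Let q = P / (X - z). The sequence q(S) w is geometric of ratio z, and it is
    null because q vanishes at theta. If |z| >= 1, it is therefore 0. Then the
    Hankel determinant of w of size deg P - 1 vanishes, and w is annihilated by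
    a rational polynomial of degree smaller than deg P. This polynomial
    vanishes at theta, which contradicts the minimality of P. *)
Lemma conjugate_lt1 (R : realType) (theta y : R) (w : nat -> rat) P (z : R[i]) :
  1 < theta -> y != 0 -> is_minpolyQ theta P ->
  (forall k, act P w k = 0) -> null (fun k => y * theta ^+ k - ratr (w k)) ->
  root (map_poly ratr P) z -> z != theta%:C -> `|z| < 1.
Proof.
move=> th1 y0 Pm Pw nw zP zt.
rewrite real_ltNge ?normr_real ?real1//; apply/negP => z1.
have /factor_theorem[q PE] := zP.
have P0 := minpolyQ_neq0 Pm.
have q0 : q != 0.
  apply: contra_neq P0 => q0; apply/eqP; rewrite -(map_poly_eq0 (@ratr R[i])).
  by rewrite PE q0 mul0r.
have sP : size P = (size q).+1.
  by rewrite -(size_map_poly (@ratr R[i])) PE size_Mmonic ?monicXsubC// size_XsubC addn2.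
pose wC k : R[i] := ratr (w k).
have a_geom := @linear_factor_act _ q z wC.
have {}a_geom : forall k, act q wC k = act q wC 0 * z ^+ k.
  by apply: a_geom => k; rewrite -PE act_map Pw rmorph0.
have qt : q.[theta%:C] = 0.
  have : (map_poly ratr P).[theta%:C] = 0.
    rewrite (_ : map_poly _ P = map_poly (real_complex R) (map_poly ratr P)).
      by rewrite horner_map; have [_ /eqP -> _] := Pm; rewrite rmorph0.
    by rewrite -map_poly_comp; apply: eq_map_poly => c /=; rewrite fmorph_rat.
  rewrite PE hornerM hornerXsubC => /eqP; rewrite mulf_eq0 subr_eq0.
  by rewrite [_ == z]eq_sym (negPf zt) orbF => /eqP.
have nq : null (act q wC).
  apply: eq_null (null_mull (-1) (null_act q (null_complex nw))) => k.
  transitivity (- act q (fun i => y%:C * theta%:C ^+ i - wC i) k).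
    rewrite mulN1r; congr (- _); apply: eq_act => i _.
    by rewrite rmorphB rmorphM rmorphXn /= fmorph_rat.
  by rewrite act_subr act_geom qt !mul0r sub0r opprK.
have a0 := geom_null z1 nq (fun k (_ : (0 <= k)%N) => a_geom k).
have : \det (hankel w (size q)) = 0.
  apply/eqP; rewrite -(fmorph_eq0 (@ratr R[i])) -det_map_mx; apply/det0P.
  exists (poly_rV q).
    apply: contra_neq q0 => q0; rewrite -[q](@poly_rV_K _ (size q))// q0.
    exact: raddf0.
  apply/rowP => j; rewrite !mxE.
  transitivity (act q wC j); last by rewrite a_geom a0 mul0r.
  by apply: eq_bigr => i _; rewrite !mxE addnC.
move/hankel_singular => [D D0 [sD Dw]].
have {}Dw : forall k, act D w k = 0.
  by apply: (annihilator_of_initial P0 Pw) => k; rewrite sP => /Dw.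
have /(minpolyQ_size Pm D0) : root (map_poly ratr D) theta.
  by apply: (annihilator_root th1 y0 nw (m := 0)) => k _.
by rewrite sP ltnNge sD.
Qed.

Lemma minpolyQ_deriv_neq0 (R : realType) (theta : R) P : is_minpolyQ theta P ->
  ~~ root (map_poly ratr P^`()) theta.
Proof.
move=> Pm; have s1 := minpolyQ_size_gt1 Pm.
have P0 := minpolyQ_neq0 Pm.
have d0 : P^`() != 0.
  apply/negP => /eqP/polyP/(_ (size P).-2); rewrite coef_deriv coef0 => /eqP.
  rewrite mulrn_eq0 /= (_ : (size P).-2.+1 = (size P).-1); last first.
    by move: s1; move: (size P) => n; clear; lia.
  by rewrite -lead_coefE lead_coef_eq0 (negPf P0).
by apply/negP => /(minpolyQ_size Pm d0); rewrite leqNgt lt_size_deriv.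
Qed.

(** Let q = P / (X - theta). The sequence q(S) w is c theta^k where c is in
    Q[theta], and comparing growths c = q(theta) y. Moreover q(theta) is the
    value at theta of the derivative of P, which is not 0. *)
Lemma Qadjoin_leading (R : realType) (theta y : R) (w : nat -> rat) P :
  1 < theta -> is_minpolyQ theta P ->
  (forall k, act P w k = 0) -> null (fun k => y * theta ^+ k - ratr (w k)) ->
  Qadjoin theta y.
Proof.
move=> th1 Pm Pw nw; have [_ Pt _] := Pm.
have /factor_theorem[q PE] := Pt.
have qt : q.[theta] = (map_poly ratr P^`()).[theta].
  rewrite -deriv_map PE derivM derivXsubC mulr1 hornerD hornerM hornerXsubC.
  by rewrite subrr mulr0 add0r.
have qt0 : q.[theta] != 0 by rewrite qt; exact: minpolyQ_deriv_neq0.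
pose wR k : R := ratr (w k).
have a_geom : forall k, act q wR k = act q wR 0 * theta ^+ k.
  by apply: linear_factor_act => k; rewrite -PE act_map Pw rmorph0.
have th1' : 1 <= `|theta| by rewrite ger0_norm ltW// (lt_trans ltr01).
have a0 : q.[theta] * y - act q wR 0 = 0.
  apply: (geom_null (m := 0) th1' (null_act q nw)) => k _.
  by rewrite act_subr act_geom (a_geom k) mulrBl.
have -> : y = act q wR 0 * q.[theta]^-1.
  by move/eqP: a0; rewrite subr_eq0 => /eqP <-; rewrite mulrAC divff// mul1r.
apply: QadjoinM; last first.
  by apply: (QadjoinV Pm); rewrite qt; exact: Qadjoin_horner.
have Qq n i : (size q <= i + n)%N -> Qadjoin theta q`_i.
  elim: n i => [|n IH] i si.
    rewrite addn0 in si; rewrite nth_default// -(rmorph0 ratr); exact: Qadjoin_rat.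
  have : (map_poly ratr P)`_i.+1 = q`_i - q`_i.+1 * theta :> R.
    by rewrite PE mulrBr coefB coefMX coefMC.
  rewrite coef_map => h.
  have -> : q`_i = ratr P`_i.+1 + q`_i.+1 * theta by rewrite h; ring.
  apply: QadjoinD; first exact: Qadjoin_rat.
  by apply: QadjoinM; [apply: IH; rewrite addSn -addnS|exact: QadjoinX].
apply: Qadjoin_sum => i; apply: QadjoinM; last exact: Qadjoin_rat.
exact: (Qq (size q)) (leq_addl _ _).
Qed.

(** * Pisot's theorem and traces *)

Lemma act_int_denominator (D : {poly rat}) : exists2 N : int, N != 0 &
  forall (u : nat -> int) k, N%:~R * act D (fun i => (u i)%:~R) k \is a Num.int.
Proof.
have [q [a a0 ->]] := rat_poly_scale D.
exists a => // u k; rewrite actZ mulVKf ?intr_eq0//.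
apply: rpred_sum => i _; apply: rpredM; last exact: intr_int.
by rewrite coef_map /= intr_int.
Qed.

(** Pisot's theorem. Let C be a rational polynomial of least degree that
    annihilates the sequence u of integers from some index on. It vanishes at
    theta, so C = P D with P the minimal polynomial. If D vanished at theta,
    D(S) u would be a null sequence with bounded denominators, hence would
    vanish eventually, against the choice of C. So D(S) u is a rational
    sequence that is annihilated by P and asymptotic to x D(theta) theta^k with
    a nonzero coefficient, to which [conjugate_lt1] and [Qadjoin_leading]
    apply. *)
Theorem pisot_of_sum_sqr (R : realType) (theta x C : R) (u : nat -> int) :
  1 < theta -> x != 0 ->
  (forall n, \sum_(i < n) (x * theta ^+ i - (u i)%:~R) ^+ 2 <= C) ->
  pisot theta /\ Qadjoin theta x.
Proof.
move=> th1 x0 uC; pose v k : rat := (u k)%:~R.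
have nv : null (fun k => x * theta ^+ k - ratr (v k)).
  by apply: eq_null (null_of_sum_sqr uC) => k; rewrite /v ratr_int.
have [n0 hn0] := hankel_eventually_singular th1 uC.
have [C0 C00 C0u] : exists2 C : {poly rat}, C != 0 & forall k, act C v k = 0.
  apply: (@kronecker _ _ n0) => n /hn0 dn; apply: hankel_singular.
  rewrite -[RHS](rmorph0 intr) -dn -det_map_mx; congr (\det _).
  by apply/matrixP => i j; rewrite !mxE.
have [E Emonic Eu] := monic_int_annihilator C00 C0u.
have Et : root (map_poly intr E) theta.
  have := annihilator_root th1 x0 nv (fun k (_ : (0 <= k)%N) => Eu k).
  rewrite -map_poly_comp (_ : map_poly _ E = map_poly intr E)//.
  by apply: eq_map_poly => c /=; rewrite ratr_int.
have C0t := annihilator_root th1 x0 nv (fun k (_ : (0 <= k)%N) => C0u k).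
have [P Pm] := exists_minpolyQ C00 C0t.
have [Pmonic Pt Pdvd] := Pm.
pose Ann s := `[< exists (C : {poly rat}) m, [/\ C != 0, size C = s &
  forall k, (m <= k)%N -> act C v k = 0] >].
have exA : exists s, Ann s by exists (size C0); apply/asboolP; exists C0, 0%N.
case: (ex_minnP exA) => s /asboolP[{C0 C00 C0u C0t}C0 [m [C00 sC C0u]]] smin.
have /Pdvd/divpK := annihilator_root th1 x0 nv C0u; set D := C0 %/ P => CE.
have D0 : D != 0 by apply: contra_neq C00 => D0; rewrite -CE D0 mul0r.
have nw : null (fun k => x * (map_poly ratr D).[theta] * theta ^+ k - ratr (act D v k)).
  apply: eq_null (null_act (map_poly ratr D) nv) => k.
  by rewrite act_subr act_geom act_map [x * _]mulrC.
have y0 : x * (map_poly ratr D).[theta] != 0.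
  apply: mulf_neq0 => //; apply/negP => Dt.
  have [N N0 ND] := act_int_denominator D.
  have [J hJ] : exists J, forall k, (J <= k)%N -> act D v k = 0.
    apply: (int_null_eventually0 (R := R) N0) => [k|]; first exact: ND.
    apply: eq_null (null_mull (-1) nw) => k.
    by rewrite (eqP Dt) mulr0 mul0r sub0r mulN1r opprK.
  have : Ann (size D) by apply/asboolP; exists D, J.
  move/smin; rewrite -sC -CE size_mul// ?(minpolyQ_neq0 Pm)//.
  have := minpolyQ_size_gt1 Pm; have : (0 < size D)%N by rewrite lt0n size_poly_eq0.
  by move: (size P) (size D) => a b; clear; lia.
pose y := x * (map_poly ratr D).[theta] * theta ^+ m.
have th0 : theta != 0 by rewrite gt_eqF// (lt_trans ltr01).
have y1 : y != 0 by rewrite mulf_neq0// expf_neq0.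
pose w k := act D v (k + m)%N.
have Pw k : act P w k = 0.
  have := C0u (k + m)%N (leq_addl _ _); rewrite -CE mulrC act_mul => h.
  by rewrite -[RHS]h /act; apply: eq_bigr => i _; rewrite /w addnAC.
have nw' : null (fun k => y * theta ^+ k - ratr (w k)).
  apply: eq_null (null_shift m nw) => k; rewrite /y /w exprD.
  by congr (_ - _); ring.
split.
  split=> //; first by exists E.
  by exists P => // z zP zt; exact: (conjugate_lt1 th1 y1 Pm Pw nw' zP zt).
have Qy := Qadjoin_leading th1 Pm Pw nw'.
have Dt : (map_poly ratr D).[theta] != 0.
  by apply: contra_neq y0 => ->; rewrite mulr0.
have -> : x = y * ((map_poly ratr ('X^m * D)).[theta])^-1.
  rewrite rmorphM /= map_polyXn hornerM hornerXn /y; field.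
  by rewrite Dt expf_neq0.
by apply: QadjoinM => //; apply: (QadjoinV Pm); exact: Qadjoin_horner.
Qed.

Lemma minpolyQ_basis (R : realType) (theta : R) P : is_minpolyQ theta P ->
  is_Qbasis (Qadjoin theta) (fun i : 'I_(size P).-1 => theta ^+ i).
Proof.
move=> Pm; have P0 := minpolyQ_neq0 Pm; have [_ Pt _] := Pm.
have sP : (size P).-1.+1 = size P by rewrite prednK// lt0n size_poly_eq0.
split=> [i|c c0|x [Q _ <-]].
- by exists 'X^i => //; rewrite map_polyXn hornerXn.
- pose Q := rVpoly (\row_i c i).
  have Qc i : Q`_(i : 'I_(size P).-1) = c i by rewrite coef_rVpoly_ord mxE.
  have sQ : (size Q <= (size P).-1)%N by exact: size_poly.
  have [Q0|Q0] := eqVneq Q 0; first by move=> i; rewrite -Qc Q0 coef0.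
  suff /(minpolyQ_size Pm Q0) : root (map_poly ratr Q) theta.
    by move=> h; exfalso; move: h; rewrite -sP ltnNge sQ.
  rewrite /root (horner_coef_wide _ (n := (size P).-1)) ?size_map_poly//.
  by rewrite -[X in _ == X]c0; apply/eqP/eq_bigr => i _; rewrite coef_map Qc.
- exists (fun i => (Q %% P)`_i).
  rewrite {1}(divp_eq Q P) rmorphD rmorphM hornerD hornerM (eqP Pt) mulr0 add0r.
  rewrite (horner_coef_wide _ (n := (size P).-1)); last first.
    by rewrite size_map_poly -ltnS sP ltn_modp.
  by apply: eq_bigr => i _; rewrite coef_map.
Qed.

(** Let M be the matrix of the multiplication by G(theta) in the basis of the
    powers of theta. The relations that define M hold with any root z of P in
    place of theta, so the Vandermonde matrix of the roots conjugates M to the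
    diagonal matrix of the G(z). *)
Lemma trace_conjugates (R : realType) (theta : R) P : is_minpolyQ theta P ->
  exists s : seq R[i], [/\ map_poly ratr P = \prod_(z <- s) ('X - z%:P), uniq s &
    forall G : {poly rat}, exists2 t, is_trace theta (map_poly ratr G).[theta] t &
      ratr t = \sum_(z <- s) (map_poly ratr G).[z]].
Proof.
move=> Pm; have P0 := minpolyQ_neq0 Pm; have [Pmonic Pt _] := Pm.
have [s] := closed_field_poly_normal (map_poly (@ratr R[i]) P).
rewrite (monicP _) ?map_monic// scale1r => sE; exists s.
have us : uniq s.
  rewrite -separable_prod_XsubC -sE separable_map unlock.
  by apply: (minpolyQ_coprime Pm); exact: minpolyQ_deriv_neq0.
split=> // G.
have sP : size P = (size s).+1.
  by rewrite -(size_map_poly (@ratr R[i])) sE size_prod_XsubC.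
have := minpolyQ_basis Pm; rewrite sP /= => basis.
pose M : 'M[rat]_(size s) := \matrix_(i, j) ((G * 'X^i) %% P)`_j.
have modE (L : numFieldType) (z : L) (i : 'I_(size s)) : root (map_poly ratr P) z ->
    (map_poly ratr G).[z] * z ^+ i = \sum_j ratr (M i j) * z ^+ j.
  move=> Pz; have -> : (map_poly ratr G).[z] * z ^+ i =
      (map_poly ratr (G * 'X^i)).[z].
    by rewrite rmorphM /= map_polyXn hornerM hornerXn.
  rewrite (divp_eq (G * 'X^i) P) rmorphD rmorphM hornerD hornerM (eqP Pz).
  rewrite mulr0 add0r (horner_coef_wide _ (n := size s)); last first.
    by rewrite size_map_poly -ltnS -sP ltn_modp.
  by apply: eq_bigr => j _; rewrite mxE coef_map.
exists (\tr M).
  exists (size s), (fun i => theta ^+ i), M; split=> // i.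
  exact: modE.
pose r : 'rV[R[i]]_(size s) := \row_j s`_j.
pose W := Vandermonde (size s) r.
have Wunit : W \in unitmx.
  rewrite unitmxE unitfE det_Vandermonde; apply/prodf_neq0 => i _.
  apply/prodf_neq0 => j ij; rewrite !mxE subr_eq0 nth_uniq//.
  by rewrite gtn_eqF.
pose d : 'rV[R[i]]_(size s) := \row_j (map_poly ratr G).[s`_j].
have MW : map_mx ratr M *m W = W *m diag_mx d.
  apply/matrixP => i j; rewrite mul_mx_diag !mxE mulrC modE.
    by apply: eq_bigr => k _; rewrite !mxE.
  by rewrite sE root_prod_XsubC mem_nth.
have -> : ratr (\tr M) = \tr (map_mx (@ratr R[i]) M) by rewrite trace_map_mx.
have -> : map_mx (@ratr R[i]) M = W *m diag_mx d *m invmx W.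
  by rewrite -MW mulmxK.
rewrite mxtrace_mulC mulmxA mulVmx// mul1mx mxtrace_diag.
by rewrite (big_nth 0) big_mkord; apply: eq_bigr => i _; rewrite mxE.
Qed.

(** A monic integral recurrence preserves a common denominator of the initial
    terms. *)
Lemma monic_int_denominator (E : {poly int}) (t : nat -> rat) :
  E \is monic -> (forall k, act (map_poly intr E) t k = 0) ->
  exists2 N : int, N != 0 & forall k, N%:~R * t k \is a Num.int.
Proof.
move=> Emonic Et; set d := (size E).-1.
pose N := \prod_(k < d) denq (t k).
have N0 : N != 0 by apply/prodf_neq0 => k _; exact: denq_neq0.
exists N => //; elim/ltn_ind => k IH.
have [kd|dk] := ltnP k d.
  rewrite /N (bigD1 (Ordinal kd))//= rmorphM /= mulrAC [_ * t k]mulrC.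
  by rewrite -numqE -rmorphM intr_int.
have sE : size (map_poly (intr : int -> rat) E) = d.+1.
  by rewrite size_rat_int_poly prednK// lt0n size_poly_eq0 monic_neq0.
have := Et (k - d)%N; rewrite /act sE big_ord_recr /= subnK// coef_map /=.
rewrite -/d -lead_coefE (monicP Emonic) mul1r => /eqP; rewrite addr_eq0 => /eqP h.
rewrite -[t k]opprK -h mulrN rpredN mulr_sumr; apply: rpred_sum => i _.
rewrite mulrCA rpredM//; first by rewrite coef_map intr_int.
by apply: IH; have := ltn_ord i; lia.
Qed.

Lemma geom_lt1_null (R : realType) (c z : R[i]) :
  `|z| < 1 -> null (fun k => c * z ^+ k).
Proof.
move=> z1.
have [a cE] : exists a : R, `|c| = a%:C by rewrite normc_def; eexists.
have [r zE] : exists r : R, `|z| = r%:C by rewrite normc_def; eexists.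
have r0 : 0 <= r by rewrite -ler0c -zE.
have r1 : r < 1 by rewrite -ltcR -zE.
have nr : null (fun k => a * r ^+ k).
  apply: null_mull => rho rho0.
  have : (r ^+ k) @[k --> \oo] --> 0 by apply: cvg_expr; rewrite ger0_norm.
  move=> /cvgrPdist_lt/(_ _ rho0)[J _ hJ]; exists J => k /hJ.
  by rewrite sub0r normrN.
move=> rho /(null_complex nr)[J hJ]; exists J => k /hJ.
rewrite normrM normrX cE zE -rmorphXn -rmorphM /=.
apply: le_lt_trans; rewrite [leRHS]ger0_norm// lecR.
by rewrite mulr_ge0 ?exprn_ge0// -ler0c -cE.
Qed.

Lemma null_of_complex (R : realType) (e : nat -> R) :
  null (fun k => (e k)%:C : R[i]) -> null e.
Proof.
move=> ne rho rho0; have [|J hJ] := ne rho%:C; first by rewrite ltcR.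
exists J => k /hJ; rewrite normc_def /= expr0n addr0 sqrtr_sqr ltcR//.
Qed.

(** By [trace_conjugates] the trace of theta^n x is x theta^n plus a
    combination of n-th powers of the other conjugates, which tends to 0. So
    its difference with [u n] tends to 0; it has bounded denominators, hence it
    vanishes for large n. *)
Theorem Tset_of_null (R : realType) (theta x : R) (u : nat -> int) :
  pisot theta -> Qadjoin theta x ->
  null (fun k => x * theta ^+ k - (u k)%:~R) -> Tset theta x.
Proof.
move=> [th1 [E Emonic Et] [P Pm conj]] Qx nu; split => //.
have [G _ xE] := Qx.
have [s [sE us trG]] := trace_conjugates Pm.
have [Pmonic Pt Pdvd] := Pm.
have /choice[t tP] : forall n, exists t, is_trace theta (theta ^+ n * x) t /\
    ratr t = \sum_(z <- s) (map_poly ratr G).[z] * z ^+ n.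
  move=> n; have [t] := trG ('X^n * G).
  rewrite rmorphM /= map_polyXn hornerM hornerXn xE => trt tE; exists t.
  split=> //; rewrite tE; apply: eq_bigr => z _.
  by rewrite rmorphM /= map_polyXn hornerM hornerXn mulrC.
have root_s z : z \in s -> root (map_poly ratr P) z.
  by rewrite sE root_prod_XsubC.
have rE z : z \in s -> (map_poly ratr (map_poly intr E : {poly rat})).[z] = 0.
  have /Pdvd : root (map_poly ratr (map_poly intr E : {poly rat})) theta.
    rewrite -map_poly_comp (_ : map_poly _ E = map_poly intr E)//.
    by apply: eq_map_poly => c /=; rewrite ratr_int.
  rewrite dvdp_eq => /eqP -> /root_s/eqP zP.
  by rewrite rmorphM hornerM zP mulr0.
have [N N0 Nt] : exists2 N : int, N != 0 & forall k, N%:~R * t k \is a Num.int.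
  apply: (@monic_int_denominator E) => // k.
  apply/eqP; rewrite -(fmorph_eq0 (@ratr R[i])) -act_map; apply/eqP.
  transitivity (\sum_(z <- s) act (map_poly ratr (map_poly intr E))
      (fun n => (map_poly ratr G).[z] * z ^+ n) k).
    rewrite /act exchange_big; apply: eq_bigr => i _.
    by rewrite -mulr_sumr; congr (_ * _); exact: (tP _).2.
  by rewrite big_seq big1// => z zs; rewrite act_geom rE// !mul0r.
have ths : theta%:C \in s.
  rewrite -root_prod_XsubC -sE /root.
  rewrite (_ : map_poly _ P = map_poly (real_complex R) (map_poly ratr P)).
    by rewrite horner_map (eqP Pt) rmorph0.
  by rewrite -map_poly_comp; apply: eq_map_poly => c /=; rewrite fmorph_rat.
have [J hJ] : exists J, forall k, (J <= k)%N -> t k - (u k)%:~R = 0.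
  apply: (@int_null_eventually0 R _ N) => // [k|].
    by rewrite mulrBr rpredB// -rmorphM intr_int.
  apply: null_of_complex.
  apply: eq_null (null_add (null_complex nu) (@null_sum _ _
    (rem theta%:C s)
    (fun z n => (if `|z| < 1 then (map_poly ratr G).[z] else 0) * z ^+ n) _)).
    move=> k /=; rewrite !rmorphB /= fmorph_rat (tP k).2 ratr_int.
    rewrite (perm_big _ (perm_to_rem ths)) big_cons /=.
    rewrite [in RHS]addrAC; congr (_ + _).
      rewrite -xE rmorphM rmorphXn /= -horner_map -map_poly_comp /=.
      congr (_.[_] * _ - _); apply: eq_map_poly => c /=; exact: fmorph_rat.
    rewrite big_seq [RHS]big_seq; apply: eq_bigr => z.
    by rewrite mem_rem_uniq// inE => /andP[zt /root_s /conj ->].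
  move=> z; case: ifP => [|_]; first exact: geom_lt1_null.
  by move=> rho rho0; exists 0%N => k _; rewrite mul0r normr0.
exists J => // n /hJ /eqP; rewrite subr_eq0 => /eqP tn.
by rewrite (TrE (tP n).1) tn intr_int.
Qed.

(** * Fourier transforms of probability measures *)

Section BoundedMeasurable.
Context d (T : measurableType d) (R : realType) (P : probability T R).
Implicit Types f g : T -> R.

Lemma integrable_bounded_measurable f M :
  measurable_fun setT f -> (forall x, `|f x| <= M) ->
  P.-integrable setT (EFin \o f).
Proof.
move=> mf fM; apply: measurable_bounded_integrable => //.
  by rewrite /= probability_setT ltry.
exists M; split; first exact: num_real.
by move=> y My x _ /=; exact: le_trans (fM x) (ltW My).
Qed.

Lemma Rintegral_prob_cst (r : R) : \int[P]_x r = r.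
Proof. by rewrite Rintegral_cst//= probability_setT mulr1. Qed.

(** Integrate the inequality 2 m f - m^2 <= f^2 where m is the mean of f. *)
Lemma Rintegral_sqr_le f M : measurable_fun setT f -> (forall x, `|f x| <= M) ->
  (\int[P]_x f x) ^+ 2 <= \int[P]_x (f x ^+ 2).
Proof.
move=> mf fM; set m := \int[P]_x f x.
have m2 : measurable_fun setT (fun x => f x ^+ 2) by exact: measurable_funX.
have M2 x : `|f x ^+ 2| <= M ^+ 2.
  by rewrite normrX lerXn2r// nnegrE// (le_trans _ (fM x)).
have i2 := integrable_bounded_measurable m2 M2.
have i1 := integrable_bounded_measurable mf fM.
have mmf : measurable_fun setT (fun x => 2 * m * f x).
  by apply: measurable_funM.
have i3 : P.-integrable setT (EFin \o (fun x => 2 * m * f x)).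
  apply: (@integrable_bounded_measurable _ (`|2 * m| * M)) => // x.
  by rewrite normrM ler_wpM2l.
have i4 : P.-integrable setT (EFin \o cst (m ^+ 2)).
  exact: finite_measure_integrable_cst.
have : \int[P]_x (2 * m * f x - m ^+ 2) <= \int[P]_x (f x ^+ 2).
  apply: le_Rintegral => //.
    apply: (@integrable_bounded_measurable _ (`|2 * m| * M + m ^+ 2)) => [|x].
      exact: measurable_funB.
    rewrite (le_trans (ler_normB _ _))// normrM (ger0_norm (sqr_ge0 m)).
    by rewrite lerD2r ler_wpM2l.
  by move=> x _; have := sqr_ge0 (f x - m); rewrite !expr2; lra.
rewrite (@RintegralB _ _ _ _ _ (fun x => 2 * m * f x) (cst (m ^+ 2)))//=.
rewrite RintegralZl// Rintegral_prob_cst -/m.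
by rewrite -mulrA -expr2; lra.
Qed.

(** The right-hand side is the integral against a combination of image
    measures. Adding the bound [M] to the function reduces the claim to
    nonnegative functions, for which integrals are additive in the measure. *)
Lemma Rintegral_mixture N (p : 'I_N.+1 -> R) (psi : 'I_N.+1 -> T -> T) f M :
  (forall j, 0 <= p j) -> (forall j, measurable_fun setT (psi j)) ->
  \sum_j p j = 1 ->
  (forall A, measurable A -> P A = \sum_j (p j)%:E * P (psi j @^-1` A))%E ->
  measurable_fun setT f -> (forall x, `|f x| <= M) ->
  \int[P]_x f x = \sum_j p j * \int[P]_x f (psi j x).
Proof.
move=> p0 mpsi p1 PE mf fM.
have mfM g : measurable_fun setT g -> measurable_fun setT (fun x => g x + M).
  by move=> mg; exact: measurable_funD.
have gM0 g : (forall x, `|g x| <= M) -> forall x, 0 <= g x + M.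
  by move=> gM x; have := gM x; rewrite ler_norml => /andP[]; lra.
have Mint g : measurable_fun setT g -> (forall x, `|g x| <= M) ->
    (\int[P]_x (g x + M)%:E)%E = (\int[P]_x g x + M)%:E.
  move=> mg gM; have i1 := integrable_bounded_measurable mg gM.
  have i2 : P.-integrable setT (EFin \o cst M).
    exact: finite_measure_integrable_cst.
  rewrite -[X in _ + X]Rintegral_prob_cst -(RintegralD measurableT i1 i2).
  rewrite /Rintegral fineK//; apply: integrable_fin_num => //.
  apply: (@integrable_bounded_measurable (fun x => g x + M) (M + `|M|)).
    exact: mfM.
  by move=> x; apply: (le_trans (ler_normD _ _)); rewrite lerD2r.
pose pushed k : {measure set T -> \bar R} :=
  mscale (NngNum (p0 (inord k))) (pushforward P (psi (inord k))).
pose m := pushed (fun k => mpsi (inord k)).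
have : (\int[P]_x (f x + M)%:E = \int[msum m N.+1]_x (f x + M)%:E)%E.
  apply: eq_measure_integral => A mA _.
  rewrite /= PE// /msum; apply: eq_bigr => j _.
  by rewrite /m /pushed /= /mscale /= inord_val.
have mE : measurable_fun setT (EFin \o (fun x => f x + M)).
  by apply/measurable_EFinP; exact: mfM.
rewrite Mint// ge0_integral_measure_sum//=; last first.
  by move=> x _; rewrite lee_fin gM0.
under eq_bigr => k _.
  rewrite inord_val ge0_integral_mscale//=; last by move=> x _; rewrite lee_fin gM0.
  rewrite ge0_integral_pushforward//=; last by move=> x _; rewrite lee_fin gM0.
  rewrite preimage_setT (Mint (f \o psi k)); last 2 first.
  - exact: measurableT_comp.
  - by move=> x; exact: fM.
  rewrite -EFinM mulrDr.
  over.
rewrite sumEFin => -[].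
by rewrite big_split /= -mulr_suml p1 mul1r => /addIr.
Qed.

End BoundedMeasurable.

(** The square of the modulus as an element of [R]. Working with squares keeps
    all estimates polynomial in the real and imaginary parts. *)
Definition sqmod (R : rcfType) (z : R[i]) : R := complex.Re z ^+ 2 + complex.Im z ^+ 2.

Definition e2pi (R : realType) (x : R) : R[i] :=
  cos (2 * pi * x) +i* sin (2 * pi * x).

Lemma measurable_affine (R : realType) (a b : R) :
  measurable_fun setT (affine a b : measurableTypeR R -> measurableTypeR R).
Proof.
apply: (@continuous_measurable_fun R) => x.
by apply: cvgD; [apply: cvgMr; exact: cvg_id|exact: cvg_cst].
Qed.

Section Fourier.
Context (R : realType) (nu : probability (measurableTypeR R) R).

Lemma continuous_cosM (a : R) : continuous (fun x => cos (a * x)).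
Proof.
move=> x; apply: (continuous_comp (f := fun x => a * x) (g := cos)).
  by apply: cvgMr; exact: cvg_id.
exact: continuous_cos.
Qed.

Lemma continuous_sinM (a : R) : continuous (fun x => sin (a * x)).
Proof.
move=> x; apply: (continuous_comp (f := fun x => a * x) (g := sin)).
  by apply: cvgMr; exact: cvg_id.
exact: continuous_sin.
Qed.

Let mcos (a : R) : measurable_fun setT (fun x : measurableTypeR R => cos (a * x)).
Proof. exact: (continuous_measurable_fun (@continuous_cosM a)). Qed.

Let msin (a : R) : measurable_fun setT (fun x : measurableTypeR R => sin (a * x)).
Proof. exact: (continuous_measurable_fun (@continuous_sinM a)). Qed.

Let cos1 (x : R) : `|cos x| <= 1.
Proof. by rewrite ler_norml cos_geN1 cos_le1. Qed.

Let sin1 (x : R) : `|sin x| <= 1.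
Proof. by rewrite ler_norml sin_geN1 sin_le1. Qed.

Let icos a := integrable_bounded_measurable nu (@mcos a) (fun x => cos1 (a * x)).
Let isin a := integrable_bounded_measurable nu (@msin a) (fun x => sin1 (a * x)).

Let icosZ k a : nu.-integrable setT (EFin \o (fun x => k * cos (a * x))).
Proof.
apply: (@integrable_bounded_measurable _ _ _ nu _ `|k|) => [|x].
  by apply: measurable_funM => //; exact: mcos.
by rewrite normrM ler_piMr.
Qed.

Let isinZ k a : nu.-integrable setT (EFin \o (fun x => k * sin (a * x))).
Proof.
apply: (@integrable_bounded_measurable _ _ _ nu _ `|k|) => [|x].
  by apply: measurable_funM => //; exact: msin.
by rewrite normrM ler_piMr.
Qed.

Lemma fourier0 : fourier nu 0 = 1.
Proof.
rewrite /fourier; congr (_ +i* _).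
  under eq_Rintegral => x _ do rewrite mulr0 mul0r cos0.
  exact: Rintegral_prob_cst.
under eq_Rintegral => x _ do rewrite mulr0 mul0r sin0.
exact: Rintegral_prob_cst.
Qed.

Lemma fourier_continuous0 (eps : R) : 0 < eps -> exists2 delta, 0 < delta &
  forall t, `|t| < delta -> 1 - complex.Re (fourier nu t) < eps.
Proof.
move=> e0.
have := @continuity_under_integral R _ (measurableTypeR R) nu
  (fun t x => cos (2 * pi * t * x)) setT measurableT (-1) 1
  (fun t _ => icos (2 * pi * t)) _ (cst 1)
  (finite_measure_integrable_cst nu 1 measurableT) _.
have cont : {ae nu, forall y, [set: measurableTypeR R] y ->
    {in `]-1, 1[%classic, continuous ((fun t x : R => cos (2 * pi * t * x)) ^~ y)}}.
  apply: aeW => y _ t _.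
  under eq_fun do rewrite mulrAC.
  exact: continuous_cosM.
move=> /(_ cont) {cont}.
have bnd : forall x : R, `]-1, 1[%classic x ->
    {ae nu, forall y, [set: measurableTypeR R] y -> `|cos (2 * pi * x * y)| <= cst 1 y}.
  by move=> x _; apply: aeW => y _ /=.
move=> /(_ bnd) {bnd} /(_ 0) h.
have /h{h} : (0 : R) \in `]-1, 1[%classic by rewrite inE/= in_itv/= ltrN10 ltr01.
move=> /cvgrPdist_lt/(_ _ e0)[/= delta d0 h]; exists delta => // t td.
have := h t; rewrite /= sub0r normrN => /(_ td).
have /(congr1 (@complex.Re R)) /= -> := fourier0.
by apply: le_lt_trans; exact: ler_norm.
Qed.

(** Krein's inequality. It turns the continuity of the transform at 0 into
    uniform continuity. *)
Lemma sqmod_fourier_sub (t s : R) :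
  sqmod (fourier nu t - fourier nu s) <= 2 * (1 - complex.Re (fourier nu (t - s))).
Proof.
rewrite /fourier /sqmod /=.
rewrite -!RintegralB//; try exact: icos; try exact: isin.
have b2 (f g : R -> R) : (forall x, `|f x| <= 1) -> (forall x, `|g x| <= 1) ->
    forall x, `|f x - g x| <= 2.
  move=> f1 g1 x; apply: (le_trans (ler_normB _ _)).
  by have := f1 x; have := g1 x; lra.
pose C x : R := cos (2 * pi * t * x) - cos (2 * pi * s * x).
pose S x : R := sin (2 * pi * t * x) - sin (2 * pi * s * x).
have mC : measurable_fun setT (C : measurableTypeR R -> R).
  by apply: measurable_funB; exact: mcos.
have mS : measurable_fun setT (S : measurableTypeR R -> R).
  by apply: measurable_funB; exact: msin.
have C2 : forall x, `|C x| <= 2 by apply: b2.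
have S2 : forall x, `|S x| <= 2 by apply: b2.
apply: (le_trans (lerD (Rintegral_sqr_le nu mC C2) (Rintegral_sqr_le nu mS S2))).
have sq (f : R -> R) : (forall x, `|f x| <= 2) -> forall x, `|f x ^+ 2| <= 4.
  by move=> f2 x; rewrite normrX; have := f2 x; have := normr_ge0 (f x); rewrite expr2; nra.
rewrite -RintegralD//; last 2 first.
  apply: (@integrable_bounded_measurable _ _ _ nu _ 4); first exact: measurable_funX.
  exact: sq.
  apply: (@integrable_bounded_measurable _ _ _ nu _ 4); first exact: measurable_funX.
  exact: sq.
rewrite -[X in 2 * (X - _)](Rintegral_prob_cst nu) -RintegralB//; last first.
  exact: finite_measure_integrable_cst.
rewrite -RintegralZl//; last first.
  apply: (@integrable_bounded_measurable _ _ _ nu _ 2).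
    by apply: measurable_funB => //; exact: mcos.
  by apply: (b2 (cst 1)) => x; rewrite //= normr1.
rewrite le_eqVlt; apply/orP; left; apply/eqP; apply: eq_Rintegral => x _.
have -> : 2 * pi * (t - s) * x = 2 * pi * t * x - 2 * pi * s * x by ring.
rewrite /C /S cosB.
have := cos2Dsin2 (2 * pi * t * x); have := cos2Dsin2 (2 * pi * s * x).
by rewrite !expr2; lra.
Qed.

Lemma sqmod_fourier_le1 t : sqmod (fourier nu t) <= 1.
Proof.
rewrite /sqmod /fourier /=.
apply: (le_trans (lerD (Rintegral_sqr_le nu (@mcos _) (fun x => cos1 _))
   (Rintegral_sqr_le nu (@msin _) (fun x => sin1 _)))).
have sq (f : R -> R) : (forall x, `|f x| <= 1) -> forall x, `|f x ^+ 2| <= 1.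
  by move=> f2 x; rewrite normrX; have := f2 x; have := normr_ge0 (f x); rewrite expr2; nra.
rewrite -RintegralD//; last 2 first.
  apply: (@integrable_bounded_measurable _ _ _ nu _ 1).
    by apply: measurable_funX; exact: mcos.
  by apply: sq => x.
  apply: (@integrable_bounded_measurable _ _ _ nu _ 1).
    by apply: measurable_funX; exact: msin.
  by apply: sq => x.
under eq_Rintegral do rewrite cos2Dsin2.
by rewrite Rintegral_prob_cst.
Qed.

Lemma sqmod_fourierN t : sqmod (fourier nu (- t)) = sqmod (fourier nu t).
Proof.
rewrite /sqmod /fourier /=; congr (_ ^+ 2 + _).
  by apply: eq_Rintegral => x _; rewrite mulrN mulNr cosN.
under eq_Rintegral do rewrite mulrN mulNr sinN -mulN1r.
by rewrite RintegralZl// mulN1r sqrrN.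
Qed.

Lemma fourier_uniform_continuous (eps : R) : 0 < eps ->
  exists2 delta, 0 < delta &
    forall t s, `|t - s| < delta -> sqmod (fourier nu t - fourier nu s) < eps.
Proof.
move=> e0; have e2 : 0 < eps / 2 by rewrite divr_gt0.
have [delta d0 hd] := fourier_continuous0 e2; exists delta => // t s /hd h.
by apply: (le_lt_trans (sqmod_fourier_sub t s)); rewrite mulrC -ltr_pdivlMr.
Qed.

Lemma fourier_functional_equation N (p r b : 'I_N.+1 -> R) :
  (forall j, 0 <= p j) -> \sum_j p j = 1 ->
  invariant_measure p (fun j => affine (r j) (b j)) nu ->
  forall t, fourier nu t = \sum_j (p j)%:C * (e2pi (t * b j) * fourier nu (r j * t)).
Proof.
move=> p0 p1 nu_inv t.
have maff j := measurable_affine (r j) (b j).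
have cosE := Rintegral_mixture p0 maff p1 nu_inv (@mcos (2 * pi * t)) (fun x => cos1 _).
have sinE := Rintegral_mixture p0 maff p1 nu_inv (@msin (2 * pi * t)) (fun x => sin1 _).
rewrite {1}/fourier cosE sinE.
have argE j x : 2 * pi * t * affine (r j) (b j) x =
    2 * pi * (t * b j) + 2 * pi * (r j * t) * x by rewrite /affine; ring.
have : forall z : R[i], forall a c, complex.Re z = a -> complex.Im z = c -> a +i* c = z.
  by case=> ? ? ? ? /= <- <-.
apply.
  rewrite raddf_sum /=; apply: eq_bigr => j _; rewrite /e2pi /fourier /=.
  rewrite !mul0r !subr0; congr (_ * _).
  under [RHS]eq_Rintegral do rewrite argE cosD.
  rewrite RintegralB//.
  by rewrite !RintegralZl.
rewrite raddf_sum /=; apply: eq_bigr => j _; rewrite /e2pi /fourier /=.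
rewrite !mul0r !addr0; congr (_ * _).
under [RHS]eq_Rintegral do rewrite argE sinD.
rewrite RintegralD//.
by rewrite !RintegralZl// addrC.
Qed.

(** The image of [nu] under y |-> a y + c. *)
Lemma exists_affine_image N (p : 'I_N.+1 -> R) (phi : 'I_N.+1 -> R -> R) a c :
  a != 0 -> invariant_measure p phi nu ->
  exists w : probability (measurableTypeR R) R,
    invariant_measure p (conj_family a c phi) w.
Proof.
move=> a0 nu_inv.
have maff := measurable_affine a c.
pose f : {mfun measurableTypeR R >-> measurableTypeR R} :=
  HB.pack (affine a c : measurableTypeR R -> measurableTypeR R)
    (isMeasurableFun.Build _ _ _ _ _ maff).
exists (distribution nu f) => A mA.
have mfA : measurable (f @^-1` A).
  by rewrite -[X in measurable X]setTI; apply: (maff _ A).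
rewrite /= /distribution /pushforward nu_inv//; apply: eq_bigr => j _.
congr (_ * nu _)%E; apply/seteqP; split=> x /=;
  by rewrite /conj_family /= affineK.
Qed.

End Fourier.

(** * The functional equation on the logarithmic scale *)

Lemma sqmod_ge0 (R : rcfType) (z : R[i]) : 0 <= sqmod z.
Proof. by rewrite addr_ge0 ?sqr_ge0. Qed.

Lemma sqmodM (R : rcfType) (z w : R[i]) : sqmod (z * w) = sqmod z * sqmod w.
Proof. by case: z w => [a b] [c d]; rewrite /sqmod /=; ring. Qed.

Lemma sqmodN (R : rcfType) (z : R[i]) : sqmod (- z) = sqmod z.
Proof. by case: z => [a b]; rewrite /sqmod /=; ring. Qed.

Lemma sqmod_subC (R : rcfType) (z w : R[i]) : sqmod (z - w) = sqmod (w - z).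
Proof. by rewrite -sqmodN opprB. Qed.

Lemma sqmodD_le (R : rcfType) (z w : R[i]) :
  sqmod (z + w) <= 2 * (sqmod z + sqmod w).
Proof.
case: z w => [a b] [c d]; rewrite /sqmod /=.
by have := sqr_ge0 (a - c); have := sqr_ge0 (b - d); rewrite !expr2; lra.
Qed.

Lemma sqmodB_le (R : rcfType) (z w : R[i]) :
  sqmod (z - w) <= 2 * (sqmod z + sqmod w).
Proof. by rewrite -(sqmodN w); exact: sqmodD_le. Qed.

Lemma sqmod_le_near (R : rcfType) (z w : R[i]) :
  sqmod z <= 2 * (sqmod (w - z) + sqmod w).
Proof. by rewrite sqmod_subC -{1}[z](subrK w); exact: sqmodD_le. Qed.

Lemma sqmod_eq0 (R : rcfType) (z : R[i]) : sqmod z = 0 -> z = 0.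
Proof.
case: z => [a b] /eqP; rewrite /sqmod /= paddr_eq0 ?sqr_ge0// !sqrf_eq0.
by move=> /andP[/eqP -> /eqP ->].
Qed.

Lemma sqmod_e2pi (R : realType) (x : R) : sqmod (e2pi x) = 1.
Proof. exact: cos2Dsin2. Qed.

Lemma e2piD (R : realType) (x y : R) : e2pi (x + y) = e2pi x * e2pi y.
Proof.
rewrite /e2pi mulrDr cosD sinD; apply/eqP; rewrite eq_complex /=.
by apply/andP; split; apply/eqP; ring.
Qed.

Lemma e2pi0 (R : realType) : e2pi (0 : R) = 1.
Proof. by rewrite /e2pi mulr0 cos0 sin0. Qed.

Lemma e2piNK (R : realType) (x : R) : e2pi x * e2pi (- x) = 1.
Proof. by rewrite -e2piD subrr e2pi0. Qed.

(** The variance of the [z j] for the weights [p j]. *)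
Lemma sqmod_variance (R : rcfType) (I : finType) (p : I -> R) (z : I -> R[i])
    (m : R[i]) : \sum_j p j = 1 -> m = \sum_j (p j)%:C * z j ->
  \sum_j p j * sqmod (z j - m) = \sum_j p j * sqmod (z j) - sqmod m.
Proof.
move=> p1 mE.
have re : complex.Re m = \sum_j p j * complex.Re (z j).
  rewrite mE raddf_sum; apply: eq_bigr => j _ /=.
  by case: (z j) => x y /=; rewrite mul0r subr0.
have im : complex.Im m = \sum_j p j * complex.Im (z j).
  rewrite mE raddf_sum; apply: eq_bigr => j _ /=.
  by case: (z j) => x y /=; rewrite mul0r addr0.
transitivity (\sum_j (p j * sqmod (z j) + p j * sqmod m
   - 2 * complex.Re m * (p j * complex.Re (z j))
   - 2 * complex.Im m * (p j * complex.Im (z j)))).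
  apply: eq_bigr => j _; case: (z j) m {mE re im} => [x y] [s t].
  by rewrite /sqmod /=; ring.
rewrite !big_split /= !sumrN -!mulr_sumr -mulr_suml p1 -re -im.
by rewrite /sqmod; ring.
Qed.

Lemma sqmod_convex (R : rcfType) (I : finType) (p : I -> R) (z : I -> R[i]) :
  (forall j, 0 <= p j) -> \sum_j p j = 1 ->
  sqmod (\sum_j (p j)%:C * z j) <= \sum_j p j * sqmod (z j).
Proof.
move=> p0 p1; rewrite -subr_ge0 -(sqmod_variance p1 erefl).
by apply: sumr_ge0 => j _; rewrite mulr_ge0// sqmod_ge0.
Qed.

(** Think of the random walk that jumps from u to u - a j with probability p j;
    it drifts to -oo. The linear function u - A + step is a barrier: its
    average after one jump is smaller by the drift. If g exceeded c somewhere
    above A, then g - c - eta (u - A + step) would have a positive supremum for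
    small eta, and one jump would improve any value close to this supremum by
    the fixed amount eta times the drift. The set [Omega] allows the principle
    to be applied along a single orbit of the walk. *)
Lemma maximum_principle (R : realType) (I : finType) (p a : I -> R)
    (Omega : R -> Prop) (g : R -> R) (A step c M : R) :
  (forall j, 0 <= p j) -> \sum_j p j = 1 -> 0 < \sum_j p j * a j ->
  (forall j, a j <= step) ->
  (forall j u, Omega u -> Omega (u - a j)) ->
  (forall u, g u <= M) ->
  (forall u, Omega u -> A <= u -> g u <= \sum_j p j * g (u - a j)) ->
  (forall u, Omega u -> A - step <= u -> u < A -> g u <= c) ->
  forall u, Omega u -> A <= u -> g u <= c.
Proof.
move=> p0 p1 drift astep Om gM gsub gc u0 Ou0 Au0; rewrite leNgt; apply/negP => cg.
set mu := \sum_j _ in drift.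
have step0 : 0 < step.
  rewrite ltNge; apply/negP => s0; move: drift; rewrite ltNge => /negP; apply.
  apply: sumr_le0 => j _; rewrite mulr_ge0_le0//; exact: le_trans (astep j) s0.
(* With this slope the penalized value at u0 is (g u0 - c) / 2. *)
pose eta := (g u0 - c) / (2 * (u0 - A + step)).
have dpos : 0 < u0 - A + step by lra.
have eta0 : 0 < eta by rewrite divr_gt0 ?subr_gt0// mulr_gt0.
pose v u := g u - c - eta * (u - A + step).
have v0 : 0 < v u0.
  have -> : v u0 = (g u0 - c) / 2; last by lra.
  by rewrite /v /eta; field; rewrite gt_eqF.
pose S := [set v u | u in [set u | Omega u /\ A - step <= u]].
have supS : has_sup S.
  split; first by exists (v u0), u0 => //; split=> //; lra.
  exists (M - c) => _ [u [Ou Au] <-]; rewrite /v.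
  have : 0 <= eta * (u - A + step) by rewrite mulr_ge0 ?(ltW eta0)//; lra.
  have := gM u; lra.
have ubS u : Omega u -> A - step <= u -> v u <= sup S.
  by move=> Ou Au; apply: ub_le_sup; [exact: supS.2|exists u].
have S0 : 0 < sup S by apply: (lt_le_trans v0); apply: ubS => //; lra.
have etamu : 0 < eta * mu by rewrite mulr_gt0.
have e0 : 0 < Num.min (sup S) (eta * mu) by rewrite lt_min S0.
have [_ [u [Ou Au] <-] vu] := sup_adherent e0 supS.
have [uA|{}Au] := ltP u A.
  have : v u <= 0.
    have : 0 <= eta * (u - A + step) by rewrite mulr_ge0 ?(ltW eta0)//; lra.
    have := gc u Ou Au uA; rewrite /v; lra.
  have : Num.min (sup S) (eta * mu) <= sup S by rewrite ge_min lexx.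
  by lra.
have : v u <= \sum_j p j * v (u - a j) - eta * mu.
  have -> : \sum_j p j * v (u - a j) =
      \sum_j p j * g (u - a j) - c - eta * (u - A + step) + eta * mu.
    transitivity (\sum_j (p j * g (u - a j) - p j * (c + eta * (u - A + step))
        + eta * (p j * a j))).
      by apply: eq_bigr => j _; rewrite /v; ring.
    by rewrite !big_split /= sumrN -mulr_suml -mulr_sumr p1 -/mu; ring.
  have := gsub u Ou Au; rewrite /v; lra.
have : \sum_j p j * v (u - a j) <= sup S.
  rewrite -[leRHS]mul1r -p1 mulr_suml; apply: ler_sum => j _.
  apply: ler_wpM2l => //; apply: ubS; first exact: Om.
  by have := astep j; lra.
have : Num.min (sup S) (eta * mu) <= eta * mu by rewrite ge_min lexx orbT.
by lra.
Qed.

(** The functional equation of the Fourier transform of an invariant measure,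
    in the variable u = log t. It only sees t > 0. *)
Definition log_equation (R : realType) (I : finType) (p a b : I -> R)
    (F : R -> R[i]) :=
  forall u, F (expR u) =
    \sum_j (p j)%:C * (e2pi (expR u * b j) * F (expR (u - a j))).

Definition sq_uniform_continuous (R : realType) (F : R -> R[i]) :=
  forall eps, 0 < eps -> exists2 delta, 0 < delta &
    forall t s, `|t - s| < delta -> sqmod (F t - F s) < eps.

Definition sq_continuous0 (R : realType) (F : R -> R[i]) :=
  forall eps, 0 < eps -> exists2 delta, 0 < delta &
    forall t, `|t| < delta -> sqmod (F t - F 0) < eps.

(** The squared modulus D of the difference of two solutions is subharmonic,
    and it is small near u = -oo since the solutions agree at t = 0. The
    maximum principle propagates this smallness to all u. *)
Lemma log_equation_unique (R : realType) (I : finType) (p a b : I -> R)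
    (F G : R -> R[i]) :
  (forall j, 0 <= p j) -> \sum_j p j = 1 -> 0 < \sum_j p j * a j ->
  (forall t, sqmod (F t) <= 1) -> (forall t, sqmod (G t) <= 1) ->
  sq_continuous0 F -> sq_continuous0 G -> F 0 = G 0 ->
  log_equation p a b F -> log_equation p a b G ->
  forall t, 0 < t -> F t = G t.
Proof.
move=> p0 p1 drift F1 G1 Fc Gc FG0 FE GE t t0.
apply/eqP; rewrite -subr_eq0; apply/eqP/sqmod_eq0.
rewrite -(lnK t0); set D := fun u => sqmod (F (expR u) - G (expR u)).
rewrite -/(D (ln t)); apply/eqP; rewrite eq_le sqmod_ge0 andbT.
apply/ler_addgt0Pl => eps e0; rewrite addr0.
have e4 : 0 < eps / 4 by rewrite divr_gt0.
have [d1 d10 h1] := Fc _ e4; have [d2 d20 h2] := Gc _ e4.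
pose d := Num.min d1 d2.
have d0 : 0 < d by rewrite lt_min d10.
pose step := \sum_j `|a j|.
have astep j : a j <= step.
  apply: (le_trans (ler_norm _)); rewrite /step (bigD1 j)//= lerDl.
  by apply: sumr_ge0.
have small u : u < ln d -> D u <= eps.
  move=> ud; have {}ud : expR u < d by rewrite -[d]lnK// ltr_expR.
  rewrite /D -[F _](subrK (F 0)) {2}FG0 -addrA.
  rewrite -[X in _ + X](opprB _ (G 0)).
  apply: (le_trans (sqmodB_le _ _)).
  move: ud; rewrite lt_min => /andP[ud1 ud2].
  have := h1 (expR u); have := h2 (expR u).
  rewrite ger0_norm ?expR_ge0// => /(_ ud2) + /(_ ud1); lra.
have [tA|] := ltP (ln t) (ln d); first exact: small.
apply: (@maximum_principle _ _ p a (fun=> True) D (ln d) step eps 4) => //.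
- by move=> u; rewrite /D; have := sqmodB_le (F (expR u)) (G (expR u));
    have := F1 (expR u); have := G1 (expR u); lra.
- move=> u _ _; rewrite /D FE GE -sumrB.
  under eq_bigr do rewrite -mulrBr -mulrBr.
  apply: le_trans (sqmod_convex _ p0 p1) _.
  by apply: ler_sum => j _; rewrite sqmodM sqmod_e2pi mul1r.
- by move=> u _ _; exact: small.
Qed.

(** * Approximate symmetries *)

(** Having a finite total mass on the logarithmic scale is used in two senses,
    [finite_integral] and [finite_lattice_sum]. The predicate [Tr] describes
    the translations that preserve the notion. *)
Record finiteness_class (R : realType) (Fin : (R -> R) -> Prop) (Tr : R -> Prop)
    : Prop := FinitenessClass {
  fin_le : forall f h : R -> R, (forall u, 0 <= f u <= h u) -> Fin h -> Fin f;
  fin_add : forall f h : R -> R, Fin f -> Fin h -> Fin (fun u => f u + h u);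
  fin_scale : forall (c : R) f, 0 <= c -> Fin f -> Fin (fun u => c * f u);
  fin_shift : forall x f, Tr x -> Fin f -> Fin (fun u => f (u - x));
  tr_add : forall x y, Tr x -> Tr y -> Tr (x + y);
  tr_opp : forall x, Tr x -> Tr (- x) }.

(** It measures how far the map y |-> expR (- x) * y + b is from being a
    symmetry of [F], in the sense that F(t) = e(t b) F(exp(-x) t). *)
Definition defect (R : realType) (F : R -> R[i]) (x b u : R) : R :=
  sqmod (e2pi (expR u * b) * F (expR (u - x)) - F (expR u)).

Definition approx_symmetry (R : realType) (Fin : (R -> R) -> Prop) (Tr : R -> Prop)
    (F : R -> R[i]) (x b : R) := Tr x /\ Fin (defect F x b).

(** The amount by which the subharmonicity of the squared modulus of [F] is
    strict at u. *)
Definition energy (R : realType) (I : finType) (p a : I -> R) (F : R -> R[i])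
    (u : R) : R :=
  \sum_j p j * sqmod (F (expR (u - a j))) - sqmod (F (expR u)).

Section ApproxSymmetry.
Context (R : realType) (Fin : (R -> R) -> Prop) (Tr : R -> Prop).
Hypothesis cls : finiteness_class Fin Tr.
Variable F : R -> R[i].

Lemma eq_fin (f h : R -> R) : f =1 h -> Fin f -> Fin h.
Proof. by move=> /funext ->. Qed.

Lemma approx_symmetry_comp x b y c :
  approx_symmetry Fin Tr F x b -> approx_symmetry Fin Tr F y c ->
  approx_symmetry Fin Tr F (x + y) (b + expR (- x) * c).
Proof.
move=> [Tx fx] [Ty fy]; split; first exact: (tr_add cls).
have := fin_scale cls (ler0n R 2) (fin_add cls (fin_shift cls Tx fy) fx).
apply: (fin_le cls) => u; rewrite sqmod_ge0 /=.
have -> : defect F y c (u - x) = sqmod (e2pi (expR u * b) *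
    (e2pi (expR (u - x) * c) * F (expR (u - (x + y))) - F (expR (u - x)))).
  by rewrite sqmodM sqmod_e2pi mul1r /defect opprD addrA.
rewrite {1}/defect; apply: le_trans (sqmodD_le _ _).
rewrite mulrBr mulrA -e2piD addrA subrK.
by rewrite mulrDr mulrA -expRD lexx.
Qed.

Lemma approx_symmetry_inv x b :
  approx_symmetry Fin Tr F x b -> approx_symmetry Fin Tr F (- x) (- (expR x * b)).
Proof.
move=> [Tx fx]; split; first exact: (tr_opp cls).
have := fin_shift cls (tr_opp cls Tx) fx.
apply: (fin_le cls) => u; rewrite sqmod_ge0 /= /defect opprK addrK.
rewrite -[leLHS]mul1r -(sqmod_e2pi (expR (u + x) * b)) -sqmodM mulrBr mulrA.
rewrite mulrN mulrA -expRD e2piNK mul1r.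
by rewrite sqmod_subC lexx.
Qed.

(** For a translation the defect factors: F is small in the mean wherever t d
    is far from the integers. *)
Lemma approx_translation d : approx_symmetry Fin Tr F 0 d ->
  Fin (fun u => sqmod (e2pi (expR u * d) - 1) * sqmod (F (expR u))).
Proof.
move=> [_]; apply: eq_fin => u; rewrite /defect subr0 -sqmodM mulrBl mul1r //.
Qed.

Section Generators.
Context (I : finType) (p a b : I -> R).
Hypothesis p_gt0 : forall j, 0 < p j.
Hypothesis p_sum : \sum_j p j = 1.
Hypothesis FE : log_equation p a b F.
Hypothesis fin_energy : Fin (energy p a F).
Hypothesis Ta : forall j, Tr (a j).

Lemma energyE u : energy p a F u = \sum_j p j * defect F (a j) (b j) u.
Proof.
rewrite [RHS](sqmod_variance (m := F (expR u)) p_sum (FE u)).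
congr (_ - _); apply: eq_bigr => j _.
by rewrite sqmodM sqmod_e2pi mul1r.
Qed.

(** By the variance identity, the energy is the average of the defects of the
    maps of the system. *)
Lemma approx_symmetry_generator j : approx_symmetry Fin Tr F (a j) (b j).
Proof.
split=> //; have pV0 : 0 <= (p j)^-1 by rewrite invr_ge0 ltW.
have := fin_scale cls pV0 fin_energy; apply: (fin_le cls) => u.
rewrite sqmod_ge0 /= mulrC ler_pdivlMr// energyE (bigD1 j)//= mulrC lerDl.
by apply: sumr_ge0 => i _; rewrite mulr_ge0 ?sqmod_ge0// ltW.
Qed.

(** The approximate symmetries form a group, so every element of the group
    generated by the [a j] is the logarithmic ratio of one of them. *)
Lemma approx_symmetry_group (n : I -> int) :
  exists c, approx_symmetry Fin Tr F (\sum_j (n j)%:~R * a j) c.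
Proof.
pose G x := exists c, approx_symmetry Fin Tr F x c.
have GD x y : G x -> G y -> G (x + y).
  by move=> [b1 h1] [b2 h2]; eexists; exact: approx_symmetry_comp h1 h2.
have GN x : G x -> G (- x) by move=> [b1 h1]; eexists; exact: approx_symmetry_inv h1.
have G0 : G 0.
  case: (pickP I) => [j0 _|I0]; last first.
    by move: p_sum; rewrite big_pred0// => /eqP; rewrite eq_sym oner_eq0.
  rewrite -(subrr (a j0)); apply: (GD); [|apply: GN];
    by exists (b j0); exact: approx_symmetry_generator.
rewrite -/(G _); elim/big_rec: _ => // j x _ Gx; apply: (GD) => //.
have Gnat k : G (k%:R * a j).
  elim: k => [|k IH]; first by rewrite mul0r.
  rewrite -natr1 mulrDl mul1r; apply: (GD) => //.
  by exists (b j); exact: approx_symmetry_generator.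
case: (n j) => k; first by rewrite -pmulrn; exact: Gnat.
by rewrite NegzE rmorphN /= mulNr; apply: (GN); rewrite -pmulrn; exact: Gnat.
Qed.

End Generators.
End ApproxSymmetry.

Lemma approx_symmetry_commutator (R : realType) (Fin : (R -> R) -> Prop) Tr
    (F : R -> R[i]) x b y c :
  finiteness_class Fin Tr ->
  approx_symmetry Fin Tr F x b -> approx_symmetry Fin Tr F y c ->
  approx_symmetry Fin Tr F 0 (b + expR (- x) * c - (c + expR (- y) * b)).
Proof.
move=> cls gx gy.
have := approx_symmetry_comp cls (approx_symmetry_comp cls gx gy)
  (approx_symmetry_inv cls (approx_symmetry_comp cls gy gx)).
rewrite [y + x]addrC subrr mulrN mulrA -expRD addNr expR0 mul1r//.
Qed.

(** * Finite integrals on the logarithmic scale *)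

Lemma exists_primitive (R : realType) (g : R -> R) : continuous g ->
  exists G : R -> R, forall u : R, 0 < u -> is_derive u 1 G (g u).
Proof.
move=> cg; pose mu := @lebesgue_measure R.
exists (fun x => \int[mu]_(t in [set` `[0, x]]) g t)%R => u u0.
have int : mu.-integrable `[0, u + 1] (EFin \o g).
  apply: continuous_compact_integrable; first exact: segment_compact.
  exact: continuous_subspaceT.
have uu1 : u < u + 1 by rewrite ltrDl.
have [D1 D2] := continuous_FTC1_closed uu1 int u0 (cg u).
by split; [exact: D1|rewrite -derive1E].
Qed.

Lemma derive_mean_value (R : realType) (K K' : R -> R) (u0 v w : R) :
  (forall u : R, u0 < u -> is_derive u 1 K (K' u)) -> u0 < v -> v <= w ->
  exists2 c, v <= c <= w & K w - K v = K' c * (w - v).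
Proof.
move=> dK uv vw.
have d1 x : x \in `]v, w[ -> is_derive x 1 K (K' x).
  by rewrite in_itv /= => /andP[vx _]; apply: dK; lra.
have c1 : {within `[v, w], continuous K}.
  apply: derivable_within_continuous => x; rewrite in_itv /= => /andP[vx _].
  have ux : u0 < x by lra.
  by have [] := dK _ ux.
have [c + cE] := MVT_segment vw d1 c1.
by rewrite in_itv; exists c.
Qed.

Lemma is_derive_translate (R : realType) (K : R -> R) (x u d : R) :
  is_derive (u - x) 1 K d -> is_derive u 1 (fun v => K (v - x)) d.
Proof.
move=> dK.
have : is_derive u 1 (K \o (fun v => v - x)) (d * 1).
  apply: is_derive1_comp.
  have -> : (fun v => v - x) = id + cst (- x) by apply/funext.
  by rewrite -[X in is_derive _ _ _ X](addr0); exact: is_deriveD.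
by rewrite mulr1.
Qed.

(** The difference of the squares is the scalar product of z - w and z + w;
    apply the inequality between the arithmetic and geometric means. *)
Lemma sqmod_dist (R : rcfType) (z w : R[i]) (eps : R) :
  0 < eps -> sqmod z <= 1 -> sqmod w <= 1 -> sqmod (z - w) < eps ^+ 2 / 4 ->
  `|sqmod z - sqmod w| < eps.
Proof.
move=> e0; case: z w => [a b] [c d]; rewrite /sqmod /= => z1 w1 h.
have p1 := sqr_ge0 (a + c - (a - c) * (4 / eps)).
have p2 := sqr_ge0 (b + d - (b - d) * (4 / eps)).
have p3 := sqr_ge0 (a + c + (a - c) * (4 / eps)).
have p4 := sqr_ge0 (b + d + (b - d) * (4 / eps)).
have q1 := sqr_ge0 (a - c); have q2 := sqr_ge0 (b - d).
pose k := 4 / eps; have ke : k * eps = 4 by rewrite divfK// gt_eqF.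
have k0 : 0 < k by rewrite divr_gt0.
rewrite -/k in p1 p2 p3 p4.
set s := (a - c) ^+ 2 + (b - d) ^+ 2 in h.
have ks : k ^+ 2 * s < 4.
  have : k ^+ 2 * s < k ^+ 2 * (eps ^+ 2 / 4) by rewrite ltr_pM2l// exprn_gt0.
  by rewrite mulrA -exprMn ke; lra.
have sum4 : (a + c) ^+ 2 + (b + d) ^+ 2 <= 4.
  by move: z1 w1 q1 q2; rewrite !expr2; lra.
pose x := a ^+ 2 + b ^+ 2 - (c ^+ 2 + d ^+ 2).
have xE : x = (a + c) * (a - c) + (b + d) * (b - d) by rewrite /x; ring.
have e1 : (a + c - (a - c) * k) ^+ 2 + (b + d - (b - d) * k) ^+ 2 =
  ((a + c) ^+ 2 + (b + d) ^+ 2) + k ^+ 2 * s - 2 * k * x by rewrite xE /s; ring.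
have e2 : (a + c + (a - c) * k) ^+ 2 + (b + d + (b - d) * k) ^+ 2 =
  ((a + c) ^+ 2 + (b + d) ^+ 2) + k ^+ 2 * s + 2 * k * x by rewrite xE /s; ring.
have kx1 : k * x < k * eps by rewrite ke; lra.
have kx2 : k * (- x) < k * eps by rewrite ke; lra.
rewrite !(ltr_pM2l k0) in kx1 kx2.
by rewrite -/x ltr_norml kx1 andbT; lra.
Qed.

Section LogScale.
Context (R : realType) (F : R -> R[i]).
Hypothesis F1 : forall t, sqmod (F t) <= 1.
Hypothesis Fc : sq_uniform_continuous F.

Lemma sqmod_uniform_continuous (eps : R) : 0 < eps ->
  exists2 w, 0 < w & forall t s, `|t - s| < w ->
    `|sqmod (F t) - sqmod (F s)| < eps.
Proof.
move=> e0; have e2 : 0 < eps ^+ 2 / 4 by rewrite divr_gt0// exprn_gt0.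
have [w w0 hw] := Fc e2; exists w => // t s /hw; exact: sqmod_dist.
Qed.

Lemma log_uniform_continuous (B eps : R) : 0 < eps ->
  exists2 w, 0 < w & forall u v, u <= B -> v <= B -> `|u - v| < w ->
    `|sqmod (F (expR u)) - sqmod (F (expR v))| < eps.
Proof.
move=> e0; have [w w0 hw] := sqmod_uniform_continuous e0.
exists (w / expR B); first by rewrite divr_gt0// expR_gt0.
move=> u v; wlog uv : u v / v <= u => [th uB vB uv|uB vB].
  have [vu|/ltW vu] := leP v u; first exact: th.
  by rewrite distrC; apply: th => //; rewrite distrC.
rewrite ger0_norm ?subr_ge0// ltr_pdivlMr ?expR_gt0// => h; apply: hw.
rewrite ger0_norm ?subr_ge0 ?ler_expR//; apply: le_lt_trans h.
have := expR_ge1Dx (v - u) => h1.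
have := expR_gt0 u => h2.
have h3 : expR u <= expR B by rewrite ler_expR.
have -> : expR v = expR u * expR (v - u) by rewrite -expRD addrC subrK.
by nra.
Qed.

Lemma continuous_log_sqmod : continuous (fun u => sqmod (F (expR u))).
Proof.
move=> u; apply/cvgrPdist_lt => eps e0.
have [w w0 hw] := log_uniform_continuous (u + 1) e0.
have m0 : 0 < Num.min w 1 by rewrite lt_min w0 ltr01.
exists (Num.min w 1) => // v vu.
have /andP[uv uv1] : (`|u - v| < w) && (`|u - v| < 1) by rewrite -lt_min.
apply: hw => //; first by rewrite lerDl.
by move: uv1; rewrite ltr_norml => /andP[]; lra.
Qed.

End LogScale.

(** A bounded function whose derivative dominates [f] on a half-line. For
    nonnegative [f] this bounds the integrals of [f] over all intervals of the
    half-line, without any integrability condition. *)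
Definition finite_integral (R : realType) (f : R -> R) :=
  exists K K' : R -> R, exists C u0 : R, forall u : R, u0 < u ->
    [/\ is_derive u 1 K (K' u), f u <= K' u & `|K u| <= C].

Lemma finite_integral_class (R : realType) :
  finiteness_class (@finite_integral R) (fun=> True).
Proof.
split=> //.
- move=> f h fh [K [K' [C [u0 hK]]]]; exists K, K', C, u0 => u /hK[? h1 ?].
  by split=> //; apply: le_trans h1; have /andP[] := fh u.
- move=> f h [K [K' [C [u0 hK]]]] [L [L' [D [v0 hL]]]].
  exists (fun u => K u + L u), (fun u => K' u + L' u), (C + D), (Num.max u0 v0) => u.
  rewrite gt_max => /andP[/hK[K1 K2 K3] /hL[L1 L2 L3]]; split.
  + exact: is_deriveD.
  + exact: lerD.
  + by apply: (le_trans (ler_normD _ _)); exact: lerD.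
- move=> c f c0 [K [K' [C [u0 hK]]]].
  exists (fun u => c * K u), (fun u => c * K' u), (c * C), u0 => u.
  move=> /hK[K1 K2 K3]; split.
  + exact: is_deriveZ.
  + exact: ler_wpM2l.
  + by rewrite normrM ger0_norm// ler_wpM2l.
- move=> x f _ [K [K' [C [u0 hK]]]].
  exists (fun u => K (u - x)), (fun u => K' (u - x)), C, (u0 + x) => u ux.
  have /hK[K1 K2 K3] : u0 < u - x by lra.
  by split=> //; exact: is_derive_translate.
Qed.

Lemma primitive_lipschitz (R : realType) (G g : R -> R) (v w : R) :
  (forall u, 0 <= g u <= 1) -> (forall u : R, 0 < u -> is_derive u 1 G (g u)) ->
  0 < v -> 0 < w -> `|G v - G w| <= `|v - w|.
Proof.
move=> g01 dG; wlog vw : v w / w <= v => [th v0 w0|v0 w0].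
  have [h|/ltW h] := leP w v; first exact: th.
  by rewrite distrC [leRHS]distrC; exact: th.
have [c _ ->] := derive_mean_value dG w0 vw.
have /andP[g0 g1] := g01 c; rewrite normrM (ger0_norm g0).
by rewrite ler_piMl.
Qed.

(** If G is a primitive of g, the energy is the derivative of the sum of the
    p_j G(u - a_j) minus G(u), and this is bounded because G is 1-Lipschitz. *)
Lemma finite_integral_energy (R : realType) n (p a : 'I_n -> R) (F : R -> R[i]) :
  (forall j, 0 <= p j) -> \sum_j p j = 1 ->
  (forall t, sqmod (F t) <= 1) -> sq_uniform_continuous F ->
  finite_integral (energy p a F).
Proof.
move=> p0 p1 F1 Fc; pose g u := sqmod (F (expR u)).
have g01 u : 0 <= g u <= 1 by rewrite sqmod_ge0 F1.
have [G dG] := exists_primitive (continuous_log_sqmod F1 Fc).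
pose S := \sum_j `|a j|.
have aS j : `|a j| <= S by rewrite /S (bigD1 j)//= lerDl sumr_ge0.
exists (fun u => \sum_j p j * G (u - a j) - G u), (energy p a F), S, S => u uS.
have S0 : 0 <= S by exact: sumr_ge0.
have u0 : 0 < u by exact: le_lt_trans uS.
have ua j : 0 < u - a j by have := aS j; have := ler_norm (a j); lra.
split=> //.
- apply: is_deriveB; last exact: dG.
  rewrite (_ : (fun u => _) = \sum_j (fun u => p j * G (u - a j))); last first.
    by apply/funext => v; rewrite fct_sumE.
  apply: is_derive_sum => j; apply: is_deriveZ.
  by apply: is_derive_translate; exact: dG.
- have -> : \sum_j p j * G (u - a j) - G u = \sum_j p j * (G (u - a j) - G u).
    by under [RHS]eq_bigr do rewrite mulrBr; rewrite sumrB -mulr_suml p1 mul1r.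
  apply: (le_trans (ler_norm_sum _ _ _)).
  rewrite -[leRHS]mul1r -p1 mulr_suml; apply: ler_sum => j _.
  rewrite normrM ger0_norm// ler_wpM2l//.
  apply: le_trans (primitive_lipschitz g01 dG (ua j) u0) _.
  by rewrite addrC addKr normrN.
Qed.

(** * Decay when the scales generate a dense group *)

Lemma bounded_monotone_tail (R : realType) (K K' : R -> R) (C u0 : R) :
  (forall u : R, u0 < u -> [/\ is_derive u 1 K (K' u), 0 <= K' u & `|K u| <= C]) ->
  forall eps, 0 < eps -> exists2 A, u0 < A &
    forall v w, A <= v -> v <= w -> K w - K v <= eps.
Proof.
move=> hK eps e0; pose S := [set K u | u in [set u | u0 < u]].
have mono v w : u0 < v -> v <= w -> K v <= K w.
  move=> uv vw.
  have dK (u : R) : u0 < u -> is_derive u 1 K (K' u) by move=> /hK[].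
  have [c /andP[vc _] cE] := derive_mean_value dK uv vw.
  have [_ c0 _] := hK c (lt_le_trans uv vc).
  by rewrite -subr_ge0 cE mulr_ge0// subr_ge0.
have supS : has_sup S.
  split; first by exists (K (u0 + 1)), (u0 + 1) => //=; rewrite ltrDl.
  by exists C => _ [u /hK[_ _ h] <-]; apply: le_trans h; exact: ler_norm.
have [_ [A uA <-] hA] := sup_adherent e0 supS.
exists A => // v w Av vw.
have : K w <= sup S.
  apply: ub_le_sup; first exact: supS.2.
  by exists w => //=; apply: lt_le_trans uA _; exact: le_trans vw.
have := mono A v uA Av; lra.
Qed.

Lemma sqmod_e2pi_sub1 (R : realType) (x : R) :
  sqmod (e2pi x - 1) = 2 - 2 * cos (2 * pi * x).
Proof.
rewrite /sqmod /e2pi /= subr0.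
by have := cos2Dsin2 (2 * pi * x); rewrite !expr2; lra.
Qed.

Lemma e2pi_gap_mono (R : realType) (x y : R) : 0 <= x -> x < y -> y <= 1 / 4 ->
  sqmod (e2pi x - 1) < sqmod (e2pi y - 1).
Proof.
move=> x0 xy y4; rewrite !sqmod_e2pi_sub1.
have pi0 := @pi_gt0 R.
have mem z : 0 <= z -> z <= 1 / 4 -> 2 * pi * z \in `[0 : R, pi].
  by move=> z0 z4; rewrite in_itv /=; apply/andP; split; nra.
have : cos (2 * pi * y) < cos (2 * pi * x).
  rewrite ltr_cos; [|by apply: mem; lra|by apply: mem; lra].
  by rewrite ltr_pM2l// mulr_gt0.
by lra.
Qed.

Lemma e2pi_gap_gt0 (R : realType) (D : R) : 0 < D -> D <= 1 / 4 ->
  0 < sqmod (e2pi D - 1).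
Proof.
move=> D0 D4; have := e2pi_gap_mono (lexx 0) D0 D4.
by apply: le_lt_trans; exact: sqmod_ge0.
Qed.

(** The modulus of e(x) - e(y) is that of e(x - y) - 1, and it is at most the
    sum of the distances of e(x) and e(y) to 1. *)
Lemma e2pi_gap (R : realType) (D x y : R) : 0 < D -> D <= `|x - y| ->
  `|x - y| <= 1 / 4 ->
  sqmod (e2pi D - 1) / 2 <= sqmod (e2pi x - 1) + sqmod (e2pi y - 1).
Proof.
move=> D0 Dz z4; rewrite ler_pdivrMr// mulrC.
apply: (@le_trans _ _ (sqmod (e2pi `|x - y| - 1))).
  move: Dz; rewrite le_eqVlt => /predU1P[->//|Dz].
  by apply/ltW/e2pi_gap_mono => //; exact: ltW.
have -> : sqmod (e2pi `|x - y| - 1) = sqmod (e2pi x - e2pi y).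
  transitivity (sqmod (e2pi (x - y) - 1)).
    rewrite !sqmod_e2pi_sub1 -[in RHS]cos_norm normrM (@ger0_norm _ (2 * pi))//.
    by rewrite mulr_ge0// pi_ge0.
  by rewrite -[LHS]mul1r -(sqmod_e2pi y) -sqmodM mulrBr -e2piD mulr1 [y + _]addrC subrK.
have -> : e2pi x - e2pi y = (e2pi x - 1) - (e2pi y - 1) by rewrite opprB addrA subrK.
exact: sqmodB_le.
Qed.

(** The mass of |e(t d) - 1|^2 |F(t)|^2 is finite, so far away it is negligible
    on intervals of length 1. There is c > 0 such that, if |e(t d) - 1|^2 is
    below c at t, then it is at least c at t' = t exp(s), for a shift s such
    that t' - t lies between w and 4 w: this distance is small enough for
    |F(t)|^2 to change little, yet large enough for t d and t' d not to be both
    nearly integers. Hence |F(t)|^2 is bounded by the negligible quantity at t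
    or at t', up to a small error. *)
Lemma mean_decay (R : realType) (F : R -> R[i]) (d : R) (G : R -> R) :
  (forall t, sqmod (F t) <= 1) -> sq_uniform_continuous F -> d != 0 ->
  finite_integral (fun u => sqmod (e2pi (expR u * d) - 1) * sqmod (F (expR u))) ->
  (forall u : R, 0 < u -> is_derive u 1 G (sqmod (F (expR u)))) ->
  forall eps, 0 < eps -> exists2 A, 0 < A &
    forall v, A <= v -> G (v + 1) - G v <= eps.
Proof.
move=> F1 Fc d0 [K [K' [C [u0 hK]]]] dG eps e0.
pose phi u := sqmod (e2pi (expR u * d) - 1) * sqmod (F (expR u)).
have {}hK : forall u : R, u0 < u ->
  [/\ is_derive u 1 K (K' u), phi u <= K' u & `|K u| <= C] := hK.
pose g u := sqmod (F (expR u)).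
have nd0 : 0 < `|d| by rewrite normr_gt0.
have e2 : 0 < eps / 2 by rewrite divr_gt0.
have [om om0 hom] := sqmod_uniform_continuous F1 Fc e2.
(* The shift of t lies between w and 4 w: less than om, and moving t d by at
   most 1 / 4. *)
pose w := Num.min (om / 5) (1 / (16 * `|d|)).
have w0 : 0 < w by rewrite lt_min !divr_gt0// mulr_gt0.
have wom : 4 * w < om.
  have : w <= om / 5 by rewrite ge_min lexx.
  by lra.
have wd : 4 * w * `|d| <= 1 / 4.
  have : w <= 1 / (16 * `|d|) by rewrite ge_min lexx orbT.
  by rewrite ler_pdivlMr ?mulr_gt0//; lra.
pose D := w * `|d|.
have D0 : 0 < D by rewrite mulr_gt0.
have D4 : D <= 1 / 4 by rewrite /D; lra.
pose c := sqmod (e2pi D - 1) / 4.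
have c0 : 0 < c by rewrite divr_gt0// e2pi_gap_gt0.
have phi0 u : 0 <= phi u by rewrite mulr_ge0 ?sqmod_ge0.
have hK' (u : R) : u0 < u -> [/\ is_derive u 1 K (K' u), 0 <= K' u & `|K u| <= C].
  by move=> /hK[? h ?]; split=> //; exact: le_trans h.
have ce : 0 < c * eps / 4 by rewrite divr_gt0// mulr_gt0.
have [A1 uA1 hA1] := bounded_monotone_tail hK' ce.
exists (Num.max A1 1); first by rewrite lt_max ltr01 orbT.
move=> v; rewrite ge_max => /andP[A1v v1].
pose s := ln (1 + w * expR (- v)).
have s0 : 0 < s by rewrite ln_gt0// ltrDl mulr_gt0// expR_gt0.
have es : expR s = 1 + w * expR (- v).
  by rewrite lnK// posrE ltr_wpDl// mulr_gt0// expR_gt0.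
have gle u : v <= u <= v + 1 -> g u <= (K' u + K' (u + s)) / c + eps / 2.
  move=> /andP[vu uv].
  have u0u : u0 < u by lra.
  have u0s : u0 < u + s by lra.
  have [_ Ku _] := hK _ u0u; have [_ Ks _] := hK _ u0s.
  have shift : expR (u + s) - expR u = w * expR (u - v).
    by rewrite expRD es expRB expRN; field; rewrite expR_eq0.
  have uv1 : 1 <= expR (u - v) <= 4.
    have h1 := expR_ge1Dx (u - v).
    apply/andP; split; first by lra.
    have : expR (u - v) <= expR 1 by rewrite ler_expR; lra.
    have e1 : expR (- (1 / 2)) * expR (- (1 / 2)) * expR 1 = 1 :> R.
      by rewrite -!expRD (_ : _ + _ = 0) ?expR0//; lra.
    have y2 : 1 / 2 <= expR (- (1 / 2)) :> R.
      by have := expR_ge1Dx (- (1 / 2) : R); lra.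
    have : (1 / 2) * (1 / 2) * expR 1 <= 1 :> R.
      by rewrite -[leRHS]e1 ler_pM2r ?expR_gt0// ler_pM// divr_ge0.
    by lra.
  have sh : w <= expR (u + s) - expR u <= 4 * w by rewrite shift; nra.
  have near_int : sqmod (e2pi D - 1) / 2 <=
      sqmod (e2pi (expR (u + s) * d) - 1) + sqmod (e2pi (expR u * d) - 1).
    have ab : `|expR (u + s) * d - expR u * d| = (expR (u + s) - expR u) * `|d|.
      by rewrite -mulrBl normrM ger0_norm//; lra.
    by apply: e2pi_gap => //; rewrite ab /D; nra.
  have cE : sqmod (e2pi D - 1) / 2 = c + c by rewrite /c; lra.
  have [h|h] := leP c (sqmod (e2pi (expR u * d) - 1)).
    have : c * g u <= K' u by apply: le_trans Ku; rewrite ler_wpM2r// sqmod_ge0.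
    rewrite mulrC -ler_pdivlMr// mulrDl => h1; apply: (le_trans h1).
    rewrite -addrA lerDl; apply: addr_ge0; last exact: ltW.
    by apply: divr_ge0; [exact: le_trans (phi0 _) Ks|exact: ltW].
  have {}h : c <= sqmod (e2pi (expR (u + s) * d) - 1) by lra.
  have : c * g (u + s) <= K' (u + s).
    by apply: le_trans Ks; rewrite ler_wpM2r// sqmod_ge0.
  rewrite mulrC -ler_pdivlMr// => h1.
  have : `|g u - g (u + s)| < eps / 2.
    by apply: hom; rewrite distrC ger0_norm; lra.
  have h3 : 0 <= K' u / c by apply: divr_ge0; [exact: le_trans (phi0 _) Ku|exact: ltW].
  by rewrite mulrDl ltr_norml => /andP[]; lra.
(* Integrating the pointwise bound amounts to the monotonicity of H. *)
pose H u := (K u + K (u + s)) / c + eps / 2 * u - G u.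
pose H' u := (K' u + K' (u + s)) / c + eps / 2 - g u.
have dH u : Num.max u0 0 < u -> is_derive u 1 H (H' u).
  rewrite gt_max => /andP[u0u u00].
  have [dKu _ _] := hK _ u0u.
  have u0us : u0 < u + s by lra.
  have [dKs _ _] := hK _ u0us.
  have d1 : is_derive u 1 (fun u => K (u + s)) (K' (u + s)).
    have := @is_derive_translate R K (- s) u (K' (u + s)).
    by rewrite opprK; apply.
  rewrite /H /H'; apply: is_deriveB; last exact: dG.
  apply: is_deriveD.
    under eq_fun do rewrite mulrC.
    by rewrite mulrC; apply: is_deriveZ; exact: is_deriveD.
  rewrite -[X in is_derive _ _ _ X]mulr1; exact: is_deriveZ.
have vmax : Num.max u0 0 < v by rewrite gt_max; apply/andP; split; lra.
have vv1 : v <= v + 1 by rewrite lerDl.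
have [x xv HE] := derive_mean_value dH vmax vv1.
have : 0 <= H (v + 1) - H v.
  rewrite HE mulr_ge0//; last by lra.
  by have := gle x xv; rewrite /H'; lra.
have k1 := hA1 v (v + 1) A1v vv1.
have A1vs : A1 <= v + s by lra.
have k2 := hA1 (v + s) (v + 1 + s) A1vs.
rewrite lerD2r in k2; have {}k2 := k2 vv1.
have : (K (v + 1) + K (v + 1 + s)) / c - (K v + K (v + s)) / c <= eps / 2.
  rewrite -mulrBl ler_pdivrMr//; lra.
by rewrite /H; lra.
Qed.

(** When [M] is the upper limit of [g] at +oo: if g(u) is close to [M] for a
    large u, so is g(u - x). *)
Definition sup_propagates (R : realType) (g : R -> R) (M x : R) :=
  forall eta, 0 < eta -> exists2 eta', 0 < eta' & exists A, forall u,
    A <= u -> M - eta' <= g u -> M - eta <= g (u - x).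

Section SupPropagation.
Context (R : realType) n (p a : 'I_n -> R) (g : R -> R) (M : R).
Hypothesis p_gt0 : forall j, 0 < p j.
Hypothesis p_sum : \sum_j p j = 1.
Hypothesis gsub : forall u, g u <= \sum_j p j * g (u - a j).
Hypothesis gM : forall eta, 0 < eta -> exists A, forall u, A <= u -> g u <= M + eta.

Lemma sup_propagates0 : sup_propagates g M 0.
Proof. by move=> eta e0; exists eta => //; exists 0 => u _; rewrite subr0. Qed.

Lemma sup_propagatesD x y : sup_propagates g M x -> sup_propagates g M y ->
  sup_propagates g M (x + y).
Proof.
move=> hx hy eta /hy[e1 e10 [A hA]]; have [e2 e20 [B hB]] := hx _ e10.
exists e2 => //; exists (Num.max B (A + x)) => u.
rewrite ge_max => /andP[Bu Au] gu; rewrite opprD addrA.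
by apply: hA; [lra|exact: hB].
Qed.

(** The value g(u) is at most an average of the g(u - a i), none of which
    exceeds [M] by much; if g(u) is close to [M], so are all of them. *)
Lemma sup_propagates_step j : sup_propagates g M (a j).
Proof.
move=> eta e0; have pe : 0 < p j * eta / 2 by rewrite divr_gt0// mulr_gt0.
have [A hA] := gM pe.
pose S := \sum_i `|a i|.
have aS i : a i <= S.
  by apply: (le_trans (ler_norm _)); rewrite /S (bigD1 i)//= lerDl sumr_ge0.
exists (p j * eta / 2) => //; exists (A + S) => u Au gu.
have := gsub u; rewrite (bigD1 j)//= => h.
have rest : \sum_(i | i != j) p i * g (u - a i) <= (1 - p j) * (M + p j * eta / 2).
  have -> : 1 - p j = \sum_(i | i != j) p i.
    by have := p_sum; rewrite (bigD1 j)//=; lra.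
  rewrite mulr_suml; apply: ler_sum => i _; apply: ler_wpM2l; first exact: ltW.
  by apply: hA; have := aS i; lra.
rewrite -(ler_pM2l (p_gt0 j)).
have pj := p_gt0 j; have : 0 < p j * (p j * eta / 2) by exact: mulr_gt0.
by lra.
Qed.

Lemma sup_propagates_semigroup (m : 'I_n -> nat) :
  sup_propagates g M (\sum_j (m j)%:R * a j).
Proof.
elim/big_rec: _ => [|j x _ hx]; first exact: sup_propagates0.
apply: sup_propagatesD => //; elim: (m j) => [|k IH].
  by rewrite mul0r; exact: sup_propagates0.
by rewrite -natr1 mulrDl mul1r; apply: sup_propagatesD => //; exact: sup_propagates_step.
Qed.

Lemma sup_propagates_finite K (x : nat -> R) :
  (forall i, (i < K)%N -> sup_propagates g M (x i)) ->
  forall eta, 0 < eta -> exists2 eta', 0 < eta' & exists A, forall u, A <= u ->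
    M - eta' <= g u -> forall i, (i < K)%N -> M - eta <= g (u - x i).
Proof.
move=> hx eta e0; elim: K hx => [|K IH] hx; first by exists 1 => //; exists 0.
have [e1 e10 [A hA]] := IH (fun i iK => hx i (ltnW iK)).
have [e2 e20 [B hB]] := hx K (leqnn _) _ e0.
exists (Num.min e1 e2); first by rewrite lt_min e10.
exists (Num.max A B) => u; rewrite ge_max => /andP[Au Bu] gu i.
have m1 : Num.min e1 e2 <= e1 by rewrite ge_min lexx.
have m2 : Num.min e1 e2 <= e2 by rewrite ge_min lexx orbT.
rewrite ltnS leq_eqVlt => /predU1P[->|iK]; first by apply: hB => //; lra.
by apply: hA => //; lra.
Qed.

End SupPropagation.

Lemma exists_limsup (R : realType) (g : R -> R) (e0 : R) :
  (forall u, g u <= 1) -> (forall A, exists2 u, A <= u & e0 < g u) ->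
  exists M, [/\ e0 <= M,
    forall eta, 0 < eta -> exists A, forall u, A <= u -> g u <= M + eta &
    forall eta A, 0 < eta -> exists2 u, A <= u & M - eta < g u].
Proof.
move=> g1 ge0; pose S := [set c | forall A, exists2 u, A <= u & c < g u].
have supS : has_sup S.
  split; first by exists e0.
  by exists 1 => c /(_ 0)[u _ /ltW cu]; exact: le_trans cu (g1 u).
exists (sup S); split.
- by apply: ub_le_sup; [exact: supS.2|].
- move=> eta h; apply: contrapT => /forallNP hA.
  have : S (sup S + eta).
    move=> A; have /existsNP[u] := hA A; move=> /not_implyP[Au /negP].
    by rewrite -ltNge; exists u.
  by move/(ub_le_sup supS.2); lra.
- move=> eta A h; have [c Sc cM] := sup_adherent h supS.
  by have [u Au cu] := Sc A; exists u => //; lra.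
Qed.

Lemma riemann_sum_le (R : realType) (g G : R -> R) (w delta eps : R) K :
  (forall u, 0 <= g u) -> (forall u : R, 0 < u -> is_derive u 1 G (g u)) ->
  0 < delta -> K%:R * delta <= 1 -> 1 < w ->
  (forall u v, u <= w -> v <= w -> `|u - v| <= delta -> `|g u - g v| < eps) ->
  delta * \sum_(i < K) g (w - i%:R * delta) <= G w - G (w - 1) + K%:R * delta * eps.
Proof.
move=> g0 dG d0 Kd w1 gc.
suff : delta * \sum_(i < K) g (w - i%:R * delta) <=
    G w - G (w - K%:R * delta) + K%:R * delta * eps.
  move=> h; apply: (le_trans h); rewrite lerD2r lerD2l lerN2.
  have w10 : 0 < w - 1 by lra.
  have w1K : w - 1 <= w - K%:R * delta by lra.
  have [c _ cE] := derive_mean_value dG w10 w1K.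
  by rewrite -subr_ge0 cE mulr_ge0//; lra.
elim: K Kd => [|K IH] Kd; first by rewrite big_ord0 mulr0 !mul0r subr0 subrr addr0.
rewrite big_ord_recr /= mulrDr; rewrite -natr1 in Kd *.
have Kd' : K%:R * delta <= 1 by lra.
have h1 : 0 < w - (K%:R + 1) * delta by lra.
have h2 : w - (K%:R + 1) * delta <= w - K%:R * delta by lra.
have K0 : 0 <= K%:R * delta by rewrite mulr_ge0// ltW.
have [c /andP[c1 c2] cE] := derive_mean_value dG h1 h2.
have : `|g (w - K%:R * delta) - g c| < eps.
  by apply: gc; rewrite ?ger0_norm; lra.
rewrite ltr_norml => /andP[_ h].
have : delta * g (w - K%:R * delta) <= delta * (g c + eps) by rewrite ler_pM2l//; lra.
have := IH Kd'; lra.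
Qed.

(** Suppose that the upper limit M of g is positive. By density, some delta = s
    - s' is arbitrarily small with s and s' in the semigroup of the a_j, and
    the points x_i = K s' + i delta, i < K, all belong to this semigroup.
    Choose K so that they spread over about a unit length. The average of the
    translates g(u - x_i) is again subharmonic. On a suitable layer it is a
    Riemann sum of the integral of g over an interval of length 1, hence small,
    and the maximum principle makes it small above this layer. But
    [sup_propagates_finite] yields arbitrarily large u where all the g(u - x_i)
    are at least M / 2. *)
Lemma dense_subharmonic_decay (R : realType) n (p a : 'I_n -> R) (g G : R -> R) :
  (forall j, 0 < p j) -> \sum_j p j = 1 -> 0 < \sum_j p j * a j ->
  (forall u, 0 <= g u <= 1) -> (forall u, g u <= \sum_j p j * g (u - a j)) ->
  (forall B eps, 0 < eps -> exists2 w, 0 < w & forall u v, u <= B -> v <= B ->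
     `|u - v| < w -> `|g u - g v| < eps) ->
  (forall u : R, 0 < u -> is_derive u 1 G (g u)) ->
  (forall eps, 0 < eps -> exists2 A, 0 < A &
     forall v, A <= v -> G (v + 1) - G v <= eps) ->
  (forall eps, 0 < eps -> exists m k : 'I_n -> nat,
     0 < \sum_j (m j)%:R * a j - \sum_j (k j)%:R * a j < eps) ->
  forall eps, 0 < eps -> exists A, forall u, A <= u -> g u <= eps.
Proof.
move=> p0 p1 drift g01 gsub gc dG mean dense eps eps0.
apply: contrapT => /forallNP hA.
have g1 u : g u <= 1 by have /andP[] := g01 u.
have [A|M [eM Mub Mlim]] := exists_limsup (e0 := eps) g1.
  have /existsNP[u] := hA A; move=> /not_implyP[Au /negP].
  by rewrite -ltNge; exists u.
have M0 : 0 < M by exact: lt_le_trans eM.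
pose e := M / 8; have e0 : 0 < e by rewrite divr_gt0.
have [A1 A10 hA1] := mean _ e0.
pose step := \sum_j `|a j|.
have astep j : a j <= step.
  by apply: (le_trans (ler_norm _)); rewrite /step (bigD1 j)//= lerDl sumr_ge0.
have step0 : 0 <= step by apply: sumr_ge0.
have [w w0 hw] := gc (A1 + step + 2) _ e0.
have mw : 0 < Num.min w (1 / 2) by rewrite lt_min w0 divr_gt0.
have [m [k /andP[]]] := dense _ mw.
set s := \sum_j (m j)%:R * a j; set s' := \sum_j (k j)%:R * a j.
set delta := s - s' => d0; rewrite lt_min => /andP[dw d2].
have dV0 : 0 < delta^-1 by rewrite invr_gt0.
pose K := Num.truncn delta^-1.
have /andP[] := truncn_itv (ltW dV0); rewrite -/K => K1 K2.
have {}K1 : K%:R * delta <= 1 by rewrite -ler_pdivlMr// mul1r.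
have {}K2 : 1 / 2 < K%:R * delta.
  have : 1 < K.+1%:R * delta by rewrite -ltr_pdivrMr// mul1r.
  by rewrite -natr1; lra.
have K0 : 0 < K%:R :> R.
  rewrite ltNge; apply/negP => K0.
  have : K%:R * delta <= 0 by rewrite mulr_le0_ge0// ltW.
  by lra.
pose X := K%:R * s'.
pose x i : R := X + i%:R * delta.
have hx i : (i < K)%N -> sup_propagates g M (x i).
  move=> iK; have -> : x i = \sum_j ((i * m j + (K - i) * k j)%N)%:R * a j.
    transitivity (i%:R * s + (K - i)%:R * s').
      by rewrite /x /X /delta natrB ?(ltnW iK)//; ring.
    rewrite !mulr_sumr -big_split; apply: eq_bigr => j _ /=.
    by rewrite natrD !natrM; ring.
  exact: (sup_propagates_semigroup p0 p1 gsub Mub).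
pose gt v := K%:R^-1 * \sum_(i < K) g (v - x i).
have gt_small v : A1 + X + 1 < v -> v <= A1 + X + 2 + step -> gt v <= 3 * e.
  move=> v1 v2; pose y := v - X.
  have sumE : \sum_(i < K) g (v - x i) = \sum_(i < K) g (y - i%:R * delta).
    by apply: eq_bigr => i _; rewrite /x /y opprD addrA.
  have y1 : 1 < y by rewrite /y; lra.
  have g0 u : 0 <= g u by have /andP[] := g01 u.
  have := @riemann_sum_le R g G y delta e K g0 dG d0 K1 y1.
  have hloc u u' : u <= y -> u' <= y -> `|u - u'| <= delta -> `|g u - g u'| < e.
    move=> uy uy' uu; apply: hw; rewrite ?(le_lt_trans uu)//; rewrite /y in uy uy'; lra.
  move=> /(_ hloc); rewrite -sumE /gt => h.
  have A1y : A1 <= y - 1 by rewrite /y; lra.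
  have := hA1 _ A1y; rewrite subrK => h2.
  rewrite mulrC ler_pdivrMr// -(ler_pM2l d0).
  by apply: (le_trans h); nra.
have gt_sub v : gt v <= \sum_j p j * gt (v - a j).
  have -> : \sum_j p j * gt (v - a j) =
      K%:R^-1 * \sum_(i < K) \sum_j p j * g (v - x i - a j).
    rewrite exchange_big mulr_sumr; apply: eq_bigr => j _ /=.
    rewrite /gt mulrCA -mulr_sumr; congr (_ * (_ * _)); apply: eq_bigr => i _.
    by rewrite addrAC.
  by rewrite ler_pM2l ?invr_gt0//; apply: ler_sum => i _; exact: gsub.
have gt1 v : gt v <= 1.
  rewrite /gt mulrC ler_pdivrMr// mul1r.
  have : \sum_(i < K) g (v - x i) <= \sum_(i < K) 1 by apply: ler_sum => i _.
  by rewrite sumr_const card_ord.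
have gt_all v : A1 + X + 2 + step <= v -> gt v <= 3 * e.
  move=> hv; apply: (@maximum_principle R _ p a (fun=> True) gt
    (A1 + X + 1 + step + 1 / 2) step (3 * e) 1) => //.
  - by move=> j; exact: ltW.
  - by move=> u _ h1 h2; apply: gt_small; lra.
  - by lra.
have M2 : 0 < M / 2 by rewrite divr_gt0.
have [eta eta0 [B hB]] := sup_propagates_finite hx M2.
have [u uB ueta] := Mlim eta (Num.max B (A1 + X + 2 + step)) eta0.
move: uB; rewrite ge_max => /andP[uB uA].
have := gt_all u uA.
suff : M / 2 <= gt u by rewrite /e; lra.
rewrite /gt [leRHS]mulrC ler_pdivlMr//.
have : \sum_(i < K) M / 2 <= \sum_(i < K) g (u - x i).
  apply: ler_sum => i _; have := hB u uB (ltW ueta) i (ltn_ord i); lra.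
by rewrite sumr_const card_ord -[X in X <= _ -> _]mulr_natr.
Qed.

Lemma generated_group_dense_or_cyclic (R : realType) n (a : 'I_n -> R) j0 :
  a j0 != 0 ->
  (forall eps, 0 < eps -> exists k : 'I_n -> int, 0 < \sum_j (k j)%:~R * a j < eps) \/
  exists tau, [/\ 0 < tau, exists m : 'I_n -> int, tau = \sum_j (m j)%:~R * a j &
    forall j, exists k : int, a j = k%:~R * tau].
Proof.
move=> aj0; pose H x := exists k : 'I_n -> int, x = \sum_j (k j)%:~R * a j.
have HB x y : H x -> H y -> H (x - y).
  move=> [k ->] [l ->]; exists (fun j => k j - l j).
  by rewrite -sumrB; apply: eq_bigr => j _; rewrite rmorphB mulrBl.
have HZ (z : int) x : H x -> H (z%:~R * x).
  move=> [k ->]; exists (fun j => z * k j).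
  by rewrite mulr_sumr; apply: eq_bigr => j _; rewrite rmorphM mulrA.
have Ha j : H (a j).
  exists (fun i => (i == j)%:Z); rewrite (bigD1 j)//= eqxx mul1r big1 ?addr0//.
  by move=> i /negPf ->; rewrite mul0r.
have [dense|] := pselect (forall eps, 0 < eps -> exists2 x, H x & 0 < x < eps).
  by left => eps /dense[_ [k ->] h]; exists k.
move=> /existsNP[d0] /not_implyP[d00 nd]; right.
have gap x : H x -> 0 < x -> d0 <= x.
  move=> Hx x0; rewrite leNgt; apply/negP => xd.
  by apply: nd; exists x => //; rewrite x0.
pose S := [set x | H x /\ 0 < x].
have infS : has_inf S.
  split; last by exists 0 => x [_ /ltW].
  exists `|a j0|; split; last by rewrite normr_gt0.
  have [_|_] := ger0P (a j0); first exact: Ha.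
  by rewrite -mulN1r; exact: (HZ (-1)).
(* Two positive elements are equal or at distance at least d0, so the infimum
   is attained. *)
have [tau [Htau tau0] tauE] := inf_adherent d00 infS.
have lbS x : H x -> 0 < x -> tau <= x.
  move=> Hx x0; rewrite leNgt; apply/negP => xt.
  have : d0 <= tau - x by apply: gap; [exact: HB|rewrite subr_gt0].
  have : inf S <= x by apply: ge_inf; [exact: infS.2|].
  by lra.
exists tau; split=> // j; pose q := Num.floor (a j / tau); exists q.
have /andP[q1 q2] := real_floor_itv (num_real (a j / tau)).
rewrite -/q in q1 q2; rewrite ler_pdivlMr// in q1; rewrite ltr_pdivrMr// in q2.
apply/eqP; rewrite -subr_eq0; apply/negPn/negP => ne.
have := lbS (a j - q%:~R * tau) (HB _ _ (Ha j) (HZ _ _ Htau)).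
rewrite lt_def ne subr_ge0 q1 => /(_ isT).
by move: q2; rewrite intrD; lra.
Qed.

Lemma nat_semigroup_difference (R : realType) n (a : 'I_n -> R) (k : 'I_n -> int) :
  exists m l : 'I_n -> nat, \sum_j (k j)%:~R * a j =
    \sum_j (m j)%:R * a j - \sum_j (l j)%:R * a j.
Proof.
exists (fun j => if 0 <= k j then `|k j|%N else 0%N).
exists (fun j => if 0 <= k j then 0%N else `|k j|%N).
rewrite -sumrB; apply: eq_bigr => j _; rewrite -mulrBl; congr (_ * _).
case: (k j) => m /=; first by rewrite subr0.
by rewrite sub0r NegzE rmorphN.
Qed.

Lemma coprime_of_bezout n (k m : 'I_n -> int) :
  \sum_j m j * k j = 1 -> \big[gcdn/0%N]_j `|k j|%N = 1%N.
Proof.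
move=> mk; set d := \big[gcdn/0%N]_j _.
have dk j : (d%:Z %| k j)%Z.
  by rewrite dvdzE /= /d (bigD1 j)//= dvdn_gcdl.
have : (d%:Z %| \sum_j m j * k j)%Z.
  by apply: rpred_sum => j _; exact: dvdz_mull.
by rewrite mk dvdzE /= dvdn1 => /eqP.
Qed.

(** A map that is not a translation has a single fixed point; a map that
    commutes with it fixes this point. *)
Lemma exists_noncommuting (R : realType) n (a b : 'I_n -> R) j0 : a j0 != 0 ->
  ~ (exists x, forall k, affine (expR (- a k)) (b k) x = x) ->
  exists k, b j0 + expR (- a j0) * b k - (b k + expR (- a k) * b j0) != 0.
Proof.
move=> aj0 no_fix; set r := expR (- a j0).
have r1 : 1 - r != 0.
  by rewrite subr_eq0 eq_sym -(expR0 R) (inj_eq (@expR_inj R)) oppr_eq0.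
apply: contrapT => /forallNP comm; apply: no_fix; exists (b j0 / (1 - r)) => k.
have /negP/negPn/eqP ck := comm k; rewrite /affine.
have bk : (1 - r) * b k = (1 - expR (- a k)) * b j0 by lra.
have -> : b k = (1 - expR (- a k)) * b j0 / (1 - r) by rewrite -bk mulrAC divff// mul1r.
by field.
Qed.

(** The commutator of two maps that do not commute is a nonzero translation. *)
Theorem dense_scales_decay (R : realType) n (p a b : 'I_n -> R) (F : R -> R[i]) :
  (forall j, 0 < p j) -> \sum_j p j = 1 -> 0 < \sum_j p j * a j ->
  (forall t, sqmod (F t) <= 1) -> sq_uniform_continuous F ->
  log_equation p a b F ->
  ~ (exists x, forall k, affine (expR (- a k)) (b k) x = x) ->
  (forall eps, 0 < eps -> exists k : 'I_n -> int, 0 < \sum_j (k j)%:~R * a j < eps) ->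
  forall eps, 0 < eps -> exists A, forall u, A <= u -> sqmod (F (expR u)) <= eps.
Proof.
move=> p0 p1 drift F1 Fc FE no_fix dense.
have p0' j : 0 <= p j by exact: ltW.
have [j0 aj0] : exists j, a j != 0.
  apply: contrapT => /forallNP a0; move: drift; rewrite big1 ?ltxx// => j _.
  by have /negP/negPn/eqP -> := a0 j; rewrite mulr0.
have cls := finite_integral_class R.
have fe := finite_integral_energy a p0' p1 F1 Fc.
have gen j := approx_symmetry_generator cls p0 p1 FE fe (fun=> I) j.
have [k dk] := exists_noncommuting aj0 no_fix.
have fd := approx_translation (approx_symmetry_commutator cls (gen j0) (gen k)).
have [G dG] := exists_primitive (continuous_log_sqmod F1 Fc).
have mean := mean_decay F1 Fc dk fd dG.
apply: (@dense_subharmonic_decay R n p a _ G) => //.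
- by move=> u; rewrite sqmod_ge0 F1.
- move=> u; rewrite {1}FE; apply: le_trans (sqmod_convex _ p0' p1) _.
  by apply: ler_sum => j _; rewrite sqmodM sqmod_e2pi mul1r.
- exact: log_uniform_continuous.
- move=> eps /dense[l]; have [m [m' ->]] := nat_semigroup_difference a l.
  by exists m, m'.
Qed.

(** * Resonance when the scales generate a cyclic group *)

Definition on_lattice (R : realType) (tau x : R) := exists k : int, x = k%:~R * tau.

Definition finite_lattice_sum (R : realType) (beta tau : R) (f : R -> R) :=
  exists C : R, forall (k : int) n,
    \sum_(i < n) f (beta + (k + i%:Z)%:~R * tau) <= C.

Lemma finite_lattice_sum_class (R : realType) (beta tau : R) :
  finiteness_class (finite_lattice_sum beta tau) (on_lattice tau).
Proof.
split.
- move=> f h fh [C hC]; exists C => k n; apply: le_trans (hC k n).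
  by apply: ler_sum => i _; have /andP[] := fh (beta + (k + i%:Z)%:~R * tau).
- move=> f h [C hC] [D hD]; exists (C + D) => k n.
  by rewrite big_split; exact: lerD.
- move=> c f c0 [C hC]; exists (c * C) => k n.
  by rewrite -mulr_sumr ler_wpM2l.
- move=> x f [l ->] [C hC]; exists C => k n; apply: le_trans (hC (k - l) n).
  rewrite le_eqVlt; apply/orP; left; apply/eqP; apply: eq_bigr => i _; congr f.
  by rewrite !rmorphD rmorphN /=; ring.
- by move=> x y [k ->] [l ->]; exists (k + l); rewrite rmorphD mulrDl.
- by move=> x [k ->]; exists (- k); rewrite rmorphN mulNr.
Qed.

(** For a shift by one the sum telescopes; larger shifts are iterated, and
    negative ones are read backwards. *)
Lemma telescope_shift (R : realType) (f : int -> R) (m k : int) n :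
  (forall i, 0 <= f i <= 1) ->
  `|\sum_(i < n) (f (k + i%:Z + m) - f (k + i%:Z))| <= (`|m|%N)%:R.
Proof.
move=> f01.
have nat_shift (l : nat) k' :
    `|\sum_(i < n) (f (k' + i%:Z + l%:Z) - f (k' + i%:Z))| <= l%:R.
  elim: l => [|l IH].
    by rewrite big1 ?normr0// => i _; rewrite addr0 subrr.
  have -> : \sum_(i < n) (f (k' + i%:Z + l.+1%:Z) - f (k' + i%:Z)) =
      (f (k' + l%:Z + n%:Z) - f (k' + l%:Z)) +
      \sum_(i < n) (f (k' + i%:Z + l%:Z) - f (k' + i%:Z)).
    transitivity (\sum_(i < n) ((f (k' + l%:Z + i.+1%:Z) - f (k' + l%:Z + i%:Z)) +
        (f (k' + i%:Z + l%:Z) - f (k' + i%:Z)))).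
      apply: eq_bigr => i _.
      have -> : k' + l%:Z + i.+1%:Z = k' + i%:Z + l.+1%:Z by lia.
      have -> : k' + l%:Z + i%:Z = k' + i%:Z + l%:Z by lia.
      by rewrite addrA subrK.
    rewrite big_split /=; congr (_ + _).
    elim: n {IH} => [|n' IH]; first by rewrite big_ord0 addr0 subrr.
    by rewrite big_ord_recr /= IH; ring.
  rewrite -natr1 addrC; apply: (le_trans (ler_normD _ _)); apply: lerD => //.
  have := f01 (k' + l%:Z + n%:Z); have := f01 (k' + l%:Z).
  by rewrite ler_norml => /andP[? ?] /andP[? ?]; apply/andP; split; lra.
case: m => l; first exact: nat_shift.
rewrite NegzE abszN /= -normrN -sumrN.
have := nat_shift l.+1 (k - l.+1%:Z).
congr (`| _ | <= _); apply: eq_bigr => i _; rewrite opprB.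
by congr (f _ - f _); lia.
Qed.

Lemma finite_lattice_sum_energy (R : realType) n (p a : 'I_n -> R) (F : R -> R[i])
    (beta tau : R) :
  (forall j, 0 <= p j) -> \sum_j p j = 1 -> (forall t, sqmod (F t) <= 1) ->
  (forall j, on_lattice tau (a j)) -> finite_lattice_sum beta tau (energy p a F).
Proof.
move=> p0 p1 F1 /choice[m am].
exists (\sum_j p j * (`|m j|%N)%:R) => k l.
pose f (i : int) := sqmod (F (expR (beta + i%:~R * tau))).
have -> : \sum_(i < l) energy p a F (beta + (k + i%:Z)%:~R * tau) =
    \sum_j p j * \sum_(i < l) (f (k + i%:Z + - m j) - f (k + i%:Z)).
  under [RHS]eq_bigr do rewrite mulr_sumr.
  rewrite exchange_big; apply: eq_bigr => i _ /=.
  under [RHS]eq_bigr do rewrite mulrBr.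
  rewrite sumrB -mulr_suml p1 mul1r /energy; congr (_ - _).
  apply: eq_bigr => j _; congr (_ * sqmod (F (expR _))).
  by rewrite am [in RHS]rmorphD rmorphN /=; ring.
apply: ler_sum => j _; apply: ler_wpM2l => //.
apply: (le_trans (ler_norm _)); rewrite -(abszN (m j)).
by apply: telescope_shift => i; rewrite sqmod_ge0 F1.
Qed.

Lemma bounded_sequence_cluster (R : realType) (x : nat -> R) (A B : R) :
  (forall n, A <= x n <= B) -> exists y, forall rho N, 0 < rho ->
    exists2 n, (N <= n)%N & `|x n - y| < rho.
Proof.
move=> xAB.
have [|y [_ cl]] := @segment_compact R A B (x @ \oo) _.
  by exists 0%N => // n _ /=; rewrite in_itv /= xAB.
exists y => rho N rho0.
have [|_ [[n Nn <-] yn]] := cl [set x n | n in [set n | (N <= n)%N]]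
  (ball y rho) _ (nbhsx_ballx y rho rho0).
  by exists N => // n /= Nn; exists n.
by exists n => //; rewrite distrC.
Qed.

(** Let u_k tend to +oo with g(u_k) > c0. By the maximum principle along the
    orbit of u_k, each layer below u_k contains a point of u_k + tau Z where g
    > c0 / 2. The residues of the u_k modulo tau accumulate at some beta, and
    the uniform continuity of g on half-lines bounded above transfers these
    points to beta + tau Z. *)
Lemma lattice_visits (R : realType) n (p a : 'I_n -> R) (F : R -> R[i]) (tau c0 : R) :
  (forall j, 0 <= p j) -> \sum_j p j = 1 -> 0 < \sum_j p j * a j -> 0 < tau ->
  (forall j, on_lattice tau (a j)) ->
  (forall t, sqmod (F t) <= 1) -> sq_uniform_continuous F ->
  (forall u, sqmod (F (expR u)) <= \sum_j p j * sqmod (F (expR (u - a j)))) ->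
  0 < c0 -> (forall A, exists2 u, A <= u & c0 < sqmod (F (expR u))) ->
  exists beta step : R, forall A, exists2 k : int,
    A - step <= beta + k%:~R * tau <= A + step &
    c0 / 4 <= sqmod (F (expR (beta + k%:~R * tau))).
Proof.
move=> p0 p1 drift tau0 la F1 Fc sub c00 big; pose g u := sqmod (F (expR u)).
have /choice[u uP] : forall n : nat, exists u, n%:R <= u /\ c0 < g u.
  by move=> k; have [u] := big k%:R; exists u.
pose q k := Num.floor (u k / tau).
pose x k := u k - (q k)%:~R * tau.
have [k|beta hbeta] := @bounded_sequence_cluster R x 0 tau.
  have /andP[] := real_floor_itv (num_real (u k / tau)).
  rewrite -/(q k) ler_pdivlMr// ltr_pdivrMr// intrD mulrDl mul1r /x => h1 h2.
  by apply/andP; split; lra.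
pose step := \sum_j `|a j|.
have astep j : a j <= step.
  by apply: (le_trans (ler_norm _)); rewrite /step (bigD1 j)//= lerDl sumr_ge0.
exists beta, (step + 1) => A.
have c4 : 0 < c0 / 4 by rewrite divr_gt0.
have [w w0 hw] := log_uniform_continuous F1 Fc (A + 1) c4.
have rho0 : 0 < Num.min w 1 by rewrite lt_min w0 ltr01.
have [k Ak] := hbeta _ (Num.bound `|A|) rho0; rewrite lt_min => /andP[xw x1].
have [uk gk] := uP k.
have Au : A <= u k.
  apply: le_trans uk; apply: (le_trans (ler_norm _)).
  by apply: (@le_trans _ _ (Num.bound `|A|)%:R); rewrite ?ler_nat// ltW// archi_boundP.
have [l /andP[l1 l2] gl] : exists2 l : int, A - step <= u k + l%:~R * tau < A &
    c0 / 2 < g (u k + l%:~R * tau).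
  apply: contrapT => nl; have : g (u k) <= c0 / 2; last by lra.
  apply: (@maximum_principle R _ p a (fun v => exists l : int, v = u k + l%:~R * tau)
    g A step (c0 / 2) 1) => //.
  - move=> j _ [l ->]; have [m ->] := la j; exists (l - m).
    by rewrite rmorphB mulrBl addrA.
  - by move=> v; exact: F1.
  - by move=> v _ _; exact: sub.
  - move=> _ [l ->] v1 v2; rewrite leNgt; apply/negP => gv.
    by apply: nl; exists l; rewrite ?v1.
  - by exists 0; rewrite mul0r addr0.
have yE : u k + l%:~R * tau - (beta + (q k + l)%:~R * tau) = x k - beta.
  by rewrite /x rmorphD /=; ring.
move: (x1); rewrite ltr_norml => /andP[x1a x1b].
exists (q k + l); first by apply/andP; split; lra.
have : `|g (u k + l%:~R * tau) - g (beta + (q k + l)%:~R * tau)| < c0 / 4.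
  by apply: hw; rewrite ?yE//; lra.
by rewrite ltr_norml => /andP[_]; move: gl; rewrite /g; lra.
Qed.

Lemma lattice_defect_null (R : realType) (F : R -> R[i]) (beta tau x b : R) :
  approx_symmetry (finite_lattice_sum beta tau) (on_lattice tau) F x b ->
  forall eps, 0 < eps -> exists N : nat, forall k : nat, (N <= k)%N ->
    defect F x b (beta + k%:R * tau) < eps.
Proof.
move=> [_ [C hC]] eps e0; have e2 : 0 < eps / 2 by rewrite divr_gt0.
have hC' n : \sum_(i < n) defect F x b (beta + i%:R * tau) <= C.
  by apply: le_trans (hC 0 n); under [leRHS]eq_bigr do rewrite add0r.
have [N hN] := small_tails (e := fun k => defect F x b (beta + k%:R * tau))
  (fun k => sqmod_ge0 _) hC' e2.
exists N => k /(hN _ 1%N); rewrite big_ord1 addn0; lra.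
Qed.

(** The defects of approximate symmetries tend to 0 along beta + tau Z, so that
    |F(exp(u))| and |F(exp(u - k tau))| are asymptotically equal for each fixed
    k. As g is bounded below at points of this lattice with bounded gaps
    ([lattice_visits]), it is bounded below at all its large points. The number
    y0 is the fixed point of an approximate symmetry of ratio expR (- tau).
    Composing the j-th map of the system with a power of this symmetry of
    inverse ratio gives the translation by b j + expR (- a j) * y0 - y0; as g
    is bounded below, [approx_translation] bounds the sum of the |e(t d) - 1|^2
    alone. *)
Theorem lattice_scales_resonance (R : realType) n (p a b : 'I_n -> R)
    (F : R -> R[i]) (tau c0 : R) (m : 'I_n -> int) :
  (forall j, 0 < p j) -> \sum_j p j = 1 -> 0 < \sum_j p j * a j -> 0 < tau ->
  (forall j, on_lattice tau (a j)) -> tau = \sum_j (m j)%:~R * a j ->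
  (forall t, sqmod (F t) <= 1) -> sq_uniform_continuous F ->
  log_equation p a b F ->
  0 < c0 -> (forall A, exists2 u, A <= u & c0 < sqmod (F (expR u))) ->
  exists alpha y0 : R, [/\ 0 < alpha,
    exists2 c, 0 < c & exists k0 : nat, forall k, (k0 <= k)%N ->
      c <= sqmod (F (alpha * expR tau ^+ k)) &
    forall j, exists C, forall l, \sum_(i < l)
      sqmod (e2pi (alpha * (b j + expR (- a j) * y0 - y0) * expR tau ^+ i) - 1) <= C].
Proof.
move=> p0 p1 drift tau0 la tauE F1 Fc FE c00 big.
have p0' j : 0 <= p j by exact: ltW.
have sub u : sqmod (F (expR u)) <= \sum_j p j * sqmod (F (expR (u - a j))).
  rewrite {1}FE; apply: le_trans (sqmod_convex _ p0' p1) _.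
  by apply: ler_sum => j _; rewrite sqmodM sqmod_e2pi mul1r.
have [beta [step visits]] := lattice_visits p0' p1 drift tau0 la F1 Fc sub c00 big.
have cls := finite_lattice_sum_class beta tau.
have fe := finite_lattice_sum_energy beta p0' p1 F1 la.
have gen j := approx_symmetry_generator cls p0 p1 FE fe la j.
pose Good := approx_symmetry (finite_lattice_sum beta tau) (on_lattice tau) F.
have expE k : expR (beta + k%:R * tau) = expR beta * expR tau ^+ k.
  by rewrite expRD expRM_natl.
have [b0 gb0] := approx_symmetry_group cls p0 p1 FE fe la m; rewrite -tauE in gb0.
have lam1 : 1 - expR (- tau) != 0.
  by rewrite subr_eq0 eq_sym -(expR0 R) (inj_eq (@expR_inj R)) oppr_eq0 gt_eqF.
pose y0 := b0 / (1 - expR (- tau)).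
pose P x := Good x (y0 * (1 - expR (- x))).
have PD x y : P x -> P y -> P (x + y).
  move=> Px Py; rewrite /P /Good.
  have -> : y0 * (1 - expR (- (x + y))) =
      y0 * (1 - expR (- x)) + expR (- x) * (y0 * (1 - expR (- y))).
    by rewrite opprD expRD; ring.
  exact: (approx_symmetry_comp cls Px Py).
have PN x : P x -> P (- x).
  move=> Px; rewrite /P /Good opprK.
  have -> : y0 * (1 - expR x) = - (expR x * (y0 * (1 - expR (- x)))).
    by rewrite -[in LHS](expRxMexpNx_1 x); ring.
  exact: (approx_symmetry_inv cls Px).
have Ptau : P tau by rewrite /P /y0 divfK.
have Pint (k : int) : P (k%:~R * tau).
  have Pnat (l : nat) : P (l%:R * tau).
    elim: l => [|l IH].
      by rewrite mul0r -(subrr tau); apply: (PD) => //; exact: PN.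
    by rewrite -natr1 mulrDl mul1r; exact: PD.
  case: k => l; first exact: Pnat.
  by rewrite NegzE rmorphN mulNr; apply: (PN); exact: Pnat.
exists (expR beta), y0; rewrite expR_gt0.
pose c := c0 / 16.
have c16 : 0 < c by rewrite divr_gt0.
have lower : exists k0 : nat, forall k, (k0 <= k)%N ->
    c <= sqmod (F (expR (beta + k%:R * tau))).
  (* Every point of the lattice has a visit less than W steps away, which
     leaves finitely many shifts to consider. *)
  pose W := (Num.bound (`|step| / tau)).+1.
  have Wtau : `|step| < W%:R * tau - tau.
    rewrite -natr1 mulrDl mul1r addrK -ltr_pdivrMr//.
    by apply: archi_boundP; rewrite divr_ge0// ltW.
  have /choice[N hN] : forall l : nat, exists N, forall k : nat, (N <= k)%N ->
      defect F ((l%:Z - W%:Z)%:~R * tau) (y0 * (1 - expR (- ((l%:Z - W%:Z)%:~R * tau))))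
        (beta + k%:R * tau) < c.
    by move=> l; exact: (lattice_defect_null (Pint (l%:Z - W%:Z)) c16).
  exists (\max_(l < W.*2.+1) N l + W)%N => k hk.
  have [k' /andP[k'1 k'2] gk'] := visits (beta + k%:R * tau).
  have st := ler_norm step.
  have d1 : ((k%:Z - k')%:~R : R) < W%:~R.
    rewrite -(ltr_pM2r tau0) rmorphB mulrBl /=; lra.
  have d2 : ((k' - k%:Z)%:~R : R) < W%:~R.
    rewrite -(ltr_pM2r tau0) rmorphB mulrBl /=; lra.
  rewrite !ltr_int in d1 d2.
  have k'0 : 0 <= k' by lia.
  case: k' k'0 k'1 k'2 gk' d1 d2 => // k' _ _ _ gk' d1 d2.
  pose l := (k' + W - k)%N.
  have lW : (l < W.*2.+1)%N by rewrite /l; lia.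
  have lE : l%:Z - W%:Z = k'%:Z - k%:Z by rewrite /l; lia.
  have Nk' : (N l <= k')%N.
    have h : (N l <= \max_(i < W.*2.+1) N i)%N.
      exact: (@leq_bigmax _ (fun i : 'I_(W.*2.+1) => N i) (Ordinal lW)).
    by move: (\max_(i < _) _) hk d1 h => mx; clear; lia.
  have := hN l k' Nk'; rewrite lE /defect.
  have -> : beta + k'%:R * tau - (k'%:Z - k%:Z)%:~R * tau = beta + k%:R * tau.
    by rewrite rmorphB /=; ring.
  set z := e2pi _ * F _ => h.
  have := sqmod_le_near (F (expR (beta + k'%:R * tau))) z.
  have -> : sqmod z = sqmod (F (expR (beta + k%:R * tau))).
    by rewrite sqmodM sqmod_e2pi mul1r.
  by move: gk' h; rewrite /c -pmulrn; lra.
have [k0 hk0] := lower.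
split=> //; first by exists c => //; exists k0 => k; rewrite -expE; exact: hk0.
move=> j; have [l laj] := la j.
have : Good 0 (b j + expR (- a j) * y0 - y0).
  have := approx_symmetry_comp cls (gen j) (PN _ (Pint l)); rewrite -laj subrr opprK.
  congr (approx_symmetry _ _ _ _ _); have := expRxMexpNx_1 (a j).
  by move: (expR _) (expR _) => e e' ee'; rewrite -[y0 in RHS]mul1r -ee'; ring.
move/(approx_translation) => [C hC].
exists (k0%:R * 4 + C / c) => l'.
set t := b j + _ - _ in hC *.
pose s (i : nat) := sqmod (e2pi (expR beta * t * expR tau ^+ i) - 1).
have s0 i : 0 <= s i by exact: sqmod_ge0.
apply: (@le_trans _ _ (\sum_(i < k0 + l') s i)).
  rewrite addnC big_split_ord /= lerDl; apply: sumr_ge0 => i _; exact: s0.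
rewrite big_split_ord /=; apply: lerD.
  have -> : k0%:R * 4 = \sum_(i < k0) (4 : R).
    by rewrite sumr_const card_ord mulr_natl.
  apply: ler_sum => i _; rewrite /s.
  have := sqmodB_le (e2pi (expR beta * t * expR tau ^+ i)) 1.
  by rewrite sqmod_e2pi /sqmod /= expr0n /= addr0 expr1n; lra.
rewrite ler_pdivlMr// mulr_suml; apply: le_trans (hC k0%:Z l').
apply: ler_sum => i _; rewrite -PoszD -pmulrn expE /s.
rewrite [expR beta * _ ^+ _ * t]mulrAC; apply: ler_wpM2l; first exact: sqmod_ge0.
by rewrite -expE; apply: hk0; exact: leq_addr.
Qed.

(** * The characterization *)

Lemma cvg0_sqmod (R : realType) (T : Type) (Ff : set_system T) (FF : Filter Ff)
    (f : T -> R[i]^o) :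
  f x @[x --> Ff] --> (0 : R[i]^o) <->
  forall eps : R, 0 < eps -> \forall x \near Ff, sqmod (f x) < eps.
Proof.
have normE (z : R[i]^o) (e : R) : 0 < e -> (`|z| < e%:C) = (sqmod z < e ^+ 2).
  move=> e0; rewrite normc_def ltcR -/(sqmod z).
  rewrite -[in RHS](sqr_sqrtr (sqmod_ge0 z)) ltr_pXn2r//.
  - by rewrite nnegrE sqrtr_ge0.
  - by rewrite nnegrE ltW.
split=> [/cvgr0Pnorm_lt h eps e0|h].
  have se : 0 < Num.sqrt eps by rewrite sqrtr_gt0.
  have se' : 0 < (Num.sqrt eps)%:C by rewrite ltcR.
  have := h _ se'; apply: filterS => x.
  by rewrite normE// sqr_sqrtr// ltW.
apply/cvgr0Pnorm_lt => e; rewrite ltcE /= => /andP[/eqP eI eR].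
have e2 : 0 < complex.Re e ^+ 2 by rewrite exprn_gt0.
have := h _ e2; apply: filterS => x hx.
have -> : e = (complex.Re e)%:C by case: e eI {eR e2 hx} => x' y' /= ->.
by rewrite normE.
Qed.

Lemma rajchmanP (R : realType) (nu : probability (measurableTypeR R) R) :
  rajchman nu <-> forall eps, 0 < eps -> exists A, forall t, A <= t ->
    sqmod (fourier nu t) < eps.
Proof.
rewrite /rajchman cvg0_sqmod; split=> h eps e0.
  have [A [_ hA]] := h _ e0; exists (A + 1) => t At; apply: hA.
  by apply: lt_le_trans At; rewrite ltrDl.
have [A hA] := h _ e0; exists A; split; first exact: num_real.
by move=> t /ltW; exact: hA.
Qed.

Lemma e2pi_int (R : realType) (k : int) : e2pi (k%:~R : R) = 1.
Proof.
have e1 : e2pi (1 : R) = 1.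
  rewrite /e2pi mulr1; congr (_ +i* _).
    by rewrite mulr_natl cos2pi.
  by rewrite mulr_natl sin2pi.
have enat (n : nat) : e2pi (n%:R : R) = 1.
  elim: n => [|n IH]; first exact: e2pi0.
  by rewrite -natr1 e2piD IH e1 mulr1.
case: k => n; first exact: enat.
have := e2piNK (n.+1%:R : R).
by rewrite enat mul1r NegzE rmorphN.
Qed.

(** The mean value theorem for the sine, whose derivative decreases on [0, pi].
    *)
Lemma mul_cos_le_sin (R : realType) (z : R) : 0 <= z <= pi -> z * cos z <= sin z.
Proof.
move=> /andP[z0 zpi].
have dsin (x : R) : x \in `]0, z[ -> is_derive x 1 sin (cos x).
  by move=> _; exact: is_derive_sin.
have [c + cE] := MVT_segment z0 dsin (continuous_subspaceT (@continuous_sin R)).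
rewrite in_itv /= => /andP[c0 cz].
move: cE; rewrite sin0 !subr0 => ->; rewrite mulrC ler_wpM2r//.
rewrite leNgt ltr_cos -?leNgt//; rewrite in_itv /=; apply/andP; split; lra.
Qed.

Lemma sqr_le_e2pi (R : realType) (y : R) : `|y| <= 1 / 2 ->
  y ^+ 2 <= sqmod (e2pi y - 1).
Proof.
move=> y2; rewrite sqmod_e2pi_sub1 -(real_normK (num_real y)).
have -> : cos (2 * pi * y) = cos (2 * pi * `|y|).
  rewrite -cos_norm normrM (@ger0_norm _ (2 * pi))// mulr_ge0// pi_ge0//.
move: (normr_ge0 y) y2; move: `|y| => {}y y0 y2.
have pi2 := @pi_ge2 R.
have half z : 2 * pi * z = (pi * z) *+ 2 by rewrite mulr2n; ring.
(* Beyond 1 / 4 the cosine is nonpositive; below, sin z >= z cos z and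
   2 (cos z)^2 >= 1 for z = pi y. *)
have [y4|y4] := leP y (1 / 4); last first.
  have : cos (2 * pi * y) <= 0.
    rewrite -(@cos_pihalf R) leNgt ltr_cos -?leNgt//; last 2 first.
    - by rewrite in_itv /=; apply/andP; split; nra.
    - by rewrite in_itv /=; apply/andP; split; nra.
    by nra.
  by rewrite expr2; nra.
have c0 : 0 <= cos (2 * pi * y).
  by apply: cos_ge0_pihalf; apply/andP; split; nra.
have zpi : 0 <= pi * y <= pi by apply/andP; split; nra.
have := mul_cos_le_sin zpi.
have := cos2Dsin2 (pi * y).
rewrite half cos_mulr2n in c0 *; move: c0.
rewrite [cos (pi * y) ^+ 2 *+ 2]mulr2n.
have cos0 : 0 <= cos (pi * y) by apply: cos_ge0_pihalf; apply/andP; split; nra.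
have z0 : 0 <= pi * y by rewrite mulr_ge0//; lra.
have zy : y <= pi * y by nra.
move: cos0 z0 zy; move: (pi * y) => z; move: (cos z) (sin z) => c s.
move=> c0 z0 yz h1 h2 h3.
have : y ^+ 2 <= z ^+ 2 by rewrite lerXn2r.
have : (z * c) ^+ 2 <= s ^+ 2.
  by rewrite lerXn2r// nnegrE ?mulr_ge0//; apply: le_trans h3; rewrite mulr_ge0.
rewrite exprMn; have := sqr_ge0 z; move: (z ^+ 2) (y ^+ 2) (c ^+ 2) (s ^+ 2) h1 h2.
by move=> Z Y C S; nra.
Qed.

Lemma exists_nearest_int (R : realType) (x : R) :
  exists u : int, (x - u%:~R) ^+ 2 <= sqmod (e2pi x - 1).
Proof.
pose u := Num.floor (x + 1 / 2); exists u.
have /andP[] := real_floor_itv (num_real (x + 1 / 2)).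
rewrite -/u intrD => h1 h2.
have -> : e2pi x = e2pi (x - u%:~R).
  by rewrite -[RHS]mulr1 -(e2pi_int R u) -e2piD subrK.
by apply: sqr_le_e2pi; rewrite ler_norml; apply/andP; split; lra.
Qed.

Section InvariantFourier.
Context (R : realType) (N : nat) (p r b : 'I_N.+1 -> R).
Context (nu : probability (measurableTypeR R) R).
Hypothesis p_gt0 : forall j, 0 < p j.
Hypothesis p_sum : \sum_j p j = 1.
Hypothesis r_gt0 : forall k, 0 < r k.
Hypothesis contr : \sum_j p j * ln (r j) < 0.
Hypothesis nu_inv : invariant_measure p (fun k => affine (r k) (b k)) nu.

Lemma log_drift : 0 < \sum_j p j * (- ln (r j)).
Proof. by under eq_bigr do rewrite mulrN; rewrite sumrN oppr_gt0. Qed.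

Lemma expR_sub_ln j u : expR (u - - ln (r j)) = r j * expR u.
Proof. by rewrite opprK expRD lnK ?posrE// mulrC. Qed.

Lemma fourier_log_equation (c : 'I_N.+1 -> R) (w : probability (measurableTypeR R) R) :
  invariant_measure p (fun k => affine (r k) (c k)) w ->
  log_equation p (fun j => - ln (r j)) c (fourier w).
Proof.
move=> w_inv u.
rewrite (fourier_functional_equation (fun j => ltW (p_gt0 j)) p_sum w_inv).
by apply: eq_bigr => j _; rewrite expR_sub_ln.
Qed.

Lemma conj_affine (a c : R) : a != 0 ->
  conj_family a c (fun k => affine (r k) (b k)) =
  (fun k => affine (r k) (a * b k + c * (1 - r k))).
Proof.
move=> a0; apply/funext => k; apply/funext => x.
by rewrite /conj_family /affine /affine_inv /=; field.
Qed.

Lemma sq_continuous0_fourier (w : probability (measurableTypeR R) R) :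
  sq_continuous0 (fourier w).
Proof.
move=> eps /(fourier_uniform_continuous w)[d d0 h]; exists d => // t td.
by apply: h; rewrite subr0.
Qed.

Lemma sq_continuous0_affine (w : probability (measurableTypeR R) R) (a c : R) :
  sq_continuous0 (fun t => e2pi (c * t) * fourier w (a * t)).
Proof.
move=> eps e0; have e4 : 0 < eps / 4 by rewrite divr_gt0.
have [d d0 hd] := sq_continuous0_fourier w e4.
have : (fun x : R => 2 - 2 * cos (2 * pi * c * x)) x @[x --> 0] -->
    (2 - 2 * cos (2 * pi * c * 0) : R).
  apply: cvgB; first exact: cvg_cst.
  by apply: cvgMr; exact: continuous_cosM.
rewrite mulr0 cos0 mulr1 subrr => /cvgrPdist_lt/(_ _ e4)[d' /= d'0 hd'].
exists (Num.min d' (d / (`|a| + 1))).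
  by rewrite lt_min d'0 divr_gt0// ltr_wpDl.
move=> t; rewrite lt_min => /andP[td' td].
have h1 : sqmod (e2pi (c * t) - 1) < eps / 4.
  have := hd' t; rewrite /= !sub0r !normrN => /(_ td').
  by rewrite sqmod_e2pi_sub1 mulrA; apply: le_lt_trans; exact: ler_norm.
have h2 : sqmod (fourier w (a * t) - fourier w 0) < eps / 4.
  apply: hd; rewrite normrM.
  rewrite ltr_pdivlMr ?ltr_wpDl// in td; apply: le_lt_trans td.
  by rewrite mulrC ler_wpM2l// lerDl.
rewrite !mulr0 e2pi0 mul1r fourier0 in h2 *.
have -> : e2pi (c * t) * fourier w (a * t) - 1 =
    e2pi (c * t) * (fourier w (a * t) - 1) + (e2pi (c * t) - 1).
  by rewrite mulrBr mulr1 addrA subrK.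
apply: (le_lt_trans (sqmodD_le _ _)).
by rewrite sqmodM sqmod_e2pi mul1r; lra.
Qed.

(** Both sides solve the functional equation of the conjugate system. *)
Lemma fourier_affine_image (w : probability (measurableTypeR R) R) (a c : R) :
  a != 0 ->
  invariant_measure p (conj_family a c (fun k => affine (r k) (b k))) w ->
  forall t, 0 < t -> fourier w t = e2pi (c * t) * fourier nu (a * t).
Proof.
move=> a0; rewrite conj_affine// => w_inv.
apply: (@log_equation_unique _ _ p (fun j => - ln (r j))
  (fun k => a * b k + c * (1 - r k)) (fourier w)
  (fun t => e2pi (c * t) * fourier nu (a * t))).
- by move=> j; exact: ltW.
- exact: p_sum.
- exact: log_drift.
- exact: sqmod_fourier_le1.
- by move=> t; rewrite sqmodM sqmod_e2pi mul1r; exact: sqmod_fourier_le1.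
- exact: sq_continuous0_fourier.
- exact: sq_continuous0_affine.
- by rewrite !mulr0 e2pi0 mul1r !fourier0.
- exact: fourier_log_equation.
- move=> u; rewrite (fourier_functional_equation (fun j => ltW (p_gt0 j)) p_sum nu_inv).
  rewrite mulr_sumr; apply: eq_bigr => j _; rewrite expR_sub_ln.
  rewrite mulrCA; congr (_ * _); rewrite !mulrA -!e2piD.
  by congr (e2pi _ * fourier nu _); ring.
Qed.

End InvariantFourier.

Lemma exprn_unbounded (R : realType) (theta A : R) : 1 < theta ->
  exists K : nat, forall k, (K <= k)%N -> A <= theta ^+ k.
Proof.
move=> th1; have d0 : 0 < theta - 1 by rewrite subr_gt0.
exists (Num.bound (`|A| / (theta - 1))) => k hk.
have bern : 1 + k%:R * (theta - 1) <= theta ^+ k.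
  elim: k {hk} => [|k IH]; first by rewrite mul0r addr0.
  rewrite exprS -natr1; have k0 : 0 <= k%:R :> R by exact: ler0n.
  have h1 := mulr_ge0 k0 (sqr_ge0 (theta - 1)); rewrite expr2 in h1.
  have h2 : theta * (1 + k%:R * (theta - 1)) <= theta * theta ^+ k.
    by rewrite ler_pM2l// (lt_trans ltr01).
  by move: h1 h2; lra.
apply: le_trans bern; apply: (le_trans (ler_norm _)).
apply: (@le_trans _ _ (k%:R * (theta - 1))); last by rewrite lerDr.
rewrite -ler_pdivrMr//; apply: ltW.
apply: (@lt_le_trans _ _ (Num.bound (`|A| / (theta - 1)))%:R).
  by apply: archi_boundP; rewrite divr_ge0// ltW.
by rewrite ler_nat.
Qed.

Lemma exists_int_approximation (R : realType) (theta x C : R) :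
  (forall l, \sum_(i < l) sqmod (e2pi (x * theta ^+ i) - 1) <= C) ->
  exists u : nat -> int, forall l,
    \sum_(i < l) (x * theta ^+ i - (u i)%:~R) ^+ 2 <= C.
Proof.
move=> hC.
have /choice[u hu] := fun i : nat => exists_nearest_int (x * theta ^+ i).
exists u => l; apply: le_trans (hC l); apply: ler_sum => i _; exact: hu.
Qed.

Lemma expR_intM (R : realType) (k : int) (x : R) : expR (k%:~R * x) = expR x ^ k.
Proof.
case: k => k; first exact: expRM_natl.
by rewrite [in LHS]NegzE rmorphN mulNr expRN; congr (_^-1); exact: expRM_natl.
Qed.

Theorem theorem2p3 (R : realType) (N : nat) (p r b : 'I_N.+1 -> R)
    (nu : probability (measurableTypeR R) R)
    (hN : (1 <= N)%N)
    (p_gt0 : forall j, 0 < p j)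
    (p_sum : \sum_j p j = 1)
    (r_gt0 : forall k, 0 < r k)
    (no_fix : ~ exists x : R, forall k, affine (r k) (b k) x = x)
    (contr : \sum_j p j * ln (r j) < 0)
    (nu_inv : invariant_measure p (fun k => affine (r k) (b k)) nu) :
  ~ rajchman nu <->
  exists a c : R, a != 0 /\
    exists lambda : R,
      pisot_form lambda (conj_family a c (fun k => affine (r k) (b k))) /\
      exists w : probability (measurableTypeR R) R,
        invariant_measure p
          (conj_family a c (fun k => affine (r k) (b k))) w /\
        ~ (fourier w (lambda ^- k) @[k --> \oo] --> 0).
Proof.
split; last first.
  move=> [a [c [a0 [lambda [[[th1 _ _] _] [w [w_inv wn]]]]]]] raj; apply: wn.
  rewrite cvg0_sqmod => eps e0.
  have [A hA] := (rajchmanP nu).1 raj eps e0.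
  have th0 : 0 < lambda^-1 by rewrite (lt_trans ltr01).
  have [K hK] := exprn_unbounded (A / `|a|) th1.
  exists K => // k /= /hK Ak.
  rewrite -exprVn.
  rewrite (fourier_affine_image p_gt0 p_sum r_gt0 contr nu_inv a0 w_inv) ?exprn_gt0//.
  rewrite sqmodM sqmod_e2pi mul1r.
  have aA : A <= `|a| * lambda^-1 ^+ k.
    by rewrite mulrC -ler_pdivrMr ?normr_gt0.
  have := hA _ aA; case: (ger0P a) => // _.
  by rewrite mulNr sqmod_fourierN.
move=> nraj; pose ell j := - ln (r j).
have rE j : expR (- ell j) = r j by rewrite opprK lnK// posrE.
have drift := log_drift contr.
have F1 := sqmod_fourier_le1 nu.
have Fc : sq_uniform_continuous (fourier nu) := @fourier_uniform_continuous _ nu.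
have FE := fourier_log_equation p_gt0 p_sum r_gt0 nu_inv.
have no_decay : ~ forall eps, 0 < eps -> exists A, forall u, A <= u ->
    sqmod (fourier nu (expR u)) <= eps.
  move=> decay; apply: nraj; apply/rajchmanP => eps e0.
  have e2 : 0 < eps / 2 by rewrite divr_gt0.
  have [A hA] := decay _ e2; exists (expR A) => t tA.
  have t0 : 0 < t by apply: lt_le_trans tA; exact: expR_gt0.
  have : sqmod (fourier nu (expR (ln t))) <= eps / 2.
    by apply: hA; rewrite -ler_expR lnK.
  by rewrite lnK//; lra.
have [j0 lj0] : exists j, ell j != 0.
  apply: contrapT => /forallNP l0; move: drift; rewrite big1 ?ltxx// => j _.
  by have /negP/negPn/eqP := l0 j; rewrite /ell => ->; rewrite mulr0.
have no_fix' : ~ exists x, forall k, affine (expR (- ell k)) (b k) x = x.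
  by move=> [x hx]; apply: no_fix; exists x => k; rewrite -rE.
have [dense|[tau [tau0 [m tauE] cyc]]] := generated_group_dense_or_cyclic lj0.
  case: no_decay.
  exact: (dense_scales_decay p_gt0 p_sum drift F1 Fc FE no_fix' dense).
have [c0 c00 big] : exists2 c0, 0 < c0 & forall A, exists2 u, A <= u &
    c0 < sqmod (fourier nu (expR u)).
  apply: contrapT => nbig; apply: no_decay => eps e0.
  apply: contrapT => /forallNP nA; apply: nbig; exists eps => // A.
  have /existsNP[u] := nA A; move=> /not_implyP[Au /negP].
  by rewrite -ltNge; exists u.
have [alpha [y0 [alpha0 [c c_gt0 [k0 lower]] res]]] :=
  lattice_scales_resonance p_gt0 p_sum drift tau0 cyc tauE F1 Fc FE c00 big.
set theta := expR tau in lower res.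
have th1 : 1 < theta by rewrite expR_gt1.
have alphan0 : alpha != 0 by rewrite gt_eqF.
pose mu j := alpha * (b j + r j * y0 - y0).
have /choice[n nE] := cyc.
have approx j : exists (u : nat -> int) (C : R), forall l,
    \sum_(i < l) (mu j * theta ^+ i - (u i)%:~R) ^+ 2 <= C.
  have [C hC] := res j.
  have hC' l : \sum_(i < l) sqmod (e2pi (mu j * theta ^+ i) - 1) <= C.
    by rewrite /mu -rE.
  by have [u hu] := exists_int_approximation hC'; exists u, C.
have pisot_mu j : mu j != 0 -> pisot theta /\ Qadjoin theta (mu j).
  by have [u [C hu]] := approx j => mu0; exact: (pisot_of_sum_sqr th1 mu0 hu).
have [j1 muj1] : exists j, mu j != 0.
  apply: contrapT => /forallNP mu0; apply: no_fix; exists y0 => k.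
  have /negP/negPn := mu0 k; rewrite mulf_eq0 (negPf alphan0)/= subr_eq0.
  by rewrite /affine addrC => /eqP.
have [pisot_theta _] := pisot_mu j1 muj1.
(* The conjugation moves y0 to 0, then rescales by alpha. *)
exists alpha, (- (alpha * y0)); split=> //; exists theta^-1; split.
  split; first by rewrite invrK.
  exists n, mu; split.
  - apply: (@coprime_of_bezout _ n m); apply/eqP; rewrite -(eqr_int R).
    apply/eqP; have taun0 : tau != 0 by rewrite gt_eqF.
    apply: (mulIf taun0); rewrite mul1r [RHS]tauE rmorph_sum mulr_suml.
    by apply: eq_bigr => j _; rewrite nE rmorphM mulrA.
  - move=> k; rewrite invrK; have [u [C hu]] := approx k.
    apply: (Tset_of_null pisot_theta _ (null_of_sum_sqr hu)).
    have [->|/pisot_mu[]//] := eqVneq (mu k) 0.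
    by rewrite -(rmorph0 ratr); exact: Qadjoin_rat.
  - move=> j x; rewrite conj_affine// /affine.
    have -> : theta^-1 ^ n j = r j.
      by rewrite -rE nE expRN expR_intM invr_expz exprz_inv.
    by rewrite /mu; ring.
have [w w_inv] := exists_affine_image (- (alpha * y0)) alphan0 nu_inv.
exists w; split=> //; rewrite cvg0_sqmod => /(_ _ c_gt0)[K _ hK].
have := hK (maxn K k0) (leq_maxl _ _); apply/negP; rewrite -leNgt /=.
rewrite exprVn invrK.
rewrite (fourier_affine_image p_gt0 p_sum r_gt0 contr nu_inv alphan0 w_inv);
  last first.
  by rewrite exprn_gt0// expR_gt0.
by rewrite sqmodM sqmod_e2pi mul1r; apply: lower; exact: leq_maxr.
Qed.
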